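(* Let $A$ be a division Albert algebra over $K$ and let $L,L'\subset A$ be separable cubic field extensions of $K$ that are isomorphic over $K$. Then there exist a $9$-dimensional subalgebra $B_\sigma^+\subset A$ containing $L$ and $L'$ and an element $s\in\mathbf{Str}(A)(K)$ stabilizing $B_\sigma^+$ such that $s(L)=L'$. In particular there exists $g\in\mathbf{Str}(A)(K)$ with $g(L)=L'$.
   Context: $K$ is an infinite field of characteristic different from $2$ and $3$. A division Albert algebra is a $27$-dimensional exceptional Jordan algebra with anisotropic cubic norm $N$; $\mathbf{Str}(A)(K)$ is the group of $K$-linear bijections $x$ of $A$ with $N(x(a))=\nu(x)N(a)$ for a scalar $\nu(x)$ (functorially). Its $9$-dimensional subalgebras are of the form $B_\sigma^+$ ($\sigma$-symmetric elements of a degree $3$ algebra $B$ over a quadratic étale $E/K$ with involution of the second kind, Jordan product $\tfrac12(xy+yx)$). *)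

(* Defs.v *)
From HB Require Import structures.
From mathcomp Require Import all_boot all_order all_algebra all_field.
Set Implicit Arguments. Unset Strict Implicit. Unset Printing Implicit Defensive.
Import Order.TTheory GRing.Theory.
Local Open Scope ring_scope.

Section AlbertDefs.
Variable K : fieldType.
Variable A : vectType K.

(* Polynomial functions on A of given degree, expressed in the coordinates
   of the standard basis vbasis {:A} (basis-independent notion). *)
Definition is_linear_form (T : A -> K) : Prop :=
  exists c : 'I_(\dim {:A}) -> K,
    forall v, T v = \sum_i c i * coord (vbasis {:A}) i v.

Definition is_quadratic_form (S : A -> K) : Prop :=
  exists c : 'I_(\dim {:A}) -> 'I_(\dim {:A}) -> K,
    forall v, S v = \sum_i \sum_j
      c i j * coord (vbasis {:A}) i v * coord (vbasis {:A}) j v.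

Definition is_cubic_form (N : A -> K) : Prop :=
  exists c : 'I_(\dim {:A}) -> 'I_(\dim {:A}) -> 'I_(\dim {:A}) -> K,
    forall v, N v = \sum_i \sum_j \sum_k
      c i j k * coord (vbasis {:A}) i v * coord (vbasis {:A}) j v
              * coord (vbasis {:A}) k v.

Definition jordan_algebra (mul : A -> A -> A) (one : A) : Prop :=
  [/\ forall x y, mul x y = mul y x,
      forall x (a : K) y z, mul x (a *: y + z) = a *: mul x y + mul x z,
      forall x, mul one x = x &
      forall x y, mul (mul (mul x x) y) x = mul (mul x x) (mul y x)].

(* (A, mul, one) is a division Albert algebra with cubic norm N:
   a 27-dimensional Jordan algebra of degree 3 (generic cubic
   Cayley-Hamilton equation x^3 - T(x)x^2 + S(x)x - N(x)1 = 0 with T linear,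
   S quadratic, N cubic, N(1) = 1) whose cubic norm N is anisotropic. *)
Definition division_albert (mul : A -> A -> A) (one : A) (N : A -> K) : Prop :=
  [/\ jordan_algebra mul one,
      \dim {:A} = 27%N,
      is_cubic_form N /\ N one = 1,
      (exists (T S : A -> K), [/\ is_linear_form T, is_quadratic_form S &
          forall x, mul x (mul x x) - T x *: mul x x + S x *: x - N x *: one = 0])
    & forall x, N x = 0 -> x = 0].

Definition in_Str (N : A -> K) (s : 'End(A)) : Prop :=
  bijective s /\ exists nu : K, forall a, N (s a) = nu * N a.

Definition is_subalgebra (mul : A -> A -> A) (one : A) (B : {vspace A}) : Prop :=
  one \in B /\ forall x y, x \in B -> y \in B -> mul x y \in B.

Definition sep_cubic_subfield (mul : A -> A -> A) (one : A)
    (F : fieldExtType K) (phi : F -> A) (L : {vspace A}) : Prop :=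
  [/\ \dim {:F} = 3%N /\ separable 1%VS {:F},
      (forall (a : K) x y, phi (a *: x + y) = a *: phi x + phi y) /\ injective phi,
      phi 1 = one,
      forall x y, phi (x * y) = mul (phi x) (phi y) &
      forall v, v \in L <-> exists x, v = phi x].

End AlbertDefs.

(* Main.v *)
Require Import Defs.
From HB Require Import structures.
From mathcomp Require Import all_boot all_order all_algebra all_field.
From mathcomp Require Import ring.
From Stdlib Require Import Classical.
Import GRing.Theory.
Set Implicit Arguments. Unset Strict Implicit. Unset Printing Implicit Defensive.
Local Open Scope ring_scope.

(** Let N be the cubic norm, T the trace form and x # its adjoint on A. If t
generates L and t' = l + v generates L', with l in L and v orthogonal to L, then
L, L.v and L.v# span a 9-dimensional subalgebra H containing L and L'.

Let W be the orthogonal complement of H; H acts on W by a.w = - a x w, and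
w # = - q(w) + b(w) with q(w) in H and b(w) in W. For nonzero x in W let e be a
root of X^2 - N(x) X + N(q(x)). Over K(e), x1 = q(x).b(x) - e x satisfies
q(x1) = 0, and then A = H + H.x1 + H.x1# with a.(b.x1) = (a * b).x1 for an
alternative product * on H. It is associative by Artin's theorem, and
N(h + a.x1 + b.x1#) = N(h) + n N(a) + n^2 N(b) - n T(h * a * b) with n = N(x1):
this is a first Tits construction.

If e lies in K, then Skolem-Noether gives g with g t = t' g, and conjugation by
g on the three summands is the similarity. Otherwise the conjugation of K(e)/K
induces an involution s of the second kind on H_{K(e)}; then h |-> g h s(g) maps
L to L' because g s(g) commutes with t'. To extend it to A one needs y with
y u s(y) = N(g) N(s(g)) u and N(y) = N(g) N(s(g))^2. Counting dimensions gives
a nonzero m in H and a scalar k with m g - s(g) m = k u^-1; then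
r = u m g commutes with u s(g) m and y is a multiple of r (u s(g) m)^-1. *)

(** The associative product of H is not given: A is only a Jordan algebra of degree 3, and
    everything is read off from one identity, (x #) # = N(x) x fully linearised, by comparing
    components in H and in W. The identities are proved over a commutative ring with 6 invertible,
    and for a projection instead of a subspace, so that the same lemmas serve over K and over K(e).

    If e is not in K, then g exists only over K(e), and conjugation by g need not commute with s,
    whereas h |-> g h s(g) does, at the price of sending 1 to g s(g). The conditions on y come from
    extending this map: N(y) = N(g) N(s(g))^2 makes the norm scale by N(g) N(s(g)) on H.x1 as it
    does on H, and y u s(y) = N(g) N(s(g)) u says that the extension commutes with s, which swaps
    H.x1 and H.x1#. If some nonzero m satisfied m g = s(g) m, then y = N(s(g)) would do. The map m
    |-> m g - s(g) m may be injective on H; but then it reaches every skew element, in particular a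
    multiple of u^-1, an error mild enough to keep the needed elements commuting. *)

(* Square-zero extension of R by J, which turns an R-linear identity between
elements of J into an identity of a commutative ring, where ring applies. *)
Definition sqz (R : comNzRingType) (J : lmodType R) : Type := (R * J)%type.

Section SqzRing.
Variables (R : comNzRingType) (J : lmodType R).
Local Notation S := (sqz J).
HB.instance Definition _ := GRing.Zmodule.copy S (R * J)%type.
Definition sqz_mul (x y : S) : S := (x.1 * y.1, x.1 *: y.2 + y.1 *: x.2).
Definition sqz_one : S := (1, 0).
Fact sqz_mulA : associative sqz_mul.
Proof.
move=> [a u] [b v] [c w]; rewrite /sqz_mul /=; congr pair; first exact: mulrA.
by rewrite !scalerDr !scalerA addrA [c * a]mulrC [c * b]mulrC.
Qed.
Fact sqz_mulC : commutative sqz_mul.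
Proof. by move=> [a u] [b v]; rewrite /sqz_mul /= mulrC addrC. Qed.
Fact sqz_mul1 : left_id sqz_one sqz_mul.
Proof. by move=> [a u]; rewrite /sqz_mul /= mul1r scale1r scaler0 addr0. Qed.
Fact sqz_mulDl : left_distributive sqz_mul +%R.
Proof.
move=> [a u] [b v] [c w]; rewrite /sqz_mul /=; congr pair; first exact: mulrDl.
by rewrite /= scalerDl scalerDr addrACA.
Qed.
Fact sqz_one0 : sqz_one != 0.
Proof. by apply/eqP => -[] /eqP; rewrite oner_eq0. Qed.
HB.instance Definition _ := GRing.Zmodule_isComNzRing.Build S
  sqz_mulA sqz_mulC sqz_mul1 sqz_mulDl sqz_one0.

Definition sqz_vec (u : J) : S := (0, u).
Definition sqz_scal (a : R) : S := (a, 0).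
Fact sqz_scal_is_additive : zmod_morphism sqz_scal.
Proof. by move=> a b; rewrite /sqz_scal; congr pair; rewrite /= subr0. Qed.
Fact sqz_scal_is_multiplicative : monoid_morphism sqz_scal.
Proof.
split=> // a b; congr pair; by rewrite /= !scaler0 addr0.
Qed.
HB.instance Definition _ := GRing.isZmodMorphism.Build R S sqz_scal sqz_scal_is_additive.
HB.instance Definition _ := GRing.isMonoidMorphism.Build R S sqz_scal sqz_scal_is_multiplicative.
Lemma sqz_vec_inj (u v : J) : sqz_vec u = sqz_vec v -> u = v.
Proof. by case. Qed.
Lemma sqz_vecD u v : sqz_vec (u + v) = sqz_vec u + sqz_vec v.
Proof. by congr pair; rewrite /= addr0. Qed.
Lemma sqz_vecN u : sqz_vec (- u) = - sqz_vec u.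
Proof. by congr pair; rewrite /= oppr0. Qed.
Lemma sqz_vec0 : sqz_vec 0 = 0. Proof. by []. Qed.
Lemma sqz_vecMn u n : sqz_vec (u *+ n) = sqz_vec u *+ n.
Proof. by elim: n => [|n IH]; rewrite ?mulr0n // !mulrS sqz_vecD IH. Qed.
Lemma sqz_vecZ a u : sqz_vec (a *: u) = sqz_scal a * sqz_vec u.
Proof. by congr pair; rewrite /= ?mulr0 // scale0r addr0. Qed.
End SqzRing.

Definition sqz_vecE := (sqz_vecD, sqz_vecN, sqz_vec0, sqz_vecMn, sqz_vecZ).

Ltac mring := apply: sqz_vec_inj; rewrite !sqz_vecE; ring.

(** Meant to be applied backwards and repeatedly: each use subtracts [k] times a known equation from
    the goal, so a chain of calls spells out a linear combination that [mring] then verifies. *)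
Lemma lin_comb (R : comNzRingType) (J : lmodType R) (k : R) (p r u v : J) :
  p = r -> u - v = k *: (p - r) -> u = v.
Proof. by move=> -> /eqP; rewrite subrr scaler0 subr_eq0 => /eqP. Qed.

Lemma lin_comb_scal (R : comNzRingType) (k : R) (p r u v : R) :
  p = r -> u - v = k * (p - r) -> u = v.
Proof. by move=> -> /eqP; rewrite subrr mulr0 subr_eq0 => /eqP. Qed.

Arguments lin_comb {R J} k {p r u v}.
Arguments lin_comb_scal {R} k {p r u v}.

(** * Identities of alternative algebras *)

Section Alternative.
Variables (R : comNzRingType) (D : lmodType R) (m : D -> D -> D).
Hypothesis mDl : forall x y z, m (x + y) z = m x z + m y z.
Hypothesis mDr : forall x y z, m z (x + y) = m z x + m z y.
Hypothesis mNl : forall x z, m (- x) z = - m x z.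
Hypothesis mNr : forall x z, m z (- x) = - m z x.
Let mE := (mDl, mDr, mNl, mNr).
Hypothesis m_lalt : forall x y, m x (m x y) = m (m x x) y.
Hypothesis m_ralt : forall x y, m (m y x) x = m y (m x x).
Hypothesis double_inj : forall x : D, x + x = 0 -> x = 0.

Definition assoc x y z := locked (m (m x y) z - m x (m y z)).
Lemma assocE x y z : assoc x y z = m (m x y) z - m x (m y z).
Proof. by rewrite /assoc -lock. Qed.

Lemma m_lalt2 x y z : m x (m y z) + m y (m x z) = m (m x y + m y x) z.
Proof.
have E := m_lalt (x + y) z; rewrite !mE in E; rewrite !mE.
move: E; rewrite !m_lalt => E; apply: (lin_comb 1 E); mring.
Qed.
Lemma m_ralt2 x y z : m (m z x) y + m (m z y) x = m z (m x y + m y x).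
Proof.
have E := m_ralt (x + y) z; rewrite !mE in E; rewrite !mE.
move: E; rewrite !m_ralt => E; apply: (lin_comb 1 E); mring.
Qed.
Lemma assoc12 x y z : assoc x y z = - assoc y x z.
Proof.
rewrite !assocE; have E := m_lalt2 x y z; rewrite !mE in E.
apply: (lin_comb (-1) E); mring.
Qed.
Lemma assoc23 x y z : assoc x y z = - assoc x z y.
Proof.
rewrite !assocE; have E := m_ralt2 y z x; rewrite !mE in E.
apply: (lin_comb 1 E); mring.
Qed.
Lemma assoc13 x y z : assoc x y z = - assoc z y x.
Proof. by rewrite assoc12 assoc23 assoc12 !opprK. Qed.
Lemma assoc_eq12 x z : assoc x x z = 0.
Proof. by rewrite assocE m_lalt subrr. Qed.
Lemma assoc_eq13 x z : assoc x z x = 0.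
Proof. by rewrite assoc23 assoc_eq12 oppr0. Qed.
Lemma m_flex x y : m (m x y) x = m x (m y x).
Proof. by have := assoc_eq13 x y; rewrite assocE => /eqP; rewrite subr_eq0 => /eqP. Qed.

(** The linearised left alternative laws yield twice the identity, which is why doubling has to be
    injective. *)
Lemma left_moufang a b c : m (m a (m b a)) c = m a (m b (m a c)).
Proof.
have dbl (x y : D) : x + x = y + y -> x = y.
  move=> E; apply/eqP; rewrite -subr_eq0; apply/eqP; apply: double_inj.
  by rewrite addrACA E addrACA !subrr addr0.
apply: dbl.
have E1 := m_lalt2 a (m a b + m b a) c.
rewrite !mE (m_lalt a b) (m_flex a b) (m_ralt a b) in E1.
have E2 := m_lalt2 (m a a) b c; rewrite !mE in E2.
have E4 := m_lalt2 a b (m a c); rewrite !mE (m_lalt a c) in E4.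
have E5 := congr1 (m a) (m_lalt2 a b c); rewrite !mE (m_lalt a (m b c)) in E5.
apply: (lin_comb (-1) E1); apply: (lin_comb 1 E2); apply: (lin_comb (-1) E4).
apply: (lin_comb (-1) E5); mring.
Qed.

(** The left Moufang identity rewritten with associators: a factor [a] can be pulled out, so
    vanishing of an associator propagates to longer words. *)
Lemma assoc_mul_l a b c : assoc a (m b a) c = m a (assoc a b c).
Proof.
have E := left_moufang a b c; rewrite [assoc a b c]assoc12 !assocE !mE E; mring.
Qed.

(** Valid for every biadditive product; it makes the set of elements whose associators all vanish
    closed under products. *)
Lemma teichmuller x y z w :
  assoc (m x y) z w - assoc x (m y z) w + assoc x y (m z w) =
  m x (assoc y z w) + m (assoc x y z) w.
Proof. rewrite !assocE !mE; mring. Qed.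
End Alternative.

(** * Artin's theorem for an algebra spanned by short words in two elements *)

Section Artin.
Variables (R : comNzRingType) (D : lmodType R) (m : D -> D -> D).
Hypothesis mDl : forall x y z, m (x + y) z = m x z + m y z.
Hypothesis mDr : forall x y z, m z (x + y) = m z x + m z y.
Hypothesis mZl : forall k x z, m (k *: x) z = k *: m x z.
Hypothesis mZr : forall k x z, m z (k *: x) = k *: m z x.
Hypothesis m_lalt : forall x y, m x (m x y) = m (m x x) y.
Hypothesis m_ralt : forall x y, m (m y x) x = m y (m x x).
Hypothesis double_inj : forall x : D, x + x = 0 -> x = 0.
Let mNl x z : m (- x) z = - m x z.
Proof. by rewrite -scaleN1r mZl scaleN1r. Qed.
Let mNr x z : m z (- x) = - m z x.
Proof. by rewrite -scaleN1r mZr scaleN1r. Qed.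
Let m0l x : m 0 x = 0.
Proof. by have := mZl 0 0 x; rewrite !scale0r. Qed.
Let m0r x : m x 0 = 0.
Proof. by have := mZr 0 0 x; rewrite !scale0r. Qed.
Local Notation as_ := (assoc m).
Let a12 := assoc12 mDl mDr m_lalt.
Let a23 := assoc23 mDl mDr m_ralt.
Let a13 := assoc13 mDl mDr m_lalt m_ralt.
Let eq12 := assoc_eq12 m_lalt.

Lemma assocDl x y z w : as_ (x + y) z w = as_ x z w + as_ y z w.
Proof. rewrite !assocE !mDl; mring. Qed.
Lemma assocZl k x z w : as_ (k *: x) z w = k *: as_ x z w.
Proof. rewrite !assocE !mZl; mring. Qed.

Lemma aml a b c : as_ a (m b a) c = m a (as_ a b c).
Proof. exact: (assoc_mul_l mDl mDr mNr m_lalt m_ralt double_inj). Qed.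

Lemma amr a b c : as_ a (m a b) c = m (as_ a b c) a.
Proof.
(* The opposite product is again alternative, with the two alternative laws exchanged, so the left
   version applies to it. *)
pose m' x y := m y x.
have opp x y z : assoc m' x y z = - as_ z y x.
  rewrite !assocE /m'; mring.
have := @assoc_mul_l R D m' (fun x y z => mDr x y z) (fun x y z => mDl x y z)
  (fun x z => mNl x z)
  (fun x y => m_ralt x y) (fun x y => m_lalt x y) double_inj a b c.
rewrite !opp /m' => E.
by rewrite (a13 a (m a b)) E (a13 a b).
Qed.

(** In the application the product of H is extended by zero to the whole module; the elements of W
    are then of this kind. *)
Definition null z := forall x, m z x = 0 /\ m x z = 0.
Variables (e t v : D).
Hypothesis assoc_e : forall x y, as_ e x y = 0.
(** States, as an induction principle, that the module is spanned by null elements, [e] and the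
    listed words in [t] and [v]. *)
Hypothesis gen : forall G : D -> Prop,
  (forall x y, G x -> G y -> G (x + y)) -> (forall k x, G x -> G (k *: x)) ->
  (forall z, null z -> G z) ->
  G e -> G t -> G (m t t) -> G v -> G (m v v) ->
  G (m t v) -> G (m v t) -> G (m (m t t) v) -> G (m v (m t t)) ->
  G (m t (m v v)) -> G (m (m v v) t) -> G (m (m t t) (m v v)) ->
  G (m (m v v) (m t t)) -> forall z, G z.

Lemma assoc_null z x y : null z -> as_ z x y = 0.
Proof. by move=> h; rewrite assocE !(h _).1 m0l subrr. Qed.

(** Obtained from [amr] by replacing [b] with [b + a] and cancelling. *)
Lemma assoc_sq a b c : as_ (m a a) b c = m (as_ a b c) a + m a (as_ a b c).
Proof.
have D2 x y z w : as_ z (x + y) w = as_ z x w + as_ z y w.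
  by rewrite !assocE !(mDl, mDr); mring.
have E := amr (b + a) a c; move: E; rewrite mDl D2 !assocDl !mDr !mDl.
rewrite (amr b a) (amr a a) (aml a b) !eq12 !m0l (a12 b a) !mNl => E.
rewrite (a12 _ b); apply: (lin_comb (-1) E); mring.
Qed.

Lemma artin x y z : as_ x y z = 0.
Proof.
have D3 x' y' z' w : as_ z' w (x' + y') = as_ z' w x' + as_ z' w y'.
  by rewrite !assocE !(mDl, mDr); mring.
have Z3 k x' z' w : as_ z' w (k *: x') = k *: as_ z' w x'.
  by rewrite !assocE !(mZl, mZr); mring.
have z12 a b c : as_ a b c = 0 -> as_ b a c = 0 by move=> h; rewrite a12 h oppr0.
have z23 a b c : as_ a b c = 0 -> as_ a c b = 0 by move=> h; rewrite a23 h oppr0.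
have rl a b c : as_ a b c = 0 -> as_ a (m b a) c = 0 by move=> h; rewrite aml h m0r.
have rr a b c : as_ a b c = 0 -> as_ a (m a b) c = 0 by move=> h; rewrite amr h m0l.
have eq13 a b : as_ a b a = 0 by apply: (z23 _ _ _); apply: eq12.
(* The elements [w] with (t, v, w) = 0 are stable under multiplication by [t] and [v] on either
   side, hence include all the words. *)
have tvz w : as_ t v w = 0.
  pose G w := as_ t v w = 0.
  have tl w' : G w' -> G (m t w') by move=> h; apply: (z23 _ _ _); apply: (rr _ _ _); apply: (z23 _ _ _).
  have tr w' : G w' -> G (m w' t) by move=> h; apply: (z23 _ _ _); apply: (rl _ _ _); apply: (z23 _ _ _).
  have vl w' : G w' -> G (m v w').
    by move=> h; apply: (z12 _ _ _); apply: (z23 _ _ _); apply: (rr _ _ _); apply: (z23 _ _ _); apply: (z12 _ _ _).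
  have vr w' : G w' -> G (m w' v).
    by move=> h; apply: (z12 _ _ _); apply: (z23 _ _ _); apply: (rl _ _ _); apply: (z23 _ _ _); apply: (z12 _ _ _).
  have Gt : G t by apply: (eq13 _ _).
  have Gv : G v by apply: (z12 _ _ _); apply: (eq13 _ _).
  apply: (gen (G := G)); rewrite ?{1}/G -/G.
  - by move=> a b ha hb; rewrite /G D3 ha hb addr0.
  - by move=> k a ha; rewrite /G Z3 ha scaler0.
  - by move=> a ha; rewrite a13 assoc_null ?oppr0.
  - by rewrite a13 assoc_e oppr0.
  - by [].
  - exact: (tl _).
  - by [].
  - exact: (vl _).
  - exact: (tl _).
  - exact: (tr _).
  - by rewrite -m_lalt; do 2 apply: (tl _).
  - by rewrite -m_ralt; do 2 apply: (tr _).
  - by apply: (tl _); apply: (vl _).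
  - by apply: (tr _); apply: (vl _).
  - by rewrite -m_lalt; do 2 apply: (tl _); apply: (vl _).
  by rewrite -m_ralt; do 2 apply: (tr _); apply: (vl _).
(* Next, all associators with first entry [t] or [v] vanish, again by checking the middle entry on
   the spanning words. *)
pose G2 a := (forall d, as_ t a d = 0) /\ (forall d, as_ v a d = 0).
have sqv d : as_ v (m t t) d = 0.
  by apply: (z12 _ _ _); rewrite assoc_sq tvz m0l m0r addr0.
have sqt d : as_ t (m v v) d = 0.
  by apply: (z12 _ _ _); rewrite assoc_sq a12 tvz oppr0 m0l m0r addr0.
have vtd d : as_ v t d = 0 by apply: (z12 _ _ _).
have D2 x' y' z' w : as_ z' (x' + y') w = as_ z' x' w + as_ z' y' w.
  by rewrite !assocE !(mDl, mDr); mring.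
have Z2 k x' z' w : as_ z' (k *: x') w = k *: as_ z' x' w.
  by rewrite !assocE !(mZl, mZr); mring.
have G2all a : G2 a.
  apply: (gen (G := G2)).
  - by move=> b c [b1 b2] [c1 c2]; split=> d; rewrite D2 ?b1 ?b2 ?c1 ?c2 addr0.
  - by move=> k b [b1 b2]; split=> d; rewrite Z2 ?b1 ?b2 scaler0.
  - by move=> b hb; split=> d; apply: (z12 _ _ _); apply: assoc_null.
  - by split=> d; apply: (z12 _ _ _); apply: assoc_e.
  - by split=> d; [apply: eq12 | apply: (vtd _)].
  - by split=> d; [apply: (rl _ _ _); apply: eq12 | apply: (sqv _)].
  - by split=> d; [apply: (tvz _) | apply: eq12].
  - by split=> d; [apply: (sqt _) | apply: (rl _ _ _); apply: eq12].
  - by split=> d; [apply: (rr _ _ _); apply: (tvz _) | apply: (rl _ _ _); apply: (vtd _)].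
  - by split=> d; [apply: (rl _ _ _); apply: (tvz _) | apply: (rr _ _ _); apply: (vtd _)].
  - split=> d; last by apply: (rl _ _ _); apply: (sqv _).
    by rewrite -m_lalt; do 2 apply: (rr _ _ _); apply: (tvz _).
  - split=> d; last by apply: (rr _ _ _); apply: (sqv _).
    by rewrite -m_ralt; do 2 apply: (rl _ _ _); apply: (tvz _).
  - split=> d; first by apply: (rr _ _ _); apply: (sqt _).
    by rewrite -m_ralt; do 2 apply: (rl _ _ _); apply: (vtd _).
  - split=> d; first by apply: (rl _ _ _); apply: (sqt _).
    by rewrite -m_lalt; do 2 apply: (rr _ _ _); apply: (vtd _).
  - split=> d; first by rewrite -m_lalt; do 2 apply: (rr _ _ _); apply: (sqt _).
    by rewrite -m_ralt; do 2 apply: (rl _ _ _); apply: (sqv _).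
  - split=> d; last by rewrite -m_lalt; do 2 apply: (rr _ _ _); apply: (sqv _).
    by rewrite -m_ralt; do 2 apply: (rl _ _ _); apply: (sqt _).
have tN a b : as_ t a b = 0 by case: (G2all a).
have vN a b : as_ v a b = 0 by case: (G2all a).
(* Elements whose associators in first position vanish form a subalgebra by [teichmuller]; it
   contains [t] and [v], hence everything. *)
pose G3 a := forall b c, as_ a b c = 0.
have mG3 a b : G3 a -> G3 b -> G3 (m a b).
  move=> ha hb c d; have := teichmuller mDl mDr mNl mNr a b c d.
  by rewrite !ha hb m0r m0l !(subr0, addr0).
have t3 : G3 t by [].
have v3 : G3 v by [].
suff : G3 x by apply.
apply: (gen (G := G3)) => //.
- by move=> a b ha hb c d; rewrite assocDl ha hb addr0.
- by move=> k a ha c d; rewrite assocZl ha scaler0.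
- by move=> a ha c d; apply: assoc_null.
- exact: (mG3 _ _).
- exact: (mG3 _ _).
- exact: (mG3 _ _).
- exact: (mG3 _ _).
- by do ![done | apply: (mG3 _ _)].
- by do ![done | apply: (mG3 _ _)].
- by do ![done | apply: (mG3 _ _)].
- by do ![done | apply: (mG3 _ _)].
- by do ![done | apply: (mG3 _ _)].
by do ![done | apply: (mG3 _ _)].
Qed.
End Artin.

(* cr is the linearised adjoint, cr x x = 2 x #, tr the bilinear trace form and
i6 = 1/6; cr_adjoint is the full linearisation of (x #) # = N(x) x. *)
Record cubic_structure (R : comNzRingType) (J : lmodType R)
    (cr : J -> J -> J) (tr : J -> J -> R) (one : J) (i6 : R) : Prop := {
  cr_comm : forall x y, cr x y = cr y x;
  cr_addl : forall x y z, cr (x + y) z = cr x z + cr y z;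
  cr_scalel : forall a x z, cr (a *: x) z = a *: cr x z;
  tr_comm : forall x y, tr x y = tr y x;
  tr_addl : forall x y z, tr (x + y) z = tr x z + tr y z;
  tr_scalel : forall a x z, tr (a *: x) z = a * tr x z;
  tr_crA : forall x y z, tr (cr x y) z = tr x (cr y z);
  cr_onel : forall x, cr one x = tr x one *: one - x;
  tr_one_one : tr one one = 3;
  cr_adjoint : forall x y z w,
    cr (cr x y) (cr z w) + cr (cr x z) (cr y w) + cr (cr x w) (cr y z) =
    tr (cr x y) z *: w + tr (cr x y) w *: z + tr (cr x z) w *: y
      + tr (cr y z) w *: x;
  mul_i6 : i6 * 6 = 1 }.

(** * Norm, adjoint and Jordan product of a cubic structure *)

Section CubicTheory.
Variables (R : comNzRingType) (J : lmodType R).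
Variables (cr : J -> J -> J) (tr : J -> J -> R) (one : J) (i6 : R).
Hypothesis cs : cubic_structure cr tr one i6.

Let crC := cr_comm cs.
Let crDl := cr_addl cs.
Let crZl := cr_scalel cs.
Let trC := tr_comm cs.
Let trDl := tr_addl cs.
Let trZl := tr_scalel cs.
Let i6E := mul_i6 cs.

Lemma crDr x y z : cr z (x + y) = cr z x + cr z y.
Proof. by rewrite crC crDl [cr x z]crC [cr y z]crC. Qed.
Lemma crZr a x z : cr z (a *: x) = a *: cr z x.
Proof. by rewrite crC crZl [cr x z]crC. Qed.
Lemma cr0l x : cr 0 x = 0.
Proof. by have := crZl 0 0 x; rewrite !scale0r. Qed.
Lemma cr0r x : cr x 0 = 0.
Proof. by rewrite crC cr0l. Qed.
Lemma crNl x z : cr (- x) z = - cr x z.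
Proof. by rewrite -scaleN1r crZl scaleN1r. Qed.
Lemma crNr x z : cr z (- x) = - cr z x.
Proof. by rewrite crC crNl crC. Qed.
Lemma trDr x y z : tr z (x + y) = tr z x + tr z y.
Proof. by rewrite trC trDl [tr x z]trC [tr y z]trC. Qed.
Lemma trZr a x z : tr z (a *: x) = a * tr z x.
Proof. by rewrite trC trZl [tr x z]trC. Qed.
Lemma tr0l x : tr 0 x = 0.
Proof. by have := trZl 0 0 x; rewrite scale0r mul0r. Qed.
Lemma tr0r x : tr x 0 = 0.
Proof. by rewrite trC tr0l. Qed.
Lemma trNl x z : tr (- x) z = - tr x z.
Proof. by rewrite -scaleN1r trZl mulN1r. Qed.
Lemma trNr x z : tr z (- x) = - tr z x.
Proof. by rewrite trC trNl trC. Qed.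

Definition crE := (crDl, crDr, crNl, crNr, crZl, crZr, cr0l, cr0r).
Definition trE := (trDl, trDr, trNl, trNr, trZl, trZr, tr0l, tr0r).

Lemma cancel6 (u v : J) : 6 *: u = 6 *: v -> u = v.
Proof. by move=> /(congr1 ( *:%R i6)); rewrite !scalerA i6E !scale1r. Qed.
Lemma cancel2 (u v : J) : 2 *: u = 2 *: v -> u = v.
Proof.
move=> E; apply: cancel6; have := congr1 ( *:%R 3) E; rewrite !scalerA.
by rewrite (_ : 3 * 2 = 6 :> R) //; ring.
Qed.
Lemma cancel3 (u v : J) : 3 *: u = 3 *: v -> u = v.
Proof.
move=> E; apply: cancel6; have := congr1 ( *:%R 2) E; rewrite !scalerA.
by rewrite (_ : 2 * 3 = 6 :> R) //; ring.
Qed.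
Lemma cancel6R (u v : R) : 6 * u = 6 * v -> u = v.
Proof. by move=> /(congr1 (GRing.mul i6)); rewrite !mulrA i6E !mul1r. Qed.
Lemma cancel2R (u v : R) : 2 * u = 2 * v -> u = v.
Proof.
move=> E; apply: cancel6R; have := congr1 (GRing.mul 3) E; rewrite !mulrA.
by rewrite (_ : 3 * 2 = 6 :> R) //; ring.
Qed.
Lemma cancel3R (u v : R) : 3 * u = 3 * v -> u = v.
Proof.
move=> E; apply: cancel6R; have := congr1 (GRing.mul 2) E; rewrite !mulrA.
by rewrite (_ : 2 * 3 = 6 :> R) //; ring.
Qed.

Definition half : R := 3 * i6.
Lemma halfE : 2 * half = 1.
Proof. by rewrite /half; ring: i6E. Qed.

Definition tr1 x := tr x one.
Local Notation T := tr1.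
Definition Sq x y := T x * T y - tr x y.
Definition sharp x := locked (half *: cr x x).
Definition Nm x := locked (i6 * tr (cr x x) x).
Lemma NmE x : Nm x = i6 * tr (cr x x) x.
Proof. by rewrite /Nm -lock. Qed.
(** The Jordan product, recovered by polarising x^2 = x # + T(x) x - S(x) 1. Note that [Sq x x] is
    twice the quadratic trace S(x). *)
Definition jm x y :=
  locked (half *: (cr x y + T x *: y + T y *: x - Sq x y *: one)).
Lemma sharpE x : sharp x = half *: cr x x.
Proof. by rewrite /sharp -lock. Qed.
Lemma jm_def x y :
  jm x y = half *: (cr x y + T x *: y + T y *: x - Sq x y *: one).
Proof. by rewrite /jm -lock. Qed.

Lemma TD x y : T (x + y) = T x + T y. Proof. exact: trDl. Qed.
Lemma TZ a x : T (a *: x) = a * T x. Proof. exact: trZl. Qed.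
Lemma TN x : T (- x) = - T x. Proof. exact: trNl. Qed.
Lemma T0 : T 0 = 0. Proof. exact: tr0l. Qed.
Lemma T1 : T one = 3. Proof. exact: (tr_one_one cs). Qed.
Lemma cr1l x : cr one x = T x *: one - x. Proof. exact: (cr_onel cs). Qed.
Lemma cr1r x : cr x one = T x *: one - x. Proof. by rewrite crC cr1l. Qed.
Definition TE := (TD, TZ, TN, T0, T1).
Lemma T_cr x y : T (cr x y) = Sq x y.
Proof. by rewrite /T (tr_crA cs) cr1r /Sq !trE -/(T x); ring. Qed.

Lemma cr_xx x : cr x x = 2 *: sharp x.
Proof. by rewrite sharpE scalerA halfE scale1r. Qed.
Lemma tr_cr_xxx x : tr (cr x x) x = 6 * Nm x.
Proof. by rewrite NmE; ring: i6E. Qed.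
Lemma tr_sharp x : tr (sharp x) x = 3 * Nm x.
Proof.
apply: cancel2R; rewrite mulrA (_ : 2 * 3 = 6 :> R); last by ring.
by rewrite -tr_cr_xxx cr_xx !trE; ring.
Qed.
Lemma sharpZ a x : sharp (a *: x) = a ^+ 2 *: sharp x.
Proof. by rewrite !sharpE !crE; mring. Qed.
Lemma sharpN x : sharp (- x) = sharp x.
Proof. by rewrite !sharpE !crE; mring. Qed.
Lemma sharp0 : sharp 0 = 0.
Proof. by rewrite sharpE cr0l scaler0. Qed.
Lemma sharpD x y : sharp (x + y) = sharp x + cr x y + sharp y.
Proof.
apply: cancel2; rewrite -cr_xx !scalerDr -!cr_xx !crE [cr y x]crC; mring.
Qed.
Lemma NmZ a x : Nm (a *: x) = a ^+ 3 * Nm x.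
Proof. by rewrite !NmE !(crE, trE); ring. Qed.
Lemma sharp_one : sharp one = one.
Proof. by apply: cancel2; rewrite -cr_xx cr1l T1; mring. Qed.
Lemma Nm_one : Nm one = 1.
Proof. by apply: cancel3R; rewrite -tr_sharp sharp_one (tr_one_one cs); ring. Qed.
Lemma sharp_sharp x : sharp (sharp x) = Nm x *: x.
Proof.
apply: cancel6; have := cr_adjoint cs x x x x.
rewrite [cr x x]cr_xx !crE cr_xx !trE tr_sharp => E.
by do 2 apply: cancel2; apply: (lin_comb 1 E); mring.
Qed.
Lemma tr_crC x y z : tr (cr x y) z = tr (cr x z) y.
Proof. by rewrite (tr_crA cs) [cr y z]crC -(tr_crA cs). Qed.
Lemma NmD x y : Nm (x + y) = Nm x + tr (sharp x) y + tr (sharp y) x + Nm y.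
Proof.
apply: cancel6R; rewrite !mulrDr -!tr_cr_xxx !(crE, trE) [cr y x]crC.
rewrite [tr (cr x y) x]tr_crC [tr (cr x y) y](tr_crA cs).
by rewrite [tr x _]trC !cr_xx !trE; ring.
Qed.
Lemma jmC x y : jm x y = jm y x.
Proof. by rewrite !jm_def crC /Sq trC; congr (_ *: _); mring. Qed.
Lemma jm1l x : jm one x = x.
Proof.
apply: cancel2; rewrite jm_def scalerA halfE scale1r cr1l T1 /Sq T1 [tr one x]trC -/(T x); mring.
Qed.
Lemma jmE x y : 2 *: jm x y = cr x y + T x *: y + T y *: x - Sq x y *: one.
Proof. by rewrite jm_def scalerA halfE scale1r. Qed.
Lemma T_jm x y : T (jm x y) = tr x y.
Proof.
apply: cancel2R; rewrite -TZ jmE !(TE) T_cr /Sq; ring.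
Qed.
Lemma jmDl x y z : jm (x + y) z = jm x z + jm y z.
Proof. by apply: cancel2; rewrite scalerDr !jmE /Sq !crE !trE !TE; mring. Qed.
Lemma jmZl a x z : jm (a *: x) z = a *: jm x z.
Proof. by apply: cancel2; rewrite [2 *: (a *: _)]scalerA mulrC -scalerA !jmE /Sq !crE !trE !TE; mring. Qed.
Lemma jmDr x y z : jm z (x + y) = jm z x + jm z y.
Proof. by rewrite jmC jmDl [jm x z]jmC [jm y z]jmC. Qed.
Lemma jmZr a x z : jm z (a *: x) = a *: jm z x.
Proof. by rewrite jmC jmZl [jm _ z]jmC. Qed.
Lemma jm_xx x : jm x x = sharp x + T x *: x - (half * Sq x x) *: one.
Proof.
apply: cancel2; rewrite jmE cr_xx.
by rewrite scalerDr scalerN [2 *: ((half * _) *: _)]scalerA mulrA halfE; mring.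
Qed.


(** Comes from the adjoint identity with [one] in the last slot, a specialisation used again
    below. *)
Lemma cr_sharp x : cr x (sharp x) =
   (T x * T (sharp x) - Nm x) *: one - T (sharp x) *: x - T x *: sharp x.
Proof.
have := cr_adjoint cs x x x one.
rewrite tr_cr_xxx [cr (cr x one) _]crC -/(T (cr x x)) cr1r cr_xx !crE !TE cr1r.
rewrite [cr (sharp x) x]crC => E.
by apply: cancel6; apply: (lin_comb (-1) E); mring.
Qed.
Lemma jm_sharp x : jm x (sharp x) = Nm x *: one.
Proof.
apply: cancel2; rewrite jmE cr_sharp /Sq [tr x _]trC tr_sharp; mring.
Qed.

(** [pH] plays the orthogonal projection onto a subalgebra: its fixed points are H and its zeros are
    W. In this form the data make sense over a ring, without bases, and extend componentwise to a
    scalar extension. *)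
Record cubic_sub (pH : J -> J) : Prop := {
  subD : forall x y, pH (x + y) = pH x + pH y;
  subZ : forall a x, pH (a *: x) = a *: pH x;
  subK : forall x, pH (pH x) = pH x;
  sub_one : pH one = one;
  sub_cr : forall x y, pH x = x -> pH y = y -> pH (cr x y) = cr x y;
  sub_cr_orth : forall x y, pH x = x -> pH y = 0 -> pH (cr x y) = 0;
  sub_tr_orth : forall x y, pH x = x -> pH y = 0 -> tr x y = 0 }.

(** * The decomposition H + W: the action of H on W and the two parts of the adjoint *)

Section Subalgebra.
Variable pH : J -> J.
Hypothesis sH : cubic_sub pH.
Local Notation inH a := (pH a = a).
Local Notation inW w := (pH w = 0).
Let pHD := subD sH.
Let pHZ := subZ sH.

Lemma sub0 : pH 0 = 0.
Proof. by have := pHZ 0 0; rewrite !scale0r. Qed.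
Lemma subN x : pH (- x) = - pH x.
Proof. by rewrite -scaleN1r pHZ scaleN1r. Qed.
Definition subE := (pHD, pHZ, subN, sub0).

Lemma inHD a b : inH a -> inH b -> inH (a + b).
Proof. by rewrite pHD => -> ->. Qed.
Lemma inHZ k a : inH a -> inH (k *: a).
Proof. by rewrite pHZ => ->. Qed.
Lemma inHN a : inH a -> inH (- a).
Proof. by rewrite subN => ->. Qed.
Lemma inH_sharp a : inH a -> inH (sharp a).
Proof. by move=> h; rewrite sharpE; apply: inHZ; apply: (sub_cr sH). Qed.
Lemma inH_jm a b : inH a -> inH b -> inH (jm a b).
Proof.
move=> ha hb; rewrite jm_def; apply: inHZ; apply: inHD; last first.
  by apply: inHN; apply: inHZ; apply: (sub_one sH).
by do ![apply: inHD | apply: inHZ | apply: (sub_cr sH) | done].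
Qed.
Lemma inWD a b : inW a -> inW b -> inW (a + b).
Proof. by rewrite pHD => -> ->; rewrite addr0. Qed.
Lemma inWZ k a : inW a -> inW (k *: a).
Proof. by rewrite pHZ => ->; rewrite scaler0. Qed.
Lemma inWN a : inW a -> inW (- a).
Proof. by rewrite subN => ->; rewrite oppr0. Qed.
Lemma inW_sub x : inW (x - pH x).
Proof. by rewrite pHD subN (subK sH) subrr. Qed.
Lemma T_W w : inW w -> T w = 0.
Proof. by move=> hw; rewrite /T trC (sub_tr_orth sH) // (sub_one sH). Qed.
Lemma tr_WH w a : inW w -> inH a -> tr w a = 0.
Proof. by move=> hw ha; rewrite trC (sub_tr_orth sH). Qed.

(* For x, y in W these split cr x y into - qf x y in H and bt x y in W. *)
Definition act a w := locked (- cr a w).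
Definition qf x y := locked (- pH (cr x y)).
Definition bt x y := locked (cr x y + qf x y).
Lemma actE a w : act a w = - cr a w. Proof. by rewrite /act -lock. Qed.
Lemma qfE x y : qf x y = - pH (cr x y). Proof. by rewrite /qf -lock. Qed.
Lemma btE x y : bt x y = cr x y + qf x y. Proof. by rewrite /bt -lock. Qed.
Lemma cr_act a w : cr a w = - act a w. Proof. by rewrite actE opprK. Qed.
Lemma cr_actr a w : cr w a = - act a w. Proof. by rewrite crC cr_act. Qed.
Lemma cr_WW x y : cr x y = bt x y - qf x y. Proof. by rewrite btE addrK. Qed.

Lemma qfC x y : qf x y = qf y x. Proof. by rewrite !qfE crC. Qed.
Lemma btC x y : bt x y = bt y x. Proof. by rewrite !btE qfC crC. Qed.
Lemma actDl a b w : act (a + b) w = act a w + act b w.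
Proof. by rewrite !actE !crE; mring. Qed.
Lemma actDr a v w : act a (v + w) = act a v + act a w.
Proof. by rewrite !actE !crE; mring. Qed.
Lemma actZl k a w : act (k *: a) w = k *: act a w.
Proof. by rewrite !actE !crE; mring. Qed.
Lemma actZr k a w : act a (k *: w) = k *: act a w.
Proof. by rewrite !actE !crE; mring. Qed.
Lemma actNl a w : act (- a) w = - act a w.
Proof. by rewrite !actE !crE; mring. Qed.
Lemma actNr a w : act a (- w) = - act a w.
Proof. by rewrite !actE !crE; mring. Qed.
Lemma act0l w : act 0 w = 0.
Proof. by rewrite !actE !crE oppr0. Qed.
Lemma act0r a : act a 0 = 0.
Proof. by rewrite !actE !crE oppr0. Qed.
Definition aE := (actDl, actDr, actNl, actNr, actZl, actZr, act0l, act0r).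
Lemma qfDl x y z : qf (x + y) z = qf x z + qf y z.
Proof. by rewrite !qfE !crE !subE; mring. Qed.
Lemma qfZl k x z : qf (k *: x) z = k *: qf x z.
Proof. by rewrite !qfE !crE !subE; mring. Qed.
Lemma qfNl x z : qf (- x) z = - qf x z.
Proof. by rewrite !qfE !crE !subE; mring. Qed.
Lemma qf0l z : qf 0 z = 0.
Proof. by rewrite !qfE !crE !subE oppr0. Qed.
Lemma qfDr x y z : qf z (x + y) = qf z x + qf z y.
Proof. by rewrite !(qfC z) qfDl. Qed.
Lemma qfZr k x z : qf z (k *: x) = k *: qf z x.
Proof. by rewrite !(qfC z) qfZl. Qed.
Lemma qfNr x z : qf z (- x) = - qf z x.
Proof. by rewrite !(qfC z) qfNl. Qed.
Lemma qf0r z : qf z 0 = 0.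
Proof. by rewrite qfC qf0l. Qed.
Definition qE := (qfDl, qfDr, qfNl, qfNr, qfZl, qfZr, qf0l, qf0r).
Lemma btDl x y z : bt (x + y) z = bt x z + bt y z.
Proof. by rewrite !btE !qE !crE; mring. Qed.
Lemma btZl k x z : bt (k *: x) z = k *: bt x z.
Proof. by rewrite !btE !qE !crE; mring. Qed.
Lemma btNl x z : bt (- x) z = - bt x z.
Proof. by rewrite !btE !qE !crE; mring. Qed.
Lemma bt0l z : bt 0 z = 0.
Proof. by rewrite !btE !qE !crE addr0. Qed.
Lemma btDr x y z : bt z (x + y) = bt z x + bt z y.
Proof. by rewrite !(btC z) btDl. Qed.
Lemma btZr k x z : bt z (k *: x) = k *: bt z x.
Proof. by rewrite !(btC z) btZl. Qed.
Lemma btNr x z : bt z (- x) = - bt z x.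
Proof. by rewrite !(btC z) btNl. Qed.
Lemma bt0r z : bt z 0 = 0.
Proof. by rewrite btC bt0l. Qed.
Definition bE := (btDl, btDr, btNl, btNr, btZl, btZr, bt0l, bt0r).

Lemma inW_act a w : inH a -> inW w -> inW (act a w).
Proof. by move=> ha hw; rewrite actE; apply: inWN; apply: (sub_cr_orth sH). Qed.
Lemma inH_qf x y : inH (qf x y).
Proof. by rewrite qfE; apply: inHN; apply: (subK sH). Qed.
Lemma inW_bt x y : inW (bt x y).
Proof. by rewrite btE qfE; apply: inW_sub. Qed.
Lemma act1 w : inW w -> act one w = w.
Proof. by move=> hw; rewrite actE cr1l T_W //; mring. Qed.

Lemma HW_inj a b v w : inH a -> inH b -> inW v -> inW w ->
  a + v = b + w -> a = b /\ v = w.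
Proof.
move=> ha hb hv hw E; have := congr1 pH E; rewrite !pHD ha hb hv hw !addr0 => Eab.
by split=> //; move: E; rewrite Eab => /addrI.
Qed.
Lemma HW_eq0 a v : inH a -> inW v -> a + v = 0 -> a = 0 /\ v = 0.
Proof.
move=> ha hv E; apply: (HW_inj ha _ hv); rewrite ?sub0 //.
by rewrite E addr0.
Qed.

Lemma tr_act a x y : tr (act a x) y = tr x (act a y).
Proof. by rewrite !actE !trE [cr a x]crC (tr_crA cs). Qed.
Lemma tr_qf a x y : inH a -> tr a (cr x y) = - tr a (qf x y).
Proof.
by move=> ha; rewrite cr_WW !trE (sub_tr_orth sH ha (inW_bt x y)) add0r.
Qed.
Lemma T_qf x y : inW x -> inW y -> T (qf x y) = tr x y.
Proof.
move=> hx hy; have := tr_qf x y (sub_one sH).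
rewrite ![tr one _]trC -!/(T _) T_cr /Sq (T_W hx) (T_W hy) => E.
by apply: (lin_comb_scal 1 E); ring.
Qed.

(** W is a special Jordan module over H. This is the adjoint identity at (a, b, w, one). *)
Lemma act_jm a b w : inH a -> inH b -> inW w ->
  act a (act b w) + act b (act a w) = 2 *: act (jm a b) w.
Proof.
move=> ha hb hw; rewrite -actZl jmE !aE act1 //.
have := cr_adjoint cs a b w one.
have ha1 := sub_cr_orth sH ha hw; have hb1 := sub_cr_orth sH hb hw.
rewrite !cr1r (T_W hw) -!/(T _) (T_W ha1) (T_W hb1) T_cr.
rewrite (sub_tr_orth sH (sub_cr sH ha hb) hw) [cr (cr a w) _]crC !cr_act !aE.
rewrite !act1 ?inW_act // => E.
by apply: (lin_comb (-1) E); mring.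
Qed.

(** The two conjuncts are the H-component and the W-component of the adjoint identity at (a, b, x,
    y). *)
Lemma act_adjoint a b x y : inH a -> inH b -> inW x -> inW y ->
  (qf (act a x) (act b y) + qf (act a y) (act b x) =
   tr a (qf x y) *: b + tr b (qf x y) *: a - cr (cr a b) (qf x y)) /\
  (bt (act a x) (act b y) + bt (act a y) (act b x) = act (cr a b) (bt x y)).
Proof.
move=> ha hb hx hy; have hab := sub_cr sH ha hb.
have := cr_adjoint cs a b x y.
rewrite (sub_tr_orth sH hab hx) (sub_tr_orth sH hab hy) !(tr_crA cs).
rewrite (tr_qf _ _ ha) (tr_qf _ _ hb) (cr_WW x y) crDr crNr.
rewrite [cr (cr a b) (bt _ _)]cr_act (cr_act a x) (cr_act a y) (cr_act b x).
rewrite (cr_act b y) !crNl !crNr !opprK.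
rewrite (cr_WW (act a x)) (cr_WW (act a y)) => E.
suff [E1 E2] : - (qf (act a x) (act b y) + qf (act a y) (act b x)) =
    - (tr a (qf x y) *: b + tr b (qf x y) *: a - cr (cr a b) (qf x y)) /\
    bt (act a x) (act b y) + bt (act a y) (act b x) = act (cr a b) (bt x y).
  by split=> //; apply: oppr_inj.
apply: HW_inj.
- by apply: inHN; apply: inHD; apply: inH_qf.
- apply: inHN; apply: inHD; last by apply: inHN; apply: (sub_cr sH) => //; apply: inH_qf.
  by apply: inHD; apply: inHZ.
- by apply: inWD; apply: inW_bt.
- by apply: inW_act => //; apply: inW_bt.
by apply: (lin_comb 1 E); mring.
Qed.
Definition qf_act a b x y ha hb hx hy := proj1 (@act_adjoint a b x y ha hb hx hy).
Definition bt_act a b x y ha hb hx hy := proj2 (@act_adjoint a b x y ha hb hx hy).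

Lemma qf_act1 a x y : inH a -> inW x -> inW y ->
  qf (act a x) y + qf x (act a y) = 2 *: jm a (qf x y).
Proof.
move=> ha hx hy; have := qf_act ha (sub_one sH) hx hy.
rewrite !act1 // => E; rewrite jmE /Sq -/(T _).
move: E; rewrite cr1r !crE cr1l ![tr one _]trC -/(T _) => E.
by rewrite [qf x _]qfC; apply: (lin_comb 1 E); mring.
Qed.
Lemma bt_act1 a x y : inH a -> inW x -> inW y ->
  bt (act a x) y + bt x (act a y) = T a *: bt x y - act a (bt x y).
Proof.
move=> ha hx hy; have := bt_act ha (sub_one sH) hx hy.
rewrite !act1 // => E; rewrite [bt x _]btC E cr1r !aE act1 //; exact: inW_bt.
Qed.

(** Same comparison of components, now with three arguments equal to [x]. *)
Lemma act_adjoint3 a x : inH a -> inW x ->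
  qf (act a x) (bt x x) = (2 * Nm x) *: a /\
  bt (act a x) (bt x x) = tr a (qf x x) *: x - act (qf x x) (act a x).
Proof.
move=> ha hx; have := cr_adjoint cs a x x x.
rewrite [tr (cr x x) x]tr_cr_xxx !(tr_crA cs a) (tr_qf x x ha).
rewrite (cr_WW x x) crDr crNr (cr_act a x) !crNl opprK.
rewrite (cr_actr (qf x x)) (cr_WW (act a x)) => E.
have hq := inH_qf x x; have hax := inW_act ha hx.
have [E1 E2] : - (3 *: qf (act a x) (bt x x)) = - ((6 * Nm x) *: a) /\
  3 *: bt (act a x) (bt x x) =
  3 *: (tr a (qf x x) *: x - act (qf x x) (act a x)).
  apply: HW_inj; last by apply: (lin_comb (-1) E); mring.
  - by apply: inHN; apply: inHZ; apply: inH_qf.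
  - by apply: inHN; apply: inHZ.
  - by apply: inWZ; apply: inW_bt.
  - by apply: inWZ; apply: inWD; [exact: inWZ | apply: inWN; apply: inW_act].
split; apply: cancel3 => //; apply: oppr_inj; rewrite E1; mring.
Qed.

Definition Q x := locked (half *: qf x x).
Definition B x := locked (half *: bt x x).
Lemma QE x : Q x = half *: qf x x. Proof. by rewrite /Q -lock. Qed.
Lemma BE x : B x = half *: bt x x. Proof. by rewrite /B -lock. Qed.
Lemma inH_Q x : inH (Q x). Proof. by rewrite QE; apply: inHZ; apply: inH_qf. Qed.
Lemma inW_B x : inW (B x). Proof. by rewrite BE; apply: inWZ; apply: inW_bt. Qed.
Lemma qf_xx x : qf x x = 2 *: Q x.
Proof. by rewrite QE scalerA halfE scale1r. Qed.
Lemma bt_xx x : bt x x = 2 *: B x.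
Proof. by rewrite BE scalerA halfE scale1r. Qed.
Lemma sharp_W x : sharp x = B x - Q x.
Proof. by rewrite sharpE cr_WW QE BE; mring. Qed.

Lemma sharp_sharp_W x : inW x ->
  sharp (Q x) = Q (B x) /\ B (B x) + act (Q x) (B x) = Nm x *: x.
Proof.
move=> hx; have := sharp_sharp x.
rewrite [sharp x]sharp_W sharpD sharpN crNr cr_actr opprK (sharp_W (B x)) => E.
have hB := inW_B x; have hQ := inH_Q x.
have [] : sharp (Q x) - Q (B x) = 0 /\ B (B x) + act (Q x) (B x) = Nm x *: x.
  apply: HW_inj.
  - by apply: inHD; [apply: inH_sharp | apply: inHN; apply: inH_Q].
  - exact: sub0.
  - by apply: inWD; [apply: inW_B | apply: inW_act].
  - exact: inWZ.
  by apply: (lin_comb 1 E); mring.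
by move=> /eqP; rewrite subr_eq0 => /eqP.
Qed.

Lemma Q_act a x : inH a -> inW x ->
  Q (act a x) = tr a (Q x) *: a - cr (sharp a) (Q x).
Proof.
move=> ha hx; have := qf_act ha ha hx hx; rewrite !qf_xx cr_xx !(crE, trE) => E.
do 2 apply: cancel2; apply: (lin_comb 1 E); mring.
Qed.
Lemma B_act a x : inH a -> inW x -> B (act a x) = act (sharp a) (B x).
Proof.
move=> ha hx; have := bt_act ha ha hx hx; rewrite !bt_xx cr_xx !aE => E.
do 2 apply: cancel2; apply: (lin_comb 1 E); mring.
Qed.
Lemma qf_act_B a x : inH a -> inW x -> qf (act a x) (B x) = Nm x *: a.
Proof.
move=> ha hx; have := proj1 (act_adjoint3 ha hx); rewrite bt_xx qE => E.
by apply: cancel2; rewrite E; mring.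
Qed.
Lemma bt_act_B a x : inH a -> inW x ->
  bt (act a x) (B x) = tr a (Q x) *: x - act (Q x) (act a x).
Proof.
move=> ha hx; have := proj2 (act_adjoint3 ha hx).
rewrite bt_xx qf_xx bE !aE trE => E.
by apply: cancel2; apply: (lin_comb 1 E); mring.
Qed.

(** Makes the action of [a] invertible on W as soon as its norm is. *)
Lemma act_sharp_act a w : inH a -> inW w -> act (sharp a) (act a w) = Nm a *: w.
Proof.
move=> ha hw; have := cr_adjoint cs a a a w.
rewrite (sub_tr_orth sH (sub_cr sH ha ha) hw) tr_cr_xxx cr_xx (cr_act a w).
rewrite !crE cr_act (cr_actr (sharp a)) => E.
by apply: cancel6; apply: (lin_comb 1 E); mring.
Qed.

(** Explains the quadratic equation: with u = q(x).b(x) one has Q(u) = N(q(x)) q(x) and qf u x =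
    N(x) q(x), so that Q(u - e x) is the value of the quadratic polynomial at [e] times q(x). *)
Lemma Q_root x e : inW x -> e ^+ 2 - Nm x * e + Nm (Q x) = 0 ->
  Q (act (Q x) (B x) - e *: x) = 0.
Proof.
move=> hx he; have hq := inH_Q x; have hB := inW_B x.
have hu := inW_act hq hB; set u := act (Q x) (B x) in hu *.
have Qu : Q u = Nm (Q x) *: Q x.
  rewrite /u Q_act // -(proj1 (sharp_sharp_W hx)) cr_xx sharp_sharp.
  by rewrite trC tr_sharp; mring.
have qux : qf u x = Nm x *: Q x.
  have := qf_act1 hq hB hx; rewrite -/u [qf (B x) (act _ _)]qfC qf_act_B //.
  have -> : qf (B x) x = Nm x *: one.
    by rewrite qfC -{1}(act1 hx) qf_act_B //; apply: (sub_one sH).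
  by rewrite jmZr jmC jm1l => E; apply: (lin_comb 1 E); mring.
have hh : 2 * half = 1 := halfE.
apply: cancel2; rewrite scaler0 -qf_xx !qE qf_xx Qu [qf x u]qfC qux qf_xx.
transitivity ((2 * (e ^+ 2 - Nm x * e + Nm (Q x))) *: Q x); first by mring.
by rewrite he mulr0 scale0r.
Qed.

(** Source of contradictions over a division algebra, where a vanishing adjoint forces [lam + x] and
    then [x] to be zero. *)
Lemma sharp_add_eq0 lam x : inH lam -> inW x -> act lam x = B x ->
  sharp lam = Q x -> sharp (lam + x) = 0.
Proof.
move=> hl hx E1 E2; rewrite sharpD cr_act E1 E2 sharp_W; mring.
Qed.

Lemma act_cubic_comm a b c a' b' c' t w : inH t -> inW w ->
  let l := a *: one + b *: t + c *: jm t t in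
  let l' := a' *: one + b' *: t + c' *: jm t t in
  act l (act l' w) = act l' (act l w).
Proof.
move=> ht hw /=.
have tt w' : inW w' -> act (jm t t) w' = act t (act t w').
  by move=> hw'; apply: cancel2; rewrite -act_jm //; mring.
have h1 := inW_act ht hw; have h2 := inW_act ht h1.
rewrite !aE !act1 ?(inWD, inWZ, inW_act) //; try exact: inH_jm.
rewrite !tt ?inW_act //; mring.
Qed.
Lemma act_act_sharp a w : inH a -> inW w -> act a (act (sharp a) w) = Nm a *: w.
Proof.
move=> ha hw; have E := act_jm ha (inH_sharp ha) hw.
move: E; rewrite jm_sharp act_sharp_act // !aE act1 // => E.
by apply: (lin_comb 1 E); mring.
Qed.
Lemma tr_Q_W x w : inW w -> tr (Q x) w = 0.
Proof. by move=> hw; rewrite (sub_tr_orth sH (inH_Q x) hw). Qed.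
Lemma tr_B_W w : inW w -> tr (B w) w = 3 * Nm w.
Proof.
move=> hw; have := tr_sharp w; rewrite sharp_W !trE tr_Q_W // => E.
by apply: (lin_comb_scal 1 E); ring.
Qed.
(** Via tr(B w, w) = 3 N(w): the factor a # acting on B w is moved across the trace form, where it
    meets [a] and leaves the scalar N(a). *)
Lemma Nm_act a w : inH a -> inW w -> Nm (act a w) = Nm a * Nm w.
Proof.
move=> ha hw; apply: cancel3R; rewrite -tr_B_W ?inW_act // B_act // tr_act.
by rewrite act_sharp_act // !trE tr_B_W //; ring.
Qed.

(** * First Tits construction from an element with vanishing quadratic part *)

Section Kummer.
Variables (x1 : J) (nV : R).
Hypothesis hx1 : inW x1.
Hypothesis Qx1 : Q x1 = 0.
Local Notation n := (Nm x1).
Hypothesis hn : nV * n = 1.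
Local Notation x2 := (B x1).
Hypothesis hdec : forall w, inW w ->
  exists a b, [/\ inH a, inH b & w = act a x1 + act b x2].

Let hx2 : inW x2 := inW_B x1.
Lemma kummer_Q2 : Q x2 = 0.
Proof. by have [<- _] := sharp_sharp_W hx1; rewrite Qx1 sharp0. Qed.
Lemma kummer_B2 : B x2 = n *: x1.
Proof. by have [_ <-] := sharp_sharp_W hx1; rewrite Qx1 act0l addr0. Qed.
Let q11 : qf x1 x1 = 0. Proof. by rewrite qf_xx Qx1 scaler0. Qed.
Let q22 : qf x2 x2 = 0. Proof. by rewrite qf_xx kummer_Q2 scaler0. Qed.
Lemma kummer_cancel (u v : J) : n *: u = n *: v -> u = v.
Proof. by move=> /(congr1 ( *:%R nV)); rewrite !scalerA hn !scale1r. Qed.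

Lemma kummer_qf12 a : inH a -> qf (act a x1) x2 = n *: a.
Proof. by move=> ha; apply: qf_act_B. Qed.
Lemma kummer_q12 : qf x1 x2 = n *: one.
Proof. by rewrite -(kummer_qf12 (sub_one sH)) act1. Qed.
Lemma kummer_qf12r a : inH a -> qf x1 (act a x2) = n *: a.
Proof.
move=> ha; have := qf_act1 ha hx1 hx2; rewrite kummer_qf12 // kummer_q12.
rewrite jmZr jmC jm1l => E; apply: (lin_comb 1 E); mring.
Qed.

Lemma qf_act_isotropic a b x : inH a -> inH b -> inW x -> qf x x = 0 ->
  qf (act a x) (act b x) = 0.
Proof.
move=> ha hb hx h; apply: cancel2; have := qf_act ha hb hx hx.
rewrite h !trE !crE => E; apply: (lin_comb 1 E); mring.
Qed.

(* The product * of H; the projections make it bilinear on all of J. *)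
Definition km a b := locked (nV *: qf (act (pH a) (act (pH b) x1)) x2).
Lemma kmE a b : km a b = nV *: qf (act (pH a) (act (pH b) x1)) x2.
Proof. by rewrite /km -lock. Qed.
Lemma kmDl a b c : km (a + b) c = km a c + km b c.
Proof. by rewrite !kmE !subE !aE !qE; mring. Qed.
Lemma kmDr a b c : km c (a + b) = km c a + km c b.
Proof. by rewrite !kmE !subE !aE !qE; mring. Qed.
Lemma kmZl k a c : km (k *: a) c = k *: km a c.
Proof. by rewrite !kmE !subE !aE !qE; mring. Qed.
Lemma kmZr k a c : km c (k *: a) = k *: km c a.
Proof. by rewrite !kmE !subE !aE !qE; mring. Qed.
Lemma kmNl a c : km (- a) c = - km a c.
Proof. by rewrite -scaleN1r kmZl scaleN1r. Qed.
Lemma kmNr a c : km c (- a) = - km c a.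
Proof. by rewrite -scaleN1r kmZr scaleN1r. Qed.
Lemma km0l c : km 0 c = 0.
Proof. by have := kmZl 0 0 c; rewrite !scale0r. Qed.
Lemma km0r c : km c 0 = 0.
Proof. by have := kmZr 0 0 c; rewrite !scale0r. Qed.
Definition kE := (kmDl, kmDr, kmNl, kmNr, kmZl, kmZr, km0l, km0r).
Lemma inH_km a b : inH (km a b).
Proof. by rewrite kmE; apply: inHZ; apply: inH_qf. Qed.
Lemma km_pl a b : km (pH a) b = km a b.
Proof. by rewrite !kmE (subK sH). Qed.
Lemma km_pr a b : km a (pH b) = km a b.
Proof. by rewrite !kmE (subK sH). Qed.

(** Pairing with [x2] under [qf] reads off the coefficient of [x1], and pairing with [x1] that of
    [x2], because H.x1 and H.x2 are isotropic for [qf]. *)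
Lemma kummer_act_inj a b a' b' : inH a -> inH b -> inH a' -> inH b' ->
  act a x1 + act b x2 = act a' x1 + act b' x2 -> a = a' /\ b = b'.
Proof.
move=> ha hb ha' hb' E; split; apply: kummer_cancel.
  have := congr1 (qf^~ x2) E; rewrite /= !qE !kummer_qf12 //.
  have h c : inH c -> qf (act c x2) x2 = 0.
    move=> hc; rewrite -{2}(act1 hx2); apply: qf_act_isotropic => //.
    exact: (sub_one sH).
  by rewrite !h // !addr0.
have := congr1 (qf x1) E; rewrite /= !qE !kummer_qf12r //.
have h c : inH c -> qf x1 (act c x1) = 0.
  move=> hc; rewrite -{1}(act1 hx1); apply: qf_act_isotropic => //.
  exact: (sub_one sH).
by rewrite !h // !add0r.
Qed.
Lemma kummer_act1_inj a b : inH a -> inH b -> act a x1 = act b x1 -> a = b.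
Proof.
move=> ha hb E; have [] := @kummer_act_inj a 0 b 0 ha (sub0) hb (sub0) _ => //.
by rewrite E.
Qed.
Lemma kummer_act2_inj a b : inH a -> inH b -> act a x2 = act b x2 -> a = b.
Proof.
move=> ha hb E; have [] := @kummer_act_inj 0 a 0 b (sub0) ha (sub0) hb _ => //.
by rewrite E.
Qed.

(** H.x1 is stable under H: the possible [x2]-coefficient is read off by [qf x1], which vanishes
    here since [qf_act1] moves [a] back inside isotropic terms. *)
Lemma act_act1 a b : inH a -> inH b -> act a (act b x1) = act (km a b) x1.
Proof.
move=> ha hb.
have hab : inW (act a (act b x1)) by do 2 apply: inW_act => //.
have [c [d [hc hd E]]] := hdec hab.
have h1 : inH one := sub_one sH.
have d0 : d = 0.
  apply: kummer_cancel; rewrite -kummer_qf12r // scaler0.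
  have q1 c' : inH c' -> qf x1 (act c' x1) = 0.
    by move=> hc'; rewrite -{1}(act1 hx1); apply: qf_act_isotropic.
  have := congr1 (qf x1) E; rewrite qE q1 // add0r => <-.
  have := qf_act1 ha hx1 (inW_act hb hx1).
  rewrite (qf_act_isotropic ha hb hx1 q11) add0r => ->.
  by rewrite q1 // -(scale0r 0) jmZr !scale0r scaler0.
rewrite E d0 act0l addr0; congr act; apply: kummer_cancel.
rewrite kmE ha hb E d0 act0l addr0 kummer_qf12 //.
by rewrite [nV *: (n *: _)]scalerA hn scale1r.
Qed.

Lemma km_jm a b : inH a -> inH b -> km a b + km b a = 2 *: jm a b.
Proof.
move=> ha hb; apply: kummer_act1_inj.
- by apply: inHD; apply: inH_km.
- by apply: inHZ; apply: inH_jm.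
by rewrite actDl -!act_act1 // act_jm // actZl.
Qed.

Lemma kummer_qf a b : inH a -> inH b -> qf (act a x1) (act b x2) = n *: km a b.
Proof.
move=> ha hb; have := qf_act1 hb hx2 (inW_act ha hx1).
rewrite act_act1 // [qf x2 _]qfC kummer_qf12 ?inH_km // [qf x2 _]qfC.
rewrite kummer_qf12 // jmZr [qf (act b x2) _]qfC => E; have F := km_jm hb ha.
by apply: (lin_comb 1 E); apply: (lin_comb (- n) F); mring.
Qed.

(** On H.x2 the order of the factors is reversed. Thus [x1] will supply the left alternative law and
    [x2] the right one, both from a.(a.w) = a^2.w. *)
Lemma act_act2 a b : inH a -> inH b -> act a (act b x2) = act (km b a) x2.
Proof.
move=> ha hb.
have hab : inW (act a (act b x2)) by do 2 apply: inW_act => //.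
have [c [d [hc hd E]]] := hdec hab.
have h1 : inH one := sub_one sH.
have q2 c' : inH c' -> qf (act c' x2) x2 = 0.
  by move=> hc'; rewrite -{2}(act1 hx2); apply: qf_act_isotropic.
have q1 c' : inH c' -> qf x1 (act c' x1) = 0.
  by move=> hc'; rewrite -{1}(act1 hx1); apply: qf_act_isotropic.
have c0 : c = 0.
  apply: kummer_cancel; rewrite -kummer_qf12 // scaler0.
  have := congr1 (qf^~ x2) E; rewrite /= qE (q2 d) // addr0 => <-.
  have := qf_act1 ha (inW_act hb hx2) hx2.
  rewrite (qf_act_isotropic hb ha hx2 q22) addr0 => ->.
  by rewrite q2 // -(scale0r 0) jmZr !scale0r scaler0.
rewrite E c0 act0l add0r; congr act; apply: kummer_cancel.
have := qf_act1 ha hx1 (inW_act hb hx2).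
rewrite kummer_qf // kummer_qf12r // E c0 act0l add0r kummer_qf12r //.
rewrite jmZr => E2; have F := km_jm ha hb.
by apply: (lin_comb 1 E2); apply: (lin_comb (- n) F); mring.
Qed.

Lemma km_one_l a : inH a -> km one a = a.
Proof.
move=> ha; have h1 := sub_one sH; apply: kummer_act1_inj => //; first exact: inH_km.
by rewrite -act_act1 // act1 // inW_act.
Qed.
Lemma km_one_r a : inH a -> km a one = a.
Proof.
move=> ha; have h1 := sub_one sH; apply: kummer_act1_inj => //; first exact: inH_km.
by rewrite -act_act1 // act1.
Qed.
Lemma km_sq a : inH a -> km a a = jm a a.
Proof.
by move=> ha; apply: cancel2; rewrite -km_jm //; mring.
Qed.
Lemma km_lalt a b : km a (km a b) = km (km a a) b.
Proof.
rewrite -(km_pl a (km a b)) -(km_pl a b) -(km_pr (pH a) b) -(km_pr (km a a)).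
rewrite -(km_pl a a) -(km_pr (pH a) a).
move: (pH a) (pH b) (subK sH a) (subK sH b) => {}a {}b ha hb.
apply: kummer_act1_inj; try exact: inH_km.
rewrite -!act_act1 ?inH_km //.
apply: cancel2; rewrite km_sq // -act_jm //; last exact: inW_act.
mring.
Qed.
Lemma km_ralt a b : km (km b a) a = km b (km a a).
Proof.
rewrite -(km_pr (km b a) a) -(km_pl b a) -(km_pr (pH b) a) -(km_pl b (km a a)).
rewrite -(km_pl a a) -(km_pr (pH a) a).
move: (pH a) (pH b) (subK sH a) (subK sH b) => {}a {}b ha hb.
apply: kummer_act2_inj; try exact: inH_km.
rewrite -!act_act2 ?inH_km //.
apply: cancel2; rewrite km_sq // -act_jm //; last exact: inW_act.
mring.
Qed.


Lemma Nm_x2 : Nm x2 = n ^+ 2.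
Proof.
apply: cancel3R; rewrite -tr_B_W // kummer_B2 trE [tr x1 _]trC tr_B_W //; ring.
Qed.

(** Both T(a * b) and T(b * a), multiplied by [n], equal tr(a.x1, b.x2), because the action is
    self-adjoint; and the products a * b and b * a add up to twice the Jordan product. *)
Lemma T_km a b : inH a -> inH b -> T (km a b) = tr a b.
Proof.
move=> ha hb.
have canc (u v : R) : n * u = n * v -> u = v.
  by move=> /(congr1 (GRing.mul nV)); rewrite !mulrA hn !mul1r.
have sym : T (km a b) = T (km b a).
  have kab := inH_km a b; have kba := inH_km b a.
  apply: canc; rewrite -!TZ -kummer_qf // -(kummer_qf12r kba).
  rewrite !T_qf //; try by apply: inW_act.
  by rewrite -act_act2 // tr_act.
have := congr1 T (km_jm ha hb); rewrite TD TZ T_jm -sym => E.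
by apply: cancel2R; rewrite -E; ring.
Qed.

Lemma tr_W1W1 a b : inH a -> inH b -> tr (act a x1) (act b x1) = 0.
Proof.
by move=> ha hb; rewrite -T_qf ?inW_act // (qf_act_isotropic ha hb hx1 q11) TE.
Qed.
Lemma tr_W2W2 a b : inH a -> inH b -> tr (act a x2) (act b x2) = 0.
Proof.
by move=> ha hb; rewrite -T_qf ?inW_act // (qf_act_isotropic ha hb hx2 q22) TE.
Qed.

Lemma Nm_kummer h a b : inH h -> inH a -> inH b ->
  Nm (h + act a x1 + act b x2) =
  Nm h + n * Nm a + n ^+ 2 * Nm b - n * tr h (km a b).
Proof.
move=> hh ha hb; have h1 := inW_act ha hx1; have h2 := inW_act hb hx2.
have Q1 : Q (act a x1) = 0.
  by rewrite QE (qf_act_isotropic ha ha hx1 q11) scaler0.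
have Q2 : Q (act b x2) = 0.
  by rewrite QE (qf_act_isotropic hb hb hx2 q22) scaler0.
have s1 : sharp (act a x1) = B (act a x1) by rewrite sharp_W Q1 subr0.
have s2 : sharp (act b x2) = B (act b x2) by rewrite sharp_W Q2 subr0.
rewrite NmD NmD !sharpD s1 s2 !trE !Nm_act // Nm_x2.
rewrite (sub_tr_orth sH (inH_sharp hh) h1) (sub_tr_orth sH (inH_sharp hh) h2).
rewrite !(tr_WH (inW_B _) hh) (tr_crA cs) (tr_qf _ _ hh) kummer_qf //.
have -> : tr (B (act a x1)) (act b x2) = 0.
  by rewrite B_act // tr_W2W2 // inH_sharp.
have -> : tr (B (act b x2)) (act a x1) = 0.
  by rewrite B_act // kummer_B2 aE trE tr_W1W1 ?inH_sharp // mulr0.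
rewrite !trE; ring.
Qed.

(** * Associativity, similarities and Skolem-Noether *)

Section KummerAssoc.
Variables (t v : J).
Hypotheses (ht : inH t) (hv : inH v).
Hypothesis jgen : forall G : J -> Prop,
  (forall x y, G x -> G y -> G (x + y)) -> (forall k x, G x -> G (k *: x)) ->
  G one -> G t -> G (jm t t) -> G v -> G (jm v v) ->
  G (jm t v) -> G (jm (jm t t) v) -> G (jm t (jm v v)) ->
  G (jm (jm t t) (jm v v)) -> forall z, inH z -> G z.

Lemma km_assoc a b c : km (km a b) c = km a (km b c).
Proof.
have dbl (x : J) : x + x = 0 -> x = 0.
  by move=> E; apply: cancel2; rewrite scaler0 -E; mring.
have nullW z : inW z -> null km z.
  by move=> hz x; rewrite -(km_pl z) hz km0l -(km_pr x z) hz km0r.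
suff : assoc km a b c = 0.
  by rewrite assocE => /eqP; rewrite subr_eq0 => /eqP.
have htt := inH_jm ht ht; have hvv := inH_jm hv hv.
apply: (artin kmDl kmDr kmZl kmZr km_lalt km_ralt dbl (e := one) (t := t) (v := v)).
  move=> x y; rewrite assocE -(km_pr one x) km_one_l ?(subK sH) // km_pl.
  by rewrite -(km_pr one) inH_km km_one_l ?inH_km // subrr.
move=> G GD GZ Gn G1 Gt Gtt Gv Gvv Gtv Gvt Gttv Gvtt Gtvv Gvvt Gttvv Gvvtt z.
rewrite -(subrK (pH z) z); apply: (GD); first by apply: Gn; apply: nullW; apply: inW_sub.
(* A Jordan word is half the sum of the two associative words, so the Jordan spanning set is covered
   by the associative one. *)
have Gj x y : inH x -> inH y -> G (km x y) -> G (km y x) -> G (jm x y).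
  move=> hx hy gx gy; rewrite -[jm x y]scale1r -halfE mulrC -scalerA -km_jm //.
  by apply: (GZ); apply: (GD).
rewrite !km_sq // in Gtt Gvv Gttv Gvtt Gtvv Gvvt Gttvv Gvvtt.
apply: (jgen (G := G)) => //; try (by apply: (Gj)).
exact: (subK sH).
Qed.

(** Take norms of a.(b.x1) = (a * b).x1 and cancel N(x1). *)
Lemma Nm_km a b : inH a -> inH b -> Nm (km a b) = Nm a * Nm b.
Proof.
move=> ha hb.
have canc (u w : R) : u * n = w * n -> u = w.
  by move=> /(congr1 (GRing.mul^~ nV)); rewrite /= -!mulrA ![n * nV]mulrC hn !mulr1.
have kab := inH_km a b.
apply: canc; rewrite -Nm_act // -act_act1 // !Nm_act ?inW_act //; ring.
Qed.
Lemma km_sharp a : inH a -> km a (sharp a) = Nm a *: one.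
Proof.
move=> ha; have hs := inH_sharp ha; have h1 := inHZ (Nm a) (sub_one sH).
apply: kummer_act1_inj => //; first exact: inH_km.
by rewrite -act_act1 // act_act_sharp // aE act1.
Qed.
Lemma km_sharpl a : inH a -> km (sharp a) a = Nm a *: one.
Proof.
move=> ha; have hs := inH_sharp ha; have h1 := inHZ (Nm a) (sub_one sH).
apply: kummer_act1_inj => //; first exact: inH_km.
by rewrite -act_act1 // act_sharp_act // aE act1.
Qed.

Definition kc1 j := nV *: qf (j - pH j) x2.
Definition kc2 j := nV *: qf x1 (j - pH j).
Lemma inH_kc1 j : inH (kc1 j). Proof. by apply: inHZ; apply: inH_qf. Qed.
Lemma inH_kc2 j : inH (kc2 j). Proof. by apply: inHZ; apply: inH_qf. Qed.
Lemma kcE h a b : inH h -> inH a -> inH b ->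
  [/\ pH (h + act a x1 + act b x2) = h,
      kc1 (h + act a x1 + act b x2) = a &
      kc2 (h + act a x1 + act b x2) = b].
Proof.
move=> hh ha hb; have h1 := inW_act ha hx1; have h2 := inW_act hb hx2.
have E : pH (h + act a x1 + act b x2) = h by rewrite !subE hh h1 h2 !addr0.
have E2 : h + act a x1 + act b x2 - h = act a x1 + act b x2 by mring.
split=> //; apply: kummer_cancel; rewrite /kc1 /kc2 E E2 !scalerA [n * _]mulrC hn scale1r qE.
  rewrite kummer_qf12 // -{2}(act1 hx2) qf_act_isotropic ?addr0 //; exact: (sub_one sH).
rewrite kummer_qf12r // -{1}(act1 hx1) qf_act_isotropic ?add0r //; exact: (sub_one sH).
Qed.
Lemma kummer_decomp j : j = pH j + act (kc1 j) x1 + act (kc2 j) x2.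
Proof.
have [a [b [ha hb E]]] := hdec (inW_sub j).
have Ej : j = pH j + act a x1 + act b x2.
  by rewrite -addrA -E; mring.
by have [_] := kcE (subK sH j) ha hb; rewrite -Ej => -> ->.
Qed.

(** In coordinates (h, a, b) this is h |-> g h g', a |-> g'^-1 a y, b |-> nu y^-1 b g^-1. In the
    product of the three images the inner factors cancel and cyclicity of the trace removes [g], so
    T(h * a * b) is multiplied by [nu]. *)
Definition smap g g' g'i gi y yi nu j :=
  km (km g (pH j)) g' + act (km (km g'i (kc1 j)) y) x1
  + act (nu *: km (km yi (kc2 j)) gi) x2.

(** The condition on N(y) is what makes the two outer coordinates scale by N(g) N(g') like the first
    one. *)
Lemma Nm_smap g g' g'i gi y yi j :
  inH g -> inH g' -> inH g'i -> inH gi -> inH y -> inH yi ->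
  km gi g = one -> km g' g'i = one -> km y yi = one ->
  Nm y = Nm g * Nm g' ^+ 2 ->
  Nm (smap g g' g'i gi y yi (Nm g * Nm g') j) = Nm g * Nm g' * Nm j.
Proof.
move=> hg hg' hg'i hgi hy hyi E1 E2 E3 Ey.
have N1 : Nm gi * Nm g = 1 by rewrite -Nm_km // E1 Nm_one.
have N2 : Nm g' * Nm g'i = 1 by rewrite -Nm_km // E2 Nm_one.
have N3 : Nm y * Nm yi = 1 by rewrite -Nm_km // E3 Nm_one.
rewrite [in RHS](kummer_decomp j).
have hh := subK sH j; have h1 := inH_kc1 j; have h2 := inH_kc2 j.
rewrite /smap; move: (pH j) (kc1 j) (kc2 j) hh h1 h2 => h a b hh ha hb.
set nu := Nm g * Nm g'.
rewrite !Nm_kummer ?(inH_km, inHZ) //; try by apply: inHZ; apply: inH_km.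
rewrite NmZ !Nm_km ?inH_km //.
have -> : tr (km (km g h) g') (km (km (km g'i a) y) (nu *: km (km yi b) gi)) =
   nu * tr h (km a b).
  rewrite -T_km ?inH_km // !kE TE; congr (_ * _).
  have -> : km (km (km g h) g') (km (km (km g'i a) y) (km (km yi b) gi)) =
     km g (km h (km (km g' g'i) (km a (km (km y yi) (km b gi))))).
    by rewrite !km_assoc.
  rewrite E2 E3 !km_one_l ?inH_km // T_km ?inH_km // trC -T_km ?inH_km //.
  by rewrite !km_assoc E1 km_one_r // T_km ?inH_km.
rewrite /nu Ey; clear nu.
have -> : Nm g'i * Nm a * (Nm g * Nm g' ^+ 2) =
   Nm g' * Nm g'i * (Nm a * Nm g * Nm g') by ring.
rewrite N2.
have -> : (Nm g * Nm g') ^+ 3 * (Nm yi * Nm b * Nm gi) =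
   Nm y * Nm yi * (Nm gi * Nm g) * (Nm g * Nm g' * Nm b) by rewrite Ey; ring.
by rewrite N1 N3; ring.
Qed.

Hypothesis hinv : forall a, inH a -> a <> 0 -> exists k, k * Nm a = 1.

Lemma km_inverse a : inH a -> a <> 0 ->
  exists ai, [/\ inH ai, km a ai = one & km ai a = one].
Proof.
move=> ha a0; have [k hk] := hinv ha a0; exists (k *: sharp a); split.
- by apply: inHZ; apply: inH_sharp.
- by rewrite kE km_sharp // scalerA hk scale1r.
by rewrite kE km_sharpl // scalerA hk scale1r.
Qed.
Lemma km_domain a b : inH a -> inH b -> km a b = 0 -> a = 0 \/ b = 0.
Proof.
move=> ha hb E; case: (a =P 0) => [|a0]; [by left | right].
have [ai [hai _ E2]] := km_inverse ha a0.
by rewrite -(km_one_l hb) -E2 km_assoc E km0r.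
Qed.

Lemma skolem_noether (p p' k c : J) (al be ga : R) :
  inH p -> inH p' -> inH k -> inH c ->
  km p (km p p) + al *: km p p + be *: p + ga *: one = 0 ->
  km p' (km p' p') + al *: km p' p' + be *: p' + ga *: one = 0 ->
  km k p <> km p k -> km c p' <> km p' c ->
  exists2 g, inH g /\ g <> 0 & km g p = km p' g.
Proof.
move=> hp hp' hk hc fp fp' nk nc.
(* With f the common cubic polynomial, this is the divided difference of f at left multiplication by
   p' and right multiplication by p. Hence p' b(x) - b(x) p = f(p') x - x f(p) = 0, and every
   nonzero value of [b] is an intertwiner. *)
pose b x := km (km p' p') x + km p' (km x p) + km x (km p p)
  + al *: (km p' x + km x p) + be *: x.
have bP x : inH x -> km (b x) p = km p' (b x).
  move=> hx; have Fp := congr1 (km x) fp; have Fp' := congr1 (km^~ x) fp'.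
  rewrite /= !kE km_one_l // in Fp'; rewrite !kE km_one_r // in Fp.
  rewrite /b !kE !km_assoc; rewrite !km_assoc in Fp Fp'.
  by apply: (lin_comb 1 Fp); apply: (lin_comb (-1) Fp'); mring.
have hb x : inH x -> inH (b x).
  by move=> hx; rewrite /b; do ![apply: inHD | apply: inHZ | apply: inH_km | done].
case: (b one =P 0) => [b1|n1]; last first.
  by exists (b one); [split=> //; apply: hb; apply: (sub_one sH)|apply: bP; apply: (sub_one sH)].
case: (b k =P 0) => [bk|nk']; last first.
  by exists (b k); [split=> //; apply: hb|apply: bP].
case: (b c =P 0) => [bc|n1]; last first.
  by exists (b c); [split=> //; apply: hb|apply: bP].
case: (b (km c k) =P 0) => [bck|n1]; last first.
  by exists (b (km c k)); [split=> //; apply: hb|apply: bP]; apply: inH_km.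
exfalso.
(* If [b] vanishes at 1, k, c and c k, compare b(k) with b(1) k, and below b(c k) with b(c) k. *)
have F1 : km p' (km k p - km p k) + (km k (km p p) - km (km p p) k)
   + al *: (km k p - km p k) = 0.
  have E := congr1 (km^~ k) b1; rewrite /= km0l /b !kE in E.
  rewrite /b in bk; rewrite !km_one_l ?inH_km // !km_one_r ?inH_km // in E.
  rewrite !km_assoc in E bk.
  by rewrite !kE !km_assoc; apply: (lin_comb 1 bk); apply: (lin_comb (-1) E); mring.
have F2 : km p' (km c (km k p - km p k)) + km c (km k (km p p) - km (km p p) k)
   + al *: (km c (km k p - km p k)) = 0.
  have E := congr1 (km^~ k) bc; rewrite /= km0l /b !kE in E.
  rewrite /b in bck; rewrite !km_assoc in E bck.
  by rewrite !kE !km_assoc; apply: (lin_comb 1 bck); apply: (lin_comb (-1) E); mring.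
have F3 : km (km c p' - km p' c) (km k p - km p k) = 0.
  have E := congr1 (km c) F1; rewrite !kE !km_assoc in E.
  rewrite !kE !km_assoc in F2.
  by rewrite !kE !km_assoc; apply: (lin_comb 1 E); apply: (lin_comb (-1) F2); mring.
case: (km_domain _ _ F3) => [||/eqP|/eqP].
- by apply: inHD; [|apply: inHN]; apply: inH_km.
- by apply: inHD; [|apply: inHN]; apply: inH_km.
- by rewrite subr_eq0 => /eqP.
by rewrite subr_eq0 => /eqP.
Qed.

(** Linearisation of a # * a = N(a) 1, checked by acting on [x1]. *)
Lemma km_sharp_polar a b : inH a -> inH b ->
  km (sharp a) b + km (cr a b) a = tr (sharp a) b *: one.
Proof.
move=> ha hb; have hs := inH_sharp ha; have hab := sub_cr sH ha hb.
apply: kummer_act1_inj.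
- by apply: inHD; apply: inH_km.
- by apply: inHZ; apply: (sub_one sH).
rewrite !aE act1 // -!act_act1 //.
have := cr_adjoint cs a a b x1.
rewrite (sub_tr_orth sH (sub_cr sH ha ha) hx1) (sub_tr_orth sH hab hx1).
rewrite cr_xx (cr_act b) (cr_act a x1) crC crNr crE.
rewrite [cr (- act a x1) _]crC !(crNl, crNr, trE).
move=> E; apply: cancel2; apply: (lin_comb 1 E).
rewrite !crZr !(crC (act _ _)) !cr_act; mring.
Qed.

Lemma km_centralizer a x : inH a -> inH x -> x <> 0 -> km a x = km x a ->
  T x = 0 -> tr a x = 0 -> tr (jm a a) x = 0 ->
  3 *: jm a a - (2 * T a) *: a + (half * Sq a a) *: one = 0.
Proof.
move=> ha hx x0 ax Tx tx ttx.
have aa : km a a = jm a a := km_sq ha.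
have jx : jm a x = km a x.
  by apply: cancel2; rewrite -km_jm // -ax; mring.
have E := km_sharp_polar ha hx.
have sa : sharp a = jm a a - T a *: a + (half * Sq a a) *: one.
  rewrite jm_xx; mring.
have cx : cr a x = 2 *: km a x - T a *: x.
  have := jmE a x; rewrite jx Tx /Sq Tx tx => E2.
  by apply: (lin_comb (-1) E2); mring.
have [] := km_domain (a := 3 *: jm a a - (2 * T a) *: a + (half * Sq a a) *: one) (b := x).
- by do ![apply: inHD | apply: inHN | apply: inHZ | apply: inH_jm | apply: (sub_one sH) | done].
- by [].
- move: E; rewrite cx sa !(trE, kE) ttx tx [tr one x]trC -/(T x) Tx km_one_l //.
  rewrite km_assoc -ax -aa !km_assoc => E.
  by apply: (lin_comb 1 E); mring.
- by [].
by [].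
Qed.

Lemma km_cubic_comm a b c p : inH p ->
  let l := a *: one + b *: p + c *: jm p p in km p l = km l p.
Proof.
move=> hp /=; set l := (X in km p X).
have hl : inH l.
  by do ![apply: inHD | apply: inHZ | apply: inH_jm | apply: (sub_one sH) | done].
apply: kummer_act1_inj; try exact: inH_km.
rewrite -!act_act1 //.
have := @act_cubic_comm 0 1 0 a b c p x1 hp hx1.
by rewrite /= -/l !scale0r scale1r addr0 add0r.
Qed.

Lemma km_commutant a b c p x z : inH p -> inH x ->
  3 *: jm p p - (2 * T p) *: p + (half * Sq p p) *: one <> 0 ->
  T x = 0 -> tr p x = 0 -> tr (jm p p) x = 0 ->
  z = a *: one + b *: p + c *: jm p p + x -> km p z = km z p -> x = 0.
Proof.
move=> hp hx sep Tx tx ttx -> E; case: (x =P 0) => // x0; case: sep.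
apply: (km_centralizer hp hx x0) => //.
have F := km_cubic_comm a b c hp; rewrite /= in F.
by move: E; rewrite kmDr F [km (_ + x) p]kmDl => /addrI.
Qed.

Lemma smap_H g g' g'i gi y yi nu j : inH j ->
  smap g g' g'i gi y yi nu j = km (km g j) g'.
Proof.
move=> hj; have [E0 E1 E2] := kcE hj (sub0) (sub0).
rewrite !act0l !addr0 in E0 E1 E2.
by rewrite /smap E0 E1 E2 !kE scaler0 !act0l !addr0.
Qed.
Lemma smap_linear g g' g'i gi y yi nu k x z :
  smap g g' g'i gi y yi nu (k *: x + z) =
  k *: smap g g' g'i gi y yi nu x + smap g g' g'i gi y yi nu z.
Proof.
rewrite /smap /kc1 /kc2 !(subE, qE, kE, aE); mring.
Qed.

Lemma km_pow p : inH p -> km p (jm p p) = jm p (jm p p).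
Proof.
move=> hp; have := km_cubic_comm 0 0 1 hp; rewrite /= !scale0r scale1r !add0r => E.
have hpp := inH_jm hp hp; have F := km_jm hp hpp; rewrite -E in F.
by apply: cancel2; rewrite -F; mring.
Qed.

Lemma km_noncomm p x : inH p -> inH x -> x <> 0 ->
  3 *: jm p p - (2 * T p) *: p + (half * Sq p p) *: one <> 0 ->
  T x = 0 -> tr p x = 0 -> tr (jm p p) x = 0 -> km x p <> km p x.
Proof.
move=> hp hx x0 sep Tx tx ttx E; apply: x0.
apply: (@km_commutant 0 0 0 p x x hp hx sep Tx tx ttx) => //.
by rewrite !scale0r !add0r.
Qed.

Lemma smap_cubic p p' a b c g g' g'i gi y yi nu : inH p -> inH p' ->
  inH g -> km g p = km p' g ->
  smap g g' g'i gi y yi nu (a *: one + b *: p + c *: jm p p) =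
  a *: km g g' + b *: km p' (km g g') + c *: km p' (km p' (km g g')).
Proof.
move=> hp hp' hg E; rewrite smap_H; last first.
  by do ![apply: inHD | apply: inHZ | apply: inH_jm | apply: (sub_one sH) | done].
rewrite !kE -km_sq // km_one_r // -(km_assoc g p p) E (km_assoc p' g p) E.
by rewrite !km_assoc.
Qed.

(* iota is the conjugation of a quadratic extension, hence reverses km on H. *)
Section Hermitian.
Variables (iota : J -> J) (cj : R -> R).
Hypothesis iotaD : forall x y, iota (x + y) = iota x + iota y.
Hypothesis iotaZ : forall k x, iota (k *: x) = cj k *: iota x.
Hypothesis iotaK : forall x, iota (iota x) = x.
Hypothesis iota_cr : forall x y, iota (cr x y) = cr (iota x) (iota y).
Hypothesis iota_pH : forall x, iota (pH x) = pH (iota x).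
Hypothesis iota_one : iota one = one.
Hypothesis iota_Nm : forall x, Nm (iota x) = cj (Nm x).
Hypothesis cjK : forall k, cj (cj k) = k.
Hypothesis iota_x1 : forall a, inH a -> iota x1 <> act a x1.

Lemma iotaN x : iota (- x) = - iota x.
Proof.
have i0 : iota 0 = 0 by have := iotaD 0 0; rewrite addr0 => /eqP; rewrite -subr_eq0 opprD addNKr oppr_eq0 => /eqP.
by apply/eqP; rewrite -addr_eq0 -iotaD addNr i0.
Qed.
Lemma iota_act a w : iota (act a w) = act (iota a) (iota w).
Proof. by rewrite !actE iotaN iota_cr. Qed.
Lemma iota_qf x y : iota (qf x y) = qf (iota x) (iota y).
Proof. by rewrite !qfE iotaN iota_pH iota_cr. Qed.
Lemma iota_inH a : inH a -> inH (iota a).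
Proof. by move=> ha; rewrite -iota_pH ha. Qed.
Lemma iota_inW w : inW w -> inW (iota w).
Proof.
move=> hw; rewrite -iota_pH hw; have := iotaD 0 0; rewrite addr0 => /eqP.
by rewrite -subr_eq0 opprD addNKr oppr_eq0 => /eqP.
Qed.

(** The image of [x1] is again isotropic, so its coefficients satisfy a * c = 0. One of them is
    zero, and it is not [c], since the image is not in H.x1. *)
Lemma iota_x1E : exists c, [/\ inH c, c <> 0 & iota x1 = act c x2].
Proof.
have [a [c [ha hc E]]] := hdec (iota_inW hx1).
have q0 : qf (iota x1) (iota x1) = 0.
  rewrite -iota_qf q11 //; have := iotaD 0 0; rewrite addr0 => /eqP.
  by rewrite -subr_eq0 opprD addNKr oppr_eq0 => /eqP.
have Eac : km a c = 0.
  apply: kummer_cancel; apply: cancel2; rewrite !scaler0 -kummer_qf //.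
  rewrite E !qE (qf_act_isotropic ha ha hx1 q11) (qf_act_isotropic hc hc hx2 q22) in q0.
  by rewrite [qf (act c _) _]qfC in q0; apply: (lin_comb 1 q0); mring.
case: (km_domain ha hc Eac) => [a0 | c0]; last first.
  by case: (iota_x1 ha); rewrite E c0 act0l addr0.
exists c; split=> //; last by rewrite E a0 act0l add0r.
by move=> c0; case: (iota_x1 ha); rewrite E c0 act0l addr0.
Qed.

Variable c : J.
Hypotheses (hc : inH c) (c0 : c <> 0) (Ec : iota x1 = act c x2).

(** The reversal of factors comes from [iota] sending H.x1 into H.x2, where H acts in the opposite
    order; the common left factor [c] is then cancelled. *)
Lemma iota_km a b : inH a -> inH b -> iota (km a b) = km (iota b) (iota a).
Proof.
move=> ha hb; have ha' := iota_inH ha; have hb' := iota_inH hb.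
have hab := iota_inH (inH_km a b).
have E : km c (iota (km a b)) = km c (km (iota b) (iota a)).
  rewrite -km_assoc; apply: kummer_act2_inj; try exact: inH_km.
  rewrite -!act_act2 ?inH_km // -Ec -!iota_act -act_act1 //.
have /(km_domain hc) : km c (iota (km a b) - km (iota b) (iota a)) = 0.
  by rewrite kmDr kmNr E subrr.
case=> //; first by apply: inHD => //; apply: inHN; apply: inH_km.
by move/eqP; rewrite subr_eq0 => /eqP.
Qed.

(** The element is [qf x1 (iota x1)], visibly symmetric under [iota]. *)
Lemma iota_u : iota (n *: c) = n *: c.
Proof.
by rewrite -[n *: c](kummer_qf12r hc) -Ec iota_qf iotaK qfC.
Qed.

Lemma hermitian_similarity g m mu ui :
  inH g -> g <> 0 -> inH m -> m <> 0 -> iota m = m ->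
  inH ui -> km (n *: c) ui = one -> km ui (n *: c) = one ->
  km m g - km (iota g) m = mu *: ui ->
  exists g'i gi y yi, let s := smap g (iota g) g'i gi y yi (Nm g * Nm (iota g)) in
    (forall j, Nm (s j) = Nm g * Nm (iota g) * Nm j) /\
    (forall j, iota j = j -> iota (s j) = s j).
Proof.
move=> hg g0 hm m0 Em hui uui uiu Emu.
have Eu : iota (n *: c) = n *: c := iota_u.
have hu : inH (n *: c) by apply: inHZ.
have [u Du] : exists u, u = n *: c by exists (n *: c).
rewrite -Du in Eu hu uui uiu.
have hg' := iota_inH hg; set g' := iota g in hg' Emu *.
have Eg' : iota g' = g by rewrite /g' iotaK.
have ne0 a : inH a -> iota a = 0 -> a = 0.
  move=> ha E; rewrite -(iotaK a) E; have := iotaD 0 0; rewrite addr0 => /eqP.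
  by rewrite -subr_eq0 opprD addNKr oppr_eq0 => /eqP.
have g'0 : g' <> 0 by move=> E; apply: g0; apply: ne0.
have [gi [hgi ggi gig]] := km_inverse hg g0.
have [g'i [hg'i gg'i g'ig]] := km_inverse hg' g'0.
have Eg'i : iota g'i = gi.
  have E : km (iota g'i) g = one by rewrite -Eg' -iota_km // gg'i iota_one.
  by rewrite -(km_one_r (iota_inH hg'i)) -ggi -km_assoc E km_one_l.
have [P DP] : exists P, P = km m g by exists (km m g).
have [P' DP'] : exists P', P' = km g' m by exists (km g' m).
have hP : inH P by rewrite DP; apply: inH_km.
have hP' : inH P' by rewrite DP'; apply: inH_km.
have P0 : P <> 0 by rewrite DP => E; case: (km_domain hm hg E).
have P'0 : P' <> 0 by rewrite DP' => E; case: (km_domain hg' hm E).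
have EP : iota P = P' by rewrite DP DP' iota_km // Em.
have EP' : iota P' = P by rewrite DP DP' iota_km // Em Eg'.
have [Pi [hPi PPi PiP]] := km_inverse hP P0.
have [Qi [hQi QQi QiQ]] := km_inverse hP' P'0.
have EPi : iota Pi = Qi.
  have E : km (iota Pi) P' = one by rewrite -EP -iota_km // PPi iota_one.
  by rewrite -(km_one_r (iota_inH hPi)) -QQi -km_assoc E km_one_l.
have EQi : iota Qi = Pi by rewrite -EPi iotaK.
have Eui : iota ui = ui.
  have E : km (iota ui) u = one by rewrite -{1}Eu -iota_km // uui iota_one.
  by rewrite -(km_one_r (iota_inH hui)) -uui -km_assoc E km_one_l.
(* P is P' plus a multiple of u^-1, and the correction contributes the same multiple of P' to both
   sides. *)
have PuQ : km P (km u P') = km P' (km u P).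
  have -> : P = P' + mu *: ui.
    by rewrite -Emu DP DP' addrC subrK.
  by rewrite !kE uui -(km_assoc ui) uiu km_one_l // km_one_r.
have inv3 : km Qi (km ui Pi) = km Pi (km ui Qi).
  have E : km (km P (km u P')) (km Qi (km ui Pi)) = one.
    by rewrite !km_assoc -(km_assoc P' Qi) QQi km_one_l ?inH_km // -(km_assoc u ui) uui km_one_l.
  have F : km (km Pi (km ui Qi)) (km P' (km u P)) = one.
    by rewrite !km_assoc -(km_assoc Qi P') QiQ km_one_l ?inH_km // -(km_assoc ui u) uiu km_one_l.
  rewrite -[LHS]km_one_l ?inH_km // -F -PuQ km_assoc E km_one_r //; exact: inH_km.
pose d := Nm g; pose d' := Nm g'.
have Ed : cj d = d' by rewrite /d /d' iota_Nm.
have Ed' : cj d' = d by rewrite -Ed cjK.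
have [k hk] := hinv hg g0; have [k' hk'] := hinv hg' g'0.
rewrite -/d in hk; rewrite -/d' in hk'.
(* The scalar d' = N(g') is forced by the norm condition: P and P' have norms N(m) N(g) and N(m)
   N(g'), so the product has norm N(g) N(g')^2. *)
pose y := d' *: km u (km P (km Qi ui)).
pose yi := k' *: km u (km P' (km Pi ui)).
have hy : inH y by apply: inHZ; apply: inH_km.
have hyi : inH yi by apply: inHZ; apply: inH_km.
have yyi : km y yi = one.
  rewrite /y /yi !kE scalerA [d' * _]mulrC hk' scale1r.
  rewrite !km_assoc -(km_assoc ui u) uiu km_one_l ?inH_km //.
  rewrite -(km_assoc Qi P') QiQ km_one_l ?inH_km //.
  by rewrite -(km_assoc P Pi) PPi km_one_l.
have Nu : Nm u * Nm ui = 1 by rewrite -Nm_km // uui Nm_one.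
have NQ : Nm P' * Nm Qi = 1 by rewrite -Nm_km // QQi Nm_one.
have Ny : Nm y = d * d' ^+ 2.
  have N1 : Nm Qi * Nm P' = 1 by rewrite mulrC.
  have NP : Nm P * d' = Nm P' * d.
    by rewrite DP DP' !Nm_km // /d /d'; ring.
  rewrite /y NmZ !Nm_km ?inH_km //.
  transitivity (d' ^+ 2 * (Nm P * d') * Nm Qi * (Nm u * Nm ui)); first by ring.
  rewrite Nu NP; transitivity (d * d' ^+ 2 * (Nm P' * Nm Qi)); first by ring.
  by rewrite NQ mulr1.
have yi' : iota y = d *: km ui (km Pi (km P' u)).
  rewrite /y iotaZ Ed' !iota_km ?inH_km // EP EQi Eu Eui.
  by rewrite !km_assoc.
have ycy : km y (km u (iota y)) = (d * d') *: u.
  rewrite yi' /y !kE scalerA [d * d']mulrC; congr (_ *: _).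
  rewrite -(km_assoc u ui) uui km_one_l ?inH_km //.
  have -> : km (km u (km P (km Qi ui))) (km Pi (km P' u)) =
     km u (km P (km (km Qi (km ui Pi)) (km P' u))) by rewrite !km_assoc.
  rewrite inv3 !km_assoc -(km_assoc Qi P') QiQ km_one_l // -(km_assoc P Pi) PPi.
  by rewrite km_one_l ?inH_km // uiu km_one_r.
(* This is y u iota(y) = N(g) N(g') u solved for the form in which it enters the comparison of the
   two W-coordinates. *)
have cy : km c (iota y) = (d * d') *: km yi c.
  have yiy : km yi y = one.
    rewrite /y /yi !kE scalerA hk' scale1r.
    rewrite !km_assoc -(km_assoc ui u) uiu km_one_l ?inH_km //.
    rewrite -(km_assoc Pi P) PiP km_one_l ?inH_km //.
    by rewrite -(km_assoc P' Qi) QQi km_one_l.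
  apply: kummer_cancel; rewrite -kmZl -Du -[km u _]km_one_l ?inH_km // -yiy km_assoc ycy.
  by rewrite Du !kE; mring.
exists g'i, gi, y, yi; split=> j.
  exact: (Nm_smap _ hg hg' hg'i hgi hy hyi).
move=> Ej.
have [ci [hci cci cic]] := km_inverse hc c0.
have hh := subK sH j; have h1 := inH_kc1 j; have h2 := inH_kc2 j.
have E := kummer_decomp j.
rewrite /smap; move: (pH j) (kc1 j) (kc2 j) hh h1 h2 E => h a b hh ha hb E.
have x2E : x2 = act ci (iota x1) by rewrite Ec act_act2 // cci act1.
have ha' := iota_inH ha; have hb' := iota_inH hb; have hci' := iota_inH hci.
have i1 a' : inH a' -> iota (act a' x1) = act (km c (iota a')) x2.
  by move=> ha1; rewrite iota_act Ec act_act2 //; apply: iota_inH.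
have i2 a' : inH a' -> iota (act a' x2) = act (km (iota a') (iota ci)) x1.
  move=> ha1; rewrite {1}x2E !iota_act iotaK act_act1 //; exact: iota_inH.
have F : h + (act a x1 + act b x2) =
   iota h + (act (km (iota b) (iota ci)) x1 + act (km c (iota a)) x2).
  by rewrite addrA -E -{1}Ej E !iotaD i1 // i2 //; mring.
have [Fh Fw] : h = iota h /\ act a x1 + act b x2 =
   act (km (iota b) (iota ci)) x1 + act (km c (iota a)) x2.
  apply: HW_inj F => //; first exact: iota_inH.
    by apply: inWD; apply: inW_act.
  by apply: inWD; apply: inW_act => //; apply: inH_km.
have [Fa Fb] := kummer_act_inj ha hb (inH_km _ _) (inH_km _ _) Fw.
rewrite !iotaD.
have -> : iota (km (km g h) g') = km (km g h) g'.
  by rewrite !iota_km ?inH_km // Eg' -Fh km_assoc.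
have hA : inH (km (km g'i a) y) := inH_km _ _.
(* For fixed [j] the conjugation interchanges the two W-summands, with b = c * iota(a); it remains
   to see that their images are interchanged too. *)
have K : iota (act (km (km g'i a) y) x1) =
    act ((Nm g * Nm g') *: km (km yi b) gi) x2.
  rewrite i1 //; congr act; rewrite !iota_km ?inH_km // Eg'i Fb.
  by rewrite -km_assoc cy !kE !km_assoc.
rewrite K -K iotaK; mring.
Qed.

(** Since g p^i iota(g) = p'^i g iota(g), this puts the image of K[p] under h |-> g h iota(g) into
    the centralizer of p'. *)
Lemma hermitian_square g p p' : inH g -> inH p -> inH p' ->
  iota p = p -> iota p' = p' -> km g p = km p' g ->
  iota (km g (iota g)) = km g (iota g) /\
  km p' (km g (iota g)) = km (km g (iota g)) p'.
Proof.
move=> hg hp hp' Ep Ep' E; have hg' := iota_inH hg.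
split; first by rewrite iota_km // iotaK.
have F : km p (iota g) = km (iota g) p'.
  by rewrite -{1}Ep -iota_km // E iota_km // Ep'.
by rewrite -km_assoc -E !km_assoc F.
Qed.
End Hermitian.
End KummerAssoc.
End Kummer.
End Subalgebra.
End CubicTheory.

(** Allows a symmetric four-linear identity to be checked on the diagonal only. *)
Lemma quartic_polarization (R : comNzRingType) (J : lmodType R) (i6 : R)
    (F : J -> J -> J -> J -> J) :
  i6 * 6 = 1 ->
  (forall x x' y z w, F (x + x') y z w = F x y z w + F x' y z w) ->
  (forall x y z w, F x y z w = F y x z w) ->
  (forall x y z w, F x y z w = F x z y w) ->
  (forall x y z w, F x y z w = F x y w z) ->
  (forall x, F x x x x = 0) -> forall x y z w, F x y z w = 0.
Proof.
move=> h6 D1 s12 s23 s34 diag.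
have c2 (u : J) : 2 *: u = 0 -> u = 0.
  move=> E; rewrite -[u]scale1r -h6; have -> : i6 * 6 = (3 * i6) * 2 by ring.
  by rewrite -scalerA E scaler0.
have c3 (u : J) : 3 *: u = 0 -> u = 0.
  move=> E; rewrite -[u]scale1r -h6; have -> : i6 * 6 = (2 * i6) * 3 by ring.
  by rewrite -scalerA E scaler0.
have D2 x x' y z w : F y (x + x') z w = F y x z w + F y x' z w.
  by rewrite s12 D1 (s12 x) (s12 x').
have D3 x x' y z w : F y z (x + x') w = F y z x w + F y z x' w.
  by rewrite s23 D2 (s23 y x) (s23 y x').
have D4 x x' y z w : F y z w (x + x') = F y z w x + F y z w x'.
  by rewrite s34 D3 (s34 y z x) (s34 y z x').
have N1 x y z w : F (- x) y z w = - F x y z w.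
  have Z : F 0 y z w = 0.
    by have /eqP := D1 0 0 y z w; rewrite addr0 -subr_eq0 opprD addrA subrr sub0r oppr_eq0 => /eqP.
  by apply/eqP; rewrite -addr_eq0 -D1 addNr Z.
have N2 x y z w : F y (- x) z w = - F y x z w by rewrite s12 N1 s12.
have N3 x y z w : F y z (- x) w = - F y z x w by rewrite s23 N2 s23.
have N4 x y z w : F y z w (- x) = - F y z w x by rewrite s34 N3 s34.
have xxyy x y : F x x y y = 0.
  (* Adding the diagonal values at x + y and x - y cancels the odd terms and leaves 12 F(x, x, y,
     y). *)
  apply: (c3); do 2 apply: (c2).
  have Ep := diag (x + y); have Em := diag (x - y).
  rewrite !(D1, D2, D3, D4, N1, N2, N3, N4) !diag in Ep Em.
  have w1 : F x y x y = F x x y y by rewrite s23.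
  have w2 : F x y y x = F x x y y by rewrite s34 w1.
  have w3 : F y x x y = F x x y y by rewrite s12 w1.
  have w4 : F y x y x = F x x y y by rewrite s12 w2.
  have w5 : F y y x x = F x x y y by rewrite s23 w4.
  rewrite w1 w2 w3 w4 w5 in Ep Em.
  by apply: (lin_comb 1 Ep); apply: (lin_comb 1 Em); mring.
have xzyy x z y : F x z y y = 0.
  apply: (c2); have E := xxyy (x + z) y; rewrite D1 !D2 !xxyy (s12 z x) in E.
  by apply: (lin_comb 1 E); mring.
move=> x y z w; apply: (c2); have E := xzyy x y (z + w).
rewrite D3 !D4 !xzyy (s34 x y w z) in E.
by apply: (lin_comb 1 E); mring.
Qed.

(** * From a degree 3 Jordan algebra with anisotropic norm to a cubic structure *)

Section JordanCubic.
Variables (K : fieldType) (A : lmodType K).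
Variables (mul : A -> A -> A) (one : A).
Variables (T : A -> K) (Sb : A -> A -> K) (Nb : A -> A -> A -> K).
Hypotheses (two0 : (2 : K) != 0) (three0 : (3 : K) != 0).
Hypothesis mulC : forall x y, mul x y = mul y x.
Hypothesis mulP : forall x a y z, mul x (a *: y + z) = a *: mul x y + mul x z.
Hypothesis mul1 : forall x, mul one x = x.
Hypothesis jordan : forall x y,
  mul (mul (mul x x) y) x = mul (mul x x) (mul y x).
Hypothesis TD : forall x y, T (x + y) = T x + T y.
Hypothesis TZ : forall k x, T (k *: x) = k * T x.
Hypothesis SDl : forall x y z, Sb (x + y) z = Sb x z + Sb y z.
Hypothesis SDr : forall x y z, Sb z (x + y) = Sb z x + Sb z y.
Hypothesis SZl : forall k x z, Sb (k *: x) z = k * Sb x z.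
Hypothesis SZr : forall k x z, Sb z (k *: x) = k * Sb z x.
Hypothesis ND1 : forall x y z w, Nb (x + y) z w = Nb x z w + Nb y z w.
Hypothesis ND2 : forall x y z w, Nb z (x + y) w = Nb z x w + Nb z y w.
Hypothesis ND3 : forall x y z w, Nb z w (x + y) = Nb z w x + Nb z w y.
Hypothesis NZ1 : forall k x z w, Nb (k *: x) z w = k * Nb x z w.
Hypothesis NZ2 : forall k x z w, Nb z (k *: x) w = k * Nb z x w.
Hypothesis NZ3 : forall k x z w, Nb z w (k *: x) = k * Nb z w x.
Local Notation S x := (Sb x x).
Local Notation N x := (Nb x x x).
Hypothesis cayley : forall x,
  mul x (mul x x) - T x *: mul x x + S x *: x - N x *: one = 0.
Hypothesis N1 : N one = 1.
Hypothesis aniso : forall x, N x = 0 -> x = 0.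

Let mulDr x y z : mul z (x + y) = mul z x + mul z y.
Proof. by rewrite -[x]scale1r mulP !scale1r. Qed.
Let mul_0r x : mul x 0 = 0.
Proof. by have := mulP x (-1) 0 0; rewrite scaler0 addr0 scaleN1r addNr. Qed.
Let mulZr k x z : mul z (k *: x) = k *: mul z x.
Proof. by rewrite -[k *: x]addr0 mulP mul_0r addr0. Qed.
Let mulDl x y z : mul (x + y) z = mul x z + mul y z.
Proof. by rewrite mulC mulDr !(mulC z). Qed.
Let mulZl k x z : mul (k *: x) z = k *: mul x z.
Proof. by rewrite mulC mulZr (mulC z). Qed.
Let mulNl x z : mul (- x) z = - mul x z.
Proof. by rewrite -scaleN1r mulZl scaleN1r. Qed.
Let mulNr x z : mul z (- x) = - mul z x.
Proof. by rewrite -scaleN1r mulZr scaleN1r. Qed.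
Let mul_1r x : mul x one = x. Proof. by rewrite mulC. Qed.
Let mE := (mulDl, mulDr, mulZl, mulZr, mulNl, mulNr, mul1, mul_1r).
Let TN x : T (- x) = - T x.
Proof. by rewrite -scaleN1r TZ mulN1r. Qed.
Let SNl x z : Sb (- x) z = - Sb x z.
Proof. by rewrite -scaleN1r SZl mulN1r. Qed.
Let SNr x z : Sb z (- x) = - Sb z x.
Proof. by rewrite -scaleN1r SZr mulN1r. Qed.
Let NN1 x z w : Nb (- x) z w = - Nb x z w.
Proof. by rewrite -scaleN1r NZ1 mulN1r. Qed.
Let NN2 x z w : Nb z (- x) w = - Nb z x w.
Proof. by rewrite -scaleN1r NZ2 mulN1r. Qed.
Let NN3 x z w : Nb z w (- x) = - Nb z w x.
Proof. by rewrite -scaleN1r NZ3 mulN1r. Qed.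
Let fE := (TD, TZ, TN, SDl, SDr, SZl, SZr, SNl, SNr, ND1, ND2, ND3, NZ1, NZ2,
  NZ3, NN1, NN2, NN3).

Definition S2 x y := Sb x y + Sb y x.
Definition N3 x y z :=
  Nb x y z + Nb x z y + Nb y x z + Nb y z x + Nb z x y + Nb z y x.

Let sixE : (6 : K) = 2 * 3. Proof. ring. Qed.
Let i6 : K := 6^-1.
Let i6E : i6 * 6 = 1.
Proof. by rewrite mulVf // sixE mulf_neq0. Qed.
Let c2 (u v : A) : 2 *: u = 2 *: v -> u = v.
Proof. exact: scalerI. Qed.
Let one0 : one != 0.
Proof.
apply/eqP => E; have := N1; rewrite E -(scale0r 0) NZ1 mul0r => /eqP.
by rewrite eq_sym oner_eq0.
Qed.

Let polar_cayley x y z :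
  2 *: (mul x (mul y z) + mul y (mul x z) + mul z (mul x y))
  - 2 *: (T x *: mul y z + T y *: mul x z + T z *: mul x y)
  + (S2 x y *: z + S2 x z *: y + S2 y z *: x) - N3 x y z *: one = 0.
Proof.
have E123 := cayley (x + y + z).
have E12 := cayley (x + y); have E13 := cayley (x + z); have E23 := cayley (y + z).
have E1 := cayley x; have E2 := cayley y; have E3 := cayley z.
rewrite !mE !fE (mulC y x) (mulC z x) (mulC z y) in E123 E12 E13 E23 E1 E2 E3.
apply: (lin_comb 1 E123); apply: (lin_comb (-1) E12); apply: (lin_comb (-1) E13).
apply: (lin_comb (-1) E23); apply: (lin_comb 1 E1); apply: (lin_comb 1 E2).
apply: (lin_comb 1 E3); rewrite /S2 /N3; mring.
Qed.

Let polar_jordan x z w y :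
  mul (mul (mul x z) y) w + mul (mul (mul z w) y) x + mul (mul (mul x w) y) z =
  mul (mul x z) (mul y w) + mul (mul z w) (mul y x) + mul (mul x w) (mul y z).
Proof.
have E123 := jordan (x + z + w) y.
have E12 := jordan (x + z) y; have E13 := jordan (x + w) y.
have E23 := jordan (z + w) y.
have E1 := jordan x y; have E2 := jordan z y; have E3 := jordan w y.
rewrite !mE (mulC z x) (mulC w x) (mulC w z) in E123 E12 E13 E23 E1 E2 E3.
apply: c2; apply: (lin_comb 1 E123); apply: (lin_comb (-1) E12).
apply: (lin_comb (-1) E13); apply: (lin_comb (-1) E23); apply: (lin_comb 1 E1).
apply: (lin_comb 1 E2); apply: (lin_comb 1 E3); mring.
Qed.

Let der x y z := locked (mul x (mul y z) - mul y (mul x z)).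
Let derE x y z : der x y z = mul x (mul y z) - mul y (mul x z).
Proof. by rewrite /der -lock. Qed.
(** In a Jordan algebra the commutator of two multiplication operators is a derivation: it is the
    difference of two instances of the linearised Jordan identity. *)
Let der_mul x y z w : der x y (mul z w) = mul (der x y z) w + mul z (der x y w).
Proof.
have pj a b : mul w (mul b (mul a z)) + mul a (mul b (mul z w)) + mul z (mul b (mul a w)) =
    mul (mul a z) (mul b w) + mul (mul z w) (mul a b) + mul (mul a w) (mul b z).
  have := polar_jordan a z w b.
  rewrite (mulC (mul (mul a z) b)) (mulC (mul a z) b) (mulC (mul (mul z w) b)).
  rewrite (mulC (mul z w) b) (mulC (mul (mul a w) b)) (mulC (mul a w) b).
  by rewrite (mulC b a).
have E1 := pj x y; have E2 := pj y x; rewrite !derE !mE.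
rewrite (mulC (mul x (mul y z)) w) (mulC (mul y (mul x z)) w).
rewrite (mulC y x) (mulC (mul y z)) (mulC (mul y w)) in E2.
apply: (lin_comb 1 E1); apply: (lin_comb (-1) E2); mring.
Qed.

(** Compare the coefficients of x0^2 in the polarised cubic equation at (x0, x0, one). *)
Lemma jordan_cubic_T1 x0 :
  (forall a b c, a *: one + b *: x0 + c *: mul x0 x0 = 0 -> [/\ a = 0, b = 0 & c = 0]) ->
  T one = 3.
Proof.
move=> ind; have E := polar_cayley x0 x0 one; rewrite !mE in E.
have [] := ind (S2 x0 x0 - N3 x0 x0 one) (2 * S2 x0 one - 4 * T x0) (6 - 2 * T one).
  by apply: (lin_comb 1 E); mring.
move=> _ _ /eqP; rewrite subr_eq0 (_ : (6 : K) = 2 * 3); last by ring.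
by move=> /eqP /(mulfI two0).
Qed.

Hypothesis T1 : T one = 3.
Let S1 : S one = 3.
Proof.
have := cayley one; rewrite !mE N1 T1 => E.
have : (S one - 3) *: one = 0 by apply: (lin_comb 1 E); mring.
by move=> /eqP; rewrite scaler_eq0 (negPf one0) orbF subr_eq0 => /eqP.
Qed.
Let S2_one x : S2 x one = 2 * T x.
Proof.
have E := polar_cayley x x one; rewrite !mE T1 in E.
(* Either the coefficient of [x] vanishes, which is the claim, or [x] is a scalar and the claim is
   computed directly. *)
case: (2 * S2 x one - 4 * T x =P 0) => [/eqP|/eqP nz].
  rewrite subr_eq0 (_ : (4 : K) = 2 * 2); last by ring.
  by rewrite -mulrA => /eqP /(mulfI two0).
have Ex : x = (- (2 * S2 x one - 4 * T x)^-1 * (S2 x x - N3 x x one)) *: one.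
  apply: (scalerI nz); rewrite scalerA mulrA mulrN divff // mulN1r.
  by apply: (lin_comb 1 E); mring.
rewrite Ex; move: (- _ * _) => k; rewrite /S2 !fE S1 T1; ring.
Qed.
Let N3_one x : N3 x x one = 2 * S x.
Proof.
have E := polar_cayley x x one; rewrite !mE T1 S2_one in E.
have : (2 * S x - N3 x x one) *: one = 0.
  by apply: (lin_comb 1 E); rewrite /S2; mring.
by move=> /eqP; rewrite scaler_eq0 (negPf one0) orbF subr_eq0 => /eqP.
Qed.
Let N3_one2 x : N3 x one one = 2 * T x.
Proof.
have E1 := N3_one (x + one); have E2 := N3_one x; have E3 := N3_one one.
have E4 := S2_one x; rewrite /N3 /S2 !fE in E1 E2 E3 E4 *.
apply: (mulfI two0).
apply: (lin_comb_scal 1 E1); apply: (lin_comb_scal (-1) E2).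
apply: (lin_comb_scal (-1) E3); apply: (lin_comb_scal 2 E4); ring.
Qed.
(** The norm of k 1 - x is the generic polynomial of [x] at [k], so by anisotropy a root in K makes
    [x] scalar. *)
Let N_shift k x : N (k *: one - x) = k ^+ 3 - k ^+ 2 * T x + k * S x - N x.
Proof.
have E1 := N3_one x; have E2 := N3_one2 x; rewrite /N3 in E1 E2.
apply: (mulfI two0); rewrite !fE N1.
apply: (lin_comb_scal k E1); apply: (lin_comb_scal (- k ^+ 2) E2); ring.
Qed.

Let scalar_or_free x : x <> (T x / 3) *: one ->
  forall a b c, a *: one + b *: x + c *: mul x x = 0 -> [/\ a = 0, b = 0 & c = 0].
Proof.
move=> nx a b c E.
have nsc k : x <> k *: one.
  by move=> Ex; apply: nx; rewrite {2}Ex TZ T1 mulfK.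
have c0 : c = 0.
  case: (c =P 0) => // /eqP nz; exfalso.
  have [al [be Exx]] : exists al be, mul x x = al *: x + be *: one.
    exists (- b / c), (- a / c).
    apply: (scalerI nz); rewrite scalerDr !scalerA ![c * _]mulrC !mulfVK //.
    by apply: (lin_comb 1 E); mring.
  have F := cayley x; rewrite Exx !mE Exx in F.
  have F2 : ((al - T x) * al + be + S x) *: x + ((al - T x) * be - N x) *: one = 0.
    by apply: (lin_comb 1 F); mring.
  have G1 : (al - T x) * al + be + S x = 0.
    case: ((al - T x) * al + be + S x =P 0) => // /eqP nz2; case: (nsc (- ((al - T x) * al + be + S x)^-1 * ((al - T x) * be - N x))).
    apply: (scalerI nz2); rewrite scalerA mulrA mulrN divff // mulN1r.
    by apply: (lin_comb 1 F2); mring.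
  have G2 : (al - T x) * be - N x = 0.
    move: F2; rewrite G1 scale0r add0r => /eqP.
    by rewrite scaler_eq0 (negPf one0) orbF => /eqP.
  (* If x^2 = al x + be, the generic polynomial factors as (X^2 - al X - be)(X - (T(x) - al)). *)
  apply: (nsc (T x - al)); apply/eqP; rewrite -subr_eq0 -oppr_eq0 opprB.
  apply/eqP/aniso; rewrite N_shift.
  by apply: (lin_comb_scal (T x - al) G1); apply: (lin_comb_scal 1 G2); ring.
have b0 : b = 0.
  case: (b =P 0) => // /eqP nz; case: (nsc (- b^-1 * a)).
  apply: (scalerI nz); rewrite scalerA mulrA mulrN divff // mulN1r.
  by apply: (lin_comb 1 E); rewrite c0; mring.
split=> //; move: E; rewrite b0 c0 !scale0r !addr0 => /eqP.
by rewrite scaler_eq0 (negPf one0) orbF => /eqP.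
Qed.

Let cube x : mul x (mul x x) = T x *: mul x x - S x *: x + N x *: one.
Proof. by have E := cayley x; apply: (lin_comb 1 E); mring. Qed.
Let sq_sq x : mul (mul x x) (mul x x) =
  T x *: mul x (mul x x) - S x *: mul x x + N x *: x.
Proof.
rewrite -jordan mulC [mul (mul x x) x]mulC {1}cube !mE; mring.
Qed.
Let sq_cube x : mul (mul x x) (mul x (mul x x)) =
  T x *: mul (mul x x) (mul x x) - S x *: mul x (mul x x) + N x *: mul x x.
Proof. by rewrite {1}cube !mE (mulC (mul x x) x); mring. Qed.

Let T_sq x : T (mul x x) = T x ^+ 2 - 2 * S x.
Proof.
case: (x =P (T x / 3) *: one) => [->|nx].
  by move: (T x / 3) => k; rewrite !(fE, mE) T1 S1; ring.
have ind := scalar_or_free nx.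
have ny : mul x x <> (T (mul x x) / 3) *: one.
  move=> E; have [] := ind (- (T (mul x x) / 3)) 0 1.
    by rewrite scale0r addr0 scale1r {2}E scaleNr addNr.
  by move=> _ _ /eqP; rewrite oner_eq0.
have indy := scalar_or_free ny.
(* The powers of x^2, reduced by the equation of [x], satisfy a second cubic equation for x^2. Both
   must agree, as 1, x^2, x^4 are independent. *)
have C := cayley (mul x x).
have [] := indy (- (N (mul x x) - N x ^+ 2))
  (S (mul x x) - (S x ^+ 2 - 2 * T x * N x)) (- (T (mul x x) - (T x ^+ 2 - 2 * S x))).
  apply: (lin_comb 1 C).
  rewrite !sq_sq !mE sq_cube sq_sq ?(mulC (mul x x) x) ?cube ?mE ?cube; mring.
by move=> _ _ /eqP; rewrite oppr_eq0 subr_eq0 => /eqP.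
Qed.

Let S2E x y : S2 x y = T x * T y - T (mul x y).
Proof.
have E := T_sq (x + y); have E1 := T_sq x; have E2 := T_sq y.
rewrite !(mE, fE) (mulC y x) in E; apply: (mulfI two0); rewrite /S2.
by apply: (lin_comb_scal 1 E); apply: (lin_comb_scal (-1) E1);
  apply: (lin_comb_scal (-1) E2); ring.
Qed.
Let SE x : 2 * S x = T x ^+ 2 - T (mul x x).
Proof. by rewrite T_sq; ring. Qed.

(** Apply the derivation to the cubic equation of [z] and compare with the polarised equation at (z,
    z, D z): the coefficient of z^2 is a multiple of T(D z). *)
Let T_der x y z : T (der x y z) = 0.
Proof.
case: (z =P (T z / 3) *: one) => [->|nz].
  move: (T z / 3) => k; rewrite derE !mE (mulC y x) subrr.
  by have := TZ 0 0; rewrite scale0r mul0r.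
have ind := scalar_or_free nz; set d := der x y z.
have derZ k u : der x y (k *: u) = k *: der x y u by rewrite !derE !mE; mring.
have derD u w : der x y (u + w) = der x y u + der x y w by rewrite !derE !mE; mring.
have der1 : der x y one = 0 by rewrite derE !mE (mulC y x) subrr.
have E := congr1 (der x y) (cayley z).
rewrite -!scaleNr !(derD, derZ, der_mul, der1) -/d !mE in E.
have E0 : der x y 0 = 0 by have := derZ 0 0; rewrite !scale0r.
rewrite E0 in E.
have P := polar_cayley z z d.
have [] := ind (- N3 z z d) (2 * S2 z d) (- 2 * T d).
  rewrite (mulC d z) in E.
  apply: (lin_comb 1 P); apply: (lin_comb (-2) E); rewrite /S2; mring.
by move=> _ _ /eqP; rewrite mulf_eq0 oppr_eq0 (negPf two0) => /eqP.
Qed.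

Let T_assoc x y z : T (mul (mul x y) z) = T (mul x (mul y z)).
Proof.
have := T_der x z y; rewrite derE !fE => /eqP; rewrite subr_eq0 => /eqP.
by rewrite (mulC z y) (mulC (mul x y)) => ->.
Qed.

Definition jordan_cross x y :=
  locked (2 *: mul x y - T x *: y - T y *: x + S2 x y *: one).
Lemma jordan_crossE x y : jordan_cross x y =
  2 *: mul x y - T x *: y - T y *: x + S2 x y *: one.
Proof. by rewrite /jordan_cross -lock. Qed.

Lemma jordan_cubic_structure :
  cubic_structure jordan_cross (fun x y => T (mul x y)) one i6.
Proof.
have crC x y : jordan_cross x y = jordan_cross y x.
  by rewrite !jordan_crossE mulC /S2; mring.
have crD x y z : jordan_cross (x + y) z = jordan_cross x z + jordan_cross y z.
  by rewrite !jordan_crossE /S2 !(mE, fE); mring.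
have crZ a x z : jordan_cross (a *: x) z = a *: jordan_cross x z.
  by rewrite !jordan_crossE /S2 !(mE, fE); mring.
have trA x y z : T (mul (jordan_cross x y) z) = T (mul x (jordan_cross y z)).
  by rewrite !jordan_crossE !(mE, fE) !S2E T_assoc; ring.
split=> //.
- by move=> x y; rewrite mulC.
- by move=> x y z; rewrite !(mE, fE).
- by move=> x y z; rewrite !(mE, fE).
- by move=> x; rewrite !jordan_crossE S2E !mE T1; mring.
- by rewrite !mE T1.
(* By polarisation only the diagonal case, which amounts to (x #) # = N(x) x, needs a
   computation. *)
move=> x y z w; apply/eqP; rewrite -subr_eq0; apply/eqP; move: x y z w.
pose tr x y := locked (T (mul x y)).
have trE x y : tr x y = T (mul x y) by rewrite /tr -lock.
pose F x y z w := jordan_cross (jordan_cross x y) (jordan_cross z w) + jordan_cross (jordan_cross x z) (jordan_cross y w) + jordan_cross (jordan_cross x w) (jordan_cross y z)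
  - (tr (jordan_cross x y) z *: w + tr (jordan_cross x y) w *: z + tr (jordan_cross x z) w *: y + tr (jordan_cross y z) w *: x).
suff FP : forall x y z w, F x y z w = 0.
  by move=> x y z w; rewrite -[RHS](FP x y z w) /F !trE.
have tC x y : tr x y = tr y x by rewrite !trE mulC.
have cDr x y z : jordan_cross z (x + y) = jordan_cross z x + jordan_cross z y by rewrite crC crD !(crC z).
have tD x y z : tr (x + y) z = tr x z + tr y z by rewrite !trE !(mE, fE).
have tsw x y z : tr (jordan_cross x y) z = tr (jordan_cross x z) y.
  by rewrite !trE trA [jordan_cross y z]crC -trA.
apply: (quartic_polarization (F := F) i6E).
- move=> x x' y z w; rewrite /F !(crD, cDr, tD); mring.
- move=> x y z w; rewrite /F !(crC y x) (crC (jordan_cross y z)) (crC (jordan_cross y w)); mring.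
- move=> x y z w; rewrite /F (crC z y) (tsw x z y); mring.
- move=> x y z w; rewrite /F (crC w z) (tsw x w z) (tsw y w z); mring.
move=> x; rewrite /F.
have Ecr : jordan_cross x x = 2 *: (mul x x - T x *: x + S x *: one).
  by rewrite !jordan_crossE /S2; mring.
have Es : mul x (mul x x - T x *: x + S x *: one) = N x *: one.
  by rewrite !mE cube; mring.
set s := mul x x - T x *: x + S x *: one in Ecr Es *.
have Ts : T s = S x by rewrite /s !fE T1 T_sq; ring.
have Tss : T (mul s s) = S x ^+ 2 - 2 * T x * N x.
  rewrite /s !mE sq_sq (mulC (mul x x) x) !cube !fE T1 T_sq; ring.
have Ess : jordan_cross s s = (2 * N x) *: x.
  rewrite !jordan_crossE S2E Ts Tss /s !mE sq_sq (mulC (mul x x) x) !cube; mring.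
have Exxx : tr (jordan_cross x x) x = 6 * N x.
  by rewrite trE Ecr mulZl mulC Es !TZ T1; ring.
have Exx2 : jordan_cross (jordan_cross x x) (jordan_cross x x) = (8 * N x) *: x.
  by rewrite Ecr crZ crC crZ Ess; mring.
by rewrite Exxx Exx2; mring.
Qed.

Lemma jordan_cubic_norm x : Nm jordan_cross (fun x y => T (mul x y)) i6 x = N x.
Proof.
rewrite NmE jordan_crossE !mE !fE (mulC (mul x x)) cube !fE T1 T_sq /S2.
transitivity (i6 * 6 * N x); last by rewrite i6E mul1r.
ring.
Qed.
Lemma jordan_cubic_jm x y : jm jordan_cross (fun x y => T (mul x y)) one i6 x y = mul x y.
Proof.
rewrite jm_def jordan_crossE /Sq /tr1 !mE S2E.
transitivity ((i6 * 6) *: mul x y); last by rewrite i6E scale1r.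
rewrite /half; mring.
Qed.
End JordanCubic.

(** * Linear maps and dimension counts *)

Section LinearMaps.
Variables (K : fieldType) (aT rT : vectType K) (f : aT -> rT).
Hypothesis f_lin : forall k x y, f (k *: x + y) = k *: f x + f y.

Lemma lfun_of_linear : exists g : 'Hom(aT, rT), g =1 f.
Proof.
pose g : {linear aT -> rT} := HB.pack f (GRing.isLinear.Build _ _ _ _ f f_lin).
by exists (linfun g) => x; rewrite lfunE.
Qed.

Hypothesis f_inj : forall x, f x = 0 -> x = 0.

Lemma image_of_linear : exists2 U : {vspace rT}, \dim U = dim aT &
  forall y, y \in U <-> exists x, y = f x.
Proof.
have [g Eg] := lfun_of_linear; exists (limg g).
  have := limg_dim_eq (f := g) (U := fullv); rewrite dimvf => -> //.
  apply/eqP; rewrite -subv0; apply/subvP => x; rewrite memv_cap memvf /=.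
  by rewrite memv_ker memv0 Eg => /eqP /f_inj ->.
move=> y; split=> [/memv_imgP [x _ ->]|[x ->]]; first by exists x; rewrite Eg.
by rewrite -Eg memv_img ?memvf.
Qed.

Lemma surjective_of_dim : dim aT = dim rT -> forall y, exists x, y = f x.
Proof.
move=> E y; have [U dU mU] := image_of_linear; apply/mU.
suff -> : U = fullv by apply: memvf.
by apply/eqP; rewrite eqEdim subvf dU E dimvf /=.
Qed.
End LinearMaps.

(** * Anisotropic norms: orthogonal projections *)

Section Division.
Variables (K : fieldType) (A : vectType K).
Variables (cr : A -> A -> A) (tr : A -> A -> K) (one : A) (i6 : K).
Hypothesis cs : cubic_structure cr tr one i6.
Local Notation T := (tr1 tr one).
Local Notation Nm := (Nm cr tr i6).
Local Notation jm := (jm cr tr one i6).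
Local Notation sharp := (sharp cr i6).
Hypothesis aniso : forall x, Nm x = 0 -> x = 0.

Lemma aniso_sharp x : sharp x = 0 -> x = 0.
Proof.
move=> E; apply: aniso; apply: (cancel3R cs); rewrite mulr0 -(tr_sharp cs).
by rewrite E (tr0l cs).
Qed.

(** The trace form is nondegenerate on H: for nonzero x in H, the element x # of H satisfies tr(x #,
    x) = 3 N(x), which is nonzero. Counting the equations that define the orthogonal complement then
    shows that the sum is everything. *)
Lemma orthogonal_projection (H : {vspace A}) : one \in H ->
  (forall x y, x \in H -> y \in H -> cr x y \in H) ->
  exists pH : A -> A, [/\ cubic_sub cr tr one pH,
    forall x, x \in H <-> pH x = x &
    forall y, (forall h, h \in H -> tr y h = 0) -> pH y = 0].
Proof.
move=> h1 hcr.
have [g Eg] := @lfun_of_linear K A 'rV[K]_(\dim H)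
  (fun w => \row_i tr w (vbasis H)`_i) (fun k x y =>
   ltac:(by apply/rowP => i; rewrite !mxE !(tr_addl cs) !(tr_scalel cs))).
pose W := lker g.
have WP w : reflect (forall h, h \in H -> tr w h = 0) (w \in W).
  rewrite memv_ker Eg; apply: (iffP eqP) => [E h hh|E].
    rewrite (coord_vbasis hh); elim/big_ind: _ => [|x y Ex Ey|i _].
    - exact: (tr0r cs).
    - by rewrite (trDr cs) Ex Ey addr0.
    by rewrite (trZr cs); have /rowP/(_ i) := E; rewrite !mxE => ->; rewrite mulr0.
  apply/rowP => i; rewrite !mxE; apply: E.
  by apply: vbasis_mem; apply: mem_nth; rewrite size_tuple.
have HW0 : (H :&: W)%VS = 0%VS.
  apply/eqP; rewrite -subv0; apply/subvP => h; rewrite memv_cap memv0.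
  case/andP => hh /WP hw; apply/eqP/aniso; apply: (cancel3R cs).
  rewrite mulr0 -(tr_sharp cs) (tr_comm cs); apply: hw.
  by rewrite sharpE; apply: memvZ; apply: hcr.
have WH0 : (W :&: H)%VS = 0%VS by rewrite capvC.
have full : (H + W)%VS = fullv.
  apply/eqP; rewrite eqEdim subvf /= dimv_disjoint_sum //.
  have := limg_ker_dim g fullv; rewrite capfv -/W => <-.
  rewrite addnC leq_add2r; have := dimvS (subvf (limg g)).
  by rewrite dimvf /dim /= mul1n.
have dec x : daddv_pi H W x + daddv_pi W H x = x.
  by apply: daddv_pi_add => //; rewrite full memvf.
have pW x : daddv_pi H W x = 0 <-> x \in W.
  split=> [E|hx]; first by rewrite -(dec x) E add0r memv_pi.
  by have := dec x; rewrite (daddv_pi_id WH0 hx) => /eqP; rewrite -subr_eq0 addrK => /eqP.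
have pHx x : x \in H <-> daddv_pi H W x = x.
  split => [hx | <-]; last exact: memv_pi.
  exact: (daddv_pi_id HW0 hx).
exists (daddv_pi H W); split=> //; last by move=> y hy; apply/pW/WP.
split.
- by move=> x y; rewrite linearD.
- by move=> a x; rewrite linearZ.
- by move=> x; apply/pHx; apply: memv_pi.
- exact/pHx.
- by move=> x y /pHx hx /pHx hy; apply/pHx; apply: hcr.
- move=> x y /pHx hx /pW /WP hy; apply/pW/WP => h hh.
  by rewrite (cr_comm cs) (tr_crA cs); apply: hy; apply: hcr.
by move=> x y /pHx hx /pW /WP hy; rewrite (tr_comm cs); apply: hy.
Qed.

Lemma act_eq0 pH (sH : cubic_sub cr tr one pH) a w : pH a = a -> pH w = 0 ->
  act cr a w = 0 -> a = 0 \/ w = 0.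
Proof.
move=> ha hw E; have := Nm_act cs sH ha hw.
have N0 : Nm 0 = 0 by rewrite NmE (tr0r cs) mulr0.
rewrite E N0 => /esym/eqP; rewrite mulf_eq0.
by case/orP => /eqP /aniso; [left | right].
Qed.

Lemma aniso_sub pH (sH : cubic_sub cr tr one pH) lam x : pH lam = lam ->
  pH x = 0 -> act cr lam x = B cr i6 pH x -> sharp lam = Q cr i6 pH x -> x = 0.
Proof.
move=> hl hx E1 E2; have := sharp_add_eq0 cs hl hx E1 E2.
by move=> /aniso_sharp /(HW_eq0 sH hl hx) [].
Qed.

(** * The 9-dimensional subalgebra generated by L and an element orthogonal to it *)

Section NineDimensional.
Variables (L : {vspace A}) (t : A) (pL : A -> A).
Hypothesis dimL : \dim L = 3%N.
Hypothesis Lspan : forall x, x \in L ->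
  exists a b c, x = a *: one + b *: t + c *: jm t t.
Hypothesis sL : cubic_sub cr tr one pL.
Hypothesis memL : forall x, x \in L <-> pL x = x.
Hypothesis tL : t \in L.
Local Notation act := (act cr).
Local Notation Q := (Q cr i6 pL).
Local Notation B := (B cr i6 pL).
Local Notation qf := (qf cr pL).
Local Notation bt := (bt cr pL).
Local Notation inH a := (pL a = a).
Local Notation inW a := (pL a = 0).

Lemma actL_mul a b w : inH a -> inH b -> inW w -> act a (act b w) = act (jm a b) w.
Proof.
move=> ha hb hw; apply: (cancel2 cs); rewrite -(act_jm cs sL) //.
have [a1 [a2 [a3 Ea]]] := Lspan (proj2 (memL a) ha).
have [b1 [b2 [b3 Eb]]] := Lspan (proj2 (memL b) hb).
have := act_cubic_comm cs sL a1 a2 a3 b1 b2 b3 (proj1 (memL t) tL) hw.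
by rewrite /= -Ea -Eb => ->; mring.
Qed.

(** Comparing two expressions for the pairing of v with B v gives lam q(v) = N(v)/2, and applying B
    again gives N(lam) = N(v)/2. For nonzero lam this yields lam # = q(v), so lam + v has zero
    adjoint. *)
Lemma B_not_proportional lam v : inH lam -> inW v -> B v = act lam v -> v = 0.
Proof.
move=> hl hv E; have hQ := inH_Q i6 sL v; have h1 := sub_one sL.
have jQ : jm lam (Q v) = (half i6 * Nm v) *: one.
  have E1 := qf_act_B cs sL h1 hv; rewrite (act1 cs sL hv) E (qfC cs) in E1.
  have E2 := qf_act1 cs sL hl hv hv; rewrite [qf v (act _ _)](qfC cs) E1 in E2.
  rewrite (qf_xx cs) (jmZr cs) in E2.
  apply: (cancel2 cs); apply: (cancel2 cs); rewrite -E2.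
  by transitivity (((2 * half i6) * 2 * Nm v) *: one); [rewrite (halfE cs)|]; mring.
have Nl : (Nm lam - half i6 * Nm v) *: v = 0.
  have [_ E1] := sharp_sharp_W cs sL hv.
  rewrite {1}E (B_act cs sL) // E (act_sharp_act cs sL) // actL_mul // in E1.
  rewrite (jmC cs) jQ (actZl cs) (act1 cs sL hv) in E1.
  apply: (lin_comb 1 E1); have h2 := halfE cs.
  transitivity ((Nm lam - (half i6) * Nm v) *: v); first by mring.
  transitivity ((Nm lam + half i6 * Nm v - (2 * half i6) * Nm v) *: v); first by mring.
  by rewrite h2; mring.
case: (v =P 0) => // /eqP v0; exfalso.
move: Nl => /eqP; rewrite scaler_eq0 (negPf v0) orbF subr_eq0 => /eqP Nl.
case: (lam =P 0) => [l0|l0].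
  have Nv : Nm v = 0.
    have := Nl; rewrite l0 NmE (tr0r cs) mulr0 => /esym E0.
    by rewrite -[Nm v]mul1r -(halfE cs) -mulrA E0 mulr0.
  by move: v0; rewrite (aniso Nv) eqxx.
move: (v0); rewrite (aniso_sub sL hl hv) ?eqxx //.
have hs := inH_sharp i6 sL hl.
have hd : inH (sharp lam - Q v) by apply: (inHD sL) => //; apply: (inHN sL).
have : act lam (act (sharp lam - Q v) v) = 0.
  rewrite actL_mul // (jmDr cs) -[- Q v]scaleN1r (jmZr cs) jQ (jm_sharp cs) Nl.
  by rewrite scaleN1r subrr (act0l cs).
case/(act_eq0 sL hl (inW_act sL hd hv)) => // /(act_eq0 sL hd hv) [] => [/eqP|Ev].
  by rewrite subr_eq0 => /eqP.
by move: v0; rewrite Ev eqxx.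
Qed.

Variable v : A.
Hypotheses (hv : inW v) (v0 : v <> 0).
Local Notation w := (B v).
Let hw : inW w := inW_B i6 sL v.

Lemma nine_dim_free m k : inH m -> inH k -> act m v + act k w = 0 ->
  m = 0 /\ k = 0.
Proof.
move=> hm hk E; have k0 : k = 0.
  case: (k =P 0) => // /eqP nz; case: v0.
  have Nk : Nm k != 0 by apply: contra nz => /eqP /aniso ->.
  have hs := inH_sharp i6 sL hk.
  apply: (@B_not_proportional (- (Nm k)^-1 *: jm (sharp k) m)) => //.
    by apply: (inHZ sL); apply: (inH_jm i6 sL).
  rewrite (actZl cs) -actL_mul //.
  have -> : act m v = - act k w by apply: (lin_comb 1 E); mring.
  rewrite (actNr cs) (act_sharp_act cs sL) // scalerN scaleNr opprK scalerA.
  by rewrite mulVf // scale1r.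
split=> //; move: E; rewrite k0 (act0l cs) addr0 => /(act_eq0 sL hm hv) [] //.
Qed.

(** [w] is used instead of v #: it is the component of v # orthogonal to L, on which L acts. *)
Definition nine_dim_mem h := exists l m k,
  [/\ inH l, inH m, inH k & h = l + act m v + act k w].
Let HPD x y : nine_dim_mem x -> nine_dim_mem y -> nine_dim_mem (x + y).
Proof.
move=> [l [m [k [hl hm hk ->]]]] [l' [m' [k' [hl' hm' hk' ->]]]].
exists (l + l'), (m + m'), (k + k'); split; try by apply: (inHD sL).
by rewrite !(actDl cs); mring.
Qed.
Let HPZ a x : nine_dim_mem x -> nine_dim_mem (a *: x).
Proof.
move=> [l [m [k [hl hm hk ->]]]]; exists (a *: l), (a *: m), (a *: k).
by split; try (by apply: (inHZ sL)); rewrite !(actZl cs); mring.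
Qed.
Let HPN x : nine_dim_mem x -> nine_dim_mem (- x).
Proof. by rewrite -scaleN1r; apply: HPZ. Qed.
Let L0 : inH 0 := sub0 sL.
Let HPl l : inH l -> nine_dim_mem l.
Proof. by move=> hl; exists l, 0, 0; split=> //; rewrite !(act0l cs) !addr0. Qed.
Let HPv m : inH m -> nine_dim_mem (act m v).
Proof. by move=> hm; exists 0, m, 0; split=> //; rewrite !(act0l cs) addr0 add0r. Qed.
Let HPw k : inH k -> nine_dim_mem (act k w).
Proof. by move=> hk; exists 0, 0, k; split=> //; rewrite !(act0l cs) !add0r. Qed.

Lemma nine_dim_closed x y : nine_dim_mem x -> nine_dim_mem y -> nine_dim_mem (cr x y).
Proof.
have hQ := inH_Q i6 sL v.
have jmL a b : inH a -> inH b -> inH (jm a b) by move=> *; apply: (inH_jm i6 sL).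
have crL a b : inH a -> inH b -> inH (cr a b) by move=> *; apply: (sub_cr sL).
have ll a b : inH a -> inH b -> nine_dim_mem (cr a b).
  by move=> ha hb; apply: HPl; apply: crL.
have lv a b : inH a -> inH b -> nine_dim_mem (cr a (act b v)).
  by move=> ha hb; rewrite cr_act; apply: HPN; rewrite actL_mul //; apply: HPv; apply: jmL.
have lw a b : inH a -> inH b -> nine_dim_mem (cr a (act b w)).
  by move=> ha hb; rewrite cr_act; apply: HPN; rewrite actL_mul //; apply: HPw; apply: jmL.
have qL a b : nine_dim_mem (- qf a b) by apply: HPN; apply: HPl; apply: (inH_qf sL).
have btx a b z : inH a -> inH b -> inW z ->
    bt (act a z) (act b z) = act (cr a b) (B z).
  move=> ha hb hz; have := bt_act cs sL ha hb hz hz; rewrite (bt_xx cs) (actZr cs) => E.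
  by apply: (cancel2 cs); rewrite -E; mring.
have vv a b : inH a -> inH b -> nine_dim_mem (cr (act a v) (act b v)).
  move=> ha hb; rewrite (cr_WW cr pL) btx //; apply: HPD; last exact: qL.
  by apply: HPw; apply: crL.
have ww a b : inH a -> inH b -> nine_dim_mem (cr (act a w) (act b w)).
  move=> ha hb; rewrite (cr_WW cr pL) btx //; apply: HPD; last exact: qL.
  have [_ E] := sharp_sharp_W cs sL hv.
  have -> : B w = Nm v *: v - act (Q v) w by apply: (lin_comb 1 E); mring.
  rewrite (actDr cs) (actNr cs) (actZr cs) (actL_mul (crL _ _ ha hb) hQ hw).
  by apply: HPD; [apply: HPZ; apply: HPv; apply: crL | apply: HPN; apply: HPw; apply: jmL => //; apply: crL].
have btvw a : inH a -> exists2 d, inH d & bt (act a v) w = act d v.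
  move=> ha; exists (tr a (Q v) *: one - jm (Q v) a).
    apply: (inHD sL); first by apply: (inHZ sL); apply: (sub_one sL).
    by apply: (inHN sL); apply: jmL.
  rewrite (bt_act_B cs sL) // actL_mul // (actDl cs) (actNl cs) (actZl cs).
  by rewrite (act1 cs sL hv).
(* [bt_act1] moves [b] from the second argument to the first, where [btvw] already evaluates the
   product. *)
have vw a b : inH a -> inH b -> nine_dim_mem (cr (act a v) (act b w)).
  move=> ha hb; rewrite (cr_WW cr pL); apply: HPD; last exact: qL.
  have hav := inW_act sL ha hv; have hba := jmL _ _ hb ha.
  have E := bt_act1 cs sL hb hav hw.
  have [d hd Ed] := btvw _ ha; have [d' hd' Ed'] := btvw _ hba.
  rewrite actL_mul // Ed Ed' in E.
  have -> : bt (act a v) (act b w) =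
     T b *: act d v - act (jm b d) v - act d' v.
    by rewrite -actL_mul //; apply: (lin_comb 1 E); mring.
  apply: HPD; last by apply: HPN; apply: HPv.
  by apply: HPD; [apply: HPZ | apply: HPN]; apply: HPv => //; apply: jmL.
have wv a b : inH a -> inH b -> nine_dim_mem (cr (act a w) (act b v)).
  by move=> ha hb; rewrite (cr_comm cs); apply: vw.
have vl a b : inH a -> inH b -> nine_dim_mem (cr (act b v) a).
  by move=> ha hb; rewrite (cr_comm cs); apply: lv.
have wl a b : inH a -> inH b -> nine_dim_mem (cr (act b w) a).
  by move=> ha hb; rewrite (cr_comm cs); apply: lw.
move=> [l [m [k [hl hm hk ->]]]] [l' [m' [k' [hl' hm' hk' ->]]]].
rewrite !(cr_addl cs) !(crDr cs).
by do ![apply: (HPD)]; auto.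
Qed.

Lemma nine_dim_subalgebra : exists H : {vspace A},
  [/\ \dim H = 9%N, (L <= H)%VS, v \in H,
      forall x y, x \in H -> y \in H -> cr x y \in H &
  forall G : A -> Prop,
  (forall x y, G x -> G y -> G (x + y)) -> (forall k x, G x -> G (k *: x)) ->
  G one -> G t -> G (jm t t) -> G v -> G (jm v v) ->
  G (jm t v) -> G (jm (jm t t) v) -> G (jm t (jm v v)) ->
  G (jm (jm t t) (jm v v)) -> forall z, z \in H -> G z].
Proof.
pose LLL : vectType K := ((subvs_of L * subvs_of L) * subvs_of L)%type.
pose f (p : LLL) := vsval p.1.1 + act (vsval p.1.2) v + act (vsval p.2) w.
have vL (a : subvs_of L) : inH (vsval a) by apply/memL; apply: subvsP.
have f_lin k x y : f (k *: x + y) = k *: f x + f y.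
  by rewrite /f /= !(actDl cs, actZl cs); mring.
have f_inj x : f x = 0 -> x = 0.
  case: x => -[a b] c; rewrite /f /= -addrA => E.
  have [Ea Ebc] := HW_eq0 sL (vL a) (inWD sL (inW_act sL (vL b) hv) (inW_act sL (vL c) hw)) E.
  have [Eb Ec] := nine_dim_free (vL b) (vL c) Ebc.
  have inj0 (z : subvs_of L) : vsval z = 0 -> z = 0 by move=> h; apply: subvs_inj; rewrite h [RHS]linear0.
  by rewrite (inj0 _ Ea) (inj0 _ Eb) (inj0 _ Ec).
have [H dH mH] := image_of_linear f_lin f_inj.
have mP h : h \in H <-> nine_dim_mem h.
  rewrite mH; split=> [[[[a b] c] ->]|[l [m [k [hl hm hk ->]]]]].
    by exists (vsval a), (vsval b), (vsval c).
  have [/memL hl' /memL hm' /memL hk'] := And3 hl hm hk.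
  exists ((Subvs hl', Subvs hm'), Subvs hk').
  by rewrite /f /= .
exists H; split.
- by rewrite dH; change (\dim L + \dim L + \dim L = 9)%N; rewrite dimL.
- by apply/subvP => x /memL hx; apply/mP; apply: HPl.
- by apply/mP; rewrite -(act1 cs sL hv); apply: HPv; apply: (sub_one sL).
- by move=> x y /mP hx /mP hy; apply/mP; apply: nine_dim_closed.
move=> G GD GZ G1 Gt Gtt Gv Gvv Gtv Gttv Gtvv Gttvv z /mP [l [m [k [hl hm hk ->]]]].
have GN x : G x -> G (- x) by rewrite -scaleN1r; apply: GZ.
have GL x : inH x -> G x.
  by move=> /memL /Lspan [a [b [c ->]]]; apply: (GD); [apply: (GD)|]; apply: (GZ).
have jL x y : inH x -> G y -> G (jm t y) -> G (jm (jm t t) y) -> G (jm x y).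
  move=> /memL /Lspan [a [b [c ->]]] Gy Gty Gtty.
  rewrite !(jmDl cs) !(jmZl cs) (jm1l cs).
  by apply: (GD); [apply: (GD)|]; apply: (GZ).
apply: (GD); first apply: (GD); first exact: GL.
  (* With this trace term zero, m.v is a combination of v and the Jordan product of m and v, so it
     is spanned by the listed words. *)
  have Sm : Sq tr one m v = 0.
    by rewrite /Sq (T_W cs sL hv) mulr0 (sub_tr_orth sL hm hv) subr0.
  have -> : act m v = T m *: v + (-2) *: jm m v.
    rewrite actE; have E := jmE cs m v.
    rewrite Sm (T_W cs sL hv) in E; apply: (lin_comb 1 E); mring.
  by apply: (GD); apply: (GZ) => //; apply: jL.
have Sk : Sq tr one k w = 0.
  by rewrite /Sq (T_W cs sL hw) mulr0 (sub_tr_orth sL hk hw) subr0.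
have hQ := inH_Q i6 sL v.
(* Modulo L, [w] is the Jordan square of v; so its products with L are words in t and v^2. *)
have Ew : w = jm v v + ((half i6 * Sq tr one v v) *: one + Q v).
  have E := sharp_W cr i6 pL v; rewrite (jm_xx cs) E (T_W cs sL hv); mring.
have Gw : G w.
  rewrite Ew; apply: (GD) => //; apply: (GD); first exact: GZ.
  exact: GL.
have -> : act k w = T k *: w + (-2) *: jm k w.
  rewrite actE; have E := jmE cs k w.
  rewrite Sk (T_W cs sL hw) in E; apply: (lin_comb 1 E); mring.
apply: (GD); apply: (GZ) => //; rewrite Ew (jmDr cs); apply: (GD); first exact: jL.
apply: GL; apply: (inH_jm i6 sL) => //; apply: (inHD sL) => //.
by apply: (inHZ sL); apply: (sub_one sL).
Qed.
End NineDimensional.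

(** * Finding an isotropic element and filling the algebra *)

Section KummerElement.
Variables (H : {vspace A}) (pH : A -> A).
Hypothesis sH : cubic_sub cr tr one pH.
Hypothesis memH : forall x, x \in H <-> pH x = x.
Local Notation act := (act cr).
Local Notation Q := (Q cr i6 pH).
Local Notation B := (B cr i6 pH).

Lemma isotropic_of_root x e : pH x = 0 -> x <> 0 ->
  e ^+ 2 - Nm x * e + Nm (Q x) = 0 ->
  exists x1, [/\ pH x1 = 0, x1 <> 0 & Q x1 = 0].
Proof.
move=> hx x0 he; have hQ := inH_Q i6 sH x; have hB := inW_B i6 sH x.
have hu := inW_act sH hQ hB; set u := act (Q x) (B x) in hu.
have Qr k : k ^+ 2 - Nm x * k + Nm (Q x) = 0 ->
    pH (u - k *: x) = 0 /\ Q (u - k *: x) = 0.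
  move=> hk; split; last exact: (Q_root cs sH hx hk).
  by apply: (inWD sH) => //; apply: (inWN sH); apply: (inWZ sH).
case: (u - e *: x =P 0) => [E|nz]; last first.
  by have [] := Qr e he; exists (u - e *: x).
(* If the element built from e vanishes, the other root N(x) - e is tried. *)
have he' : (Nm x - e) ^+ 2 - Nm x * (Nm x - e) + Nm (Q x) = 0.
  by rewrite -[RHS]he; ring.
case: (u - (Nm x - e) *: x =P 0) => [E'|nz]; last first.
  by have [] := Qr _ he'; exists (u - (Nm x - e) *: x).
have E2 : (Nm x - e - e) *: x = 0.
  by apply: (lin_comb 1 E); apply: (lin_comb (-1) E'); mring.
move: E2 => /eqP; rewrite scaler_eq0 => /orP [/eqP E2|/eqP //].
have NQ : Nm (Q x) = e ^+ 2.
  by apply: (lin_comb_scal 1 he); apply: (lin_comb_scal e E2); ring.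
case: (Q x =P 0) => [Q0|Q0]; first by exists x.
have N0 : Nm (Q x) != 0 by apply/eqP => /aniso.
(* Both fail only for a double root with q(x).b(x) = e x. Then e^2 = N(q(x)), and with lam = e
   q(x)^-1 the element lam + x has zero adjoint, a contradiction. *)
case: x0; apply: (aniso_sub sH (lam := (e / Nm (Q x)) *: sharp (Q x))) => //.
- by apply: (inHZ sH); apply: (inH_sharp i6 sH).
- have F := act_sharp_act cs sH hQ hB; rewrite -/u in F.
  have -> : B x = (Nm (Q x))^-1 *: (Nm (Q x) *: B x) by rewrite scalerA mulVf // scale1r.
  rewrite -F; have -> : u = e *: x by apply: (lin_comb 1 E); mring.
  by rewrite (actZl cs) (actZr cs) scalerA mulrC.
rewrite (sharpZ cs) (sharp_sharp cs) scalerA.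
have -> : (e / Nm (Q x)) ^+ 2 * Nm (Q x) = (e ^+ 2 / Nm (Q x)) * (Nm (Q x) / Nm (Q x)).
  by rewrite expr2; ring.
by rewrite -NQ divff // mulr1 scale1r.
Qed.

Hypotheses (dimA : \dim {:A} = 27%N) (dimH : \dim H = 9%N).
(** H + H.x1 + H.x2 is the image of an injective map from a space of dimension 9 + 9 + 9 = 27. *)
Lemma kummer_surjective x1 nV : pH x1 = 0 -> Q x1 = 0 -> nV * Nm x1 = 1 ->
  forall w, pH w = 0 ->
  exists a b, [/\ pH a = a, pH b = b & w = act a x1 + act b (B x1)].
Proof.
move=> hx1 Qx1 hn w hw; pose HH := subvs_of H.
pose f (p : (HH * HH * HH)%type) :=
  vsval p.1.1 + (act (vsval p.1.2) x1 + act (vsval p.2) (B x1)).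
have vH (a : HH) : pH (vsval a) = vsval a by apply/memH; apply: subvsP.
have f_lin k x y : f (k *: x + y) = k *: f x + f y.
  by rewrite /f /= !(actDl cs, actZl cs); mring.
have hB := inW_B i6 sH x1.
have hW a b : pH (act (vsval (a : HH)) x1 + act (vsval (b : HH)) (B x1)) = 0.
  by apply: (inWD sH); apply: (inW_act sH).
have f_inj x : f x = 0 -> x = 0.
  case: x => -[a b] c; rewrite /f /= => E.
  have [Ea Ebc] := HW_eq0 sH (vH a) (hW b c) E.
  have p0 := sub0 sH.
  have [] := kummer_act_inj cs sH hx1 Qx1 hn (vH b) (vH c) p0 p0.
    by rewrite Ebc !(act0l cs) addr0.
  have inj0 (z : HH) : vsval z = 0 -> z = 0 by move=> h; apply: subvs_inj; rewrite h [RHS]linear0.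
  by move=> Eb Ec; rewrite (inj0 _ Ea) (inj0 _ Eb) (inj0 _ Ec).
have [|[[a b] c] E] := surjective_of_dim f_lin f_inj _ w.
  rewrite -[RHS](dimvf A) dimA; change (\dim H + \dim H + \dim H = 27)%N.
  by rewrite dimH.
exists (vsval b), (vsval c); split=> //.
rewrite E /f /= in hw *; rewrite (subD sH) hW vH addr0 in hw.
by rewrite hw add0r.
Qed.
End KummerElement.
End Division.

(** * Scalar extension to K[X]/(X^2 - d) *)

Definition quad (K : comNzRingType) (d : K) : Type := (K * K)%type.
Definition ext (K : comNzRingType) (d : K) (A : lmodType K) : Type := (A * A)%type.

Section QuadRing.
Variables (K : comNzRingType) (d : K).
Local Notation E := (quad d).
HB.instance Definition _ := GRing.Zmodule.copy E (K * K)%type.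
Definition quad_mul (x y : E) : E := (x.1 * y.1 + d * (x.2 * y.2), x.1 * y.2 + x.2 * y.1).
Definition quad_one : E := (1, 0).
Fact quad_mulA : associative quad_mul.
Proof. by move=> [a b] [x y] [z t]; rewrite /quad_mul /=; congr pair; ring. Qed.
Fact quad_mulC : commutative quad_mul.
Proof. by move=> [a b] [x y]; rewrite /quad_mul /=; congr pair; ring. Qed.
Fact quad_mul1 : left_id quad_one quad_mul.
Proof. by move=> [a b]; rewrite /quad_mul /=; congr pair; ring. Qed.
Fact quad_mulDl : left_distributive quad_mul +%R.
Proof. by move=> [a b] [x y] [z t]; rewrite /quad_mul; congr pair; rewrite /=; ring. Qed.
Fact quad_one0 : quad_one != 0.
Proof. by apply/eqP => -[] /eqP; rewrite oner_eq0. Qed.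
HB.instance Definition _ := GRing.Zmodule_isComNzRing.Build E
  quad_mulA quad_mulC quad_mul1 quad_mulDl quad_one0.

Variable A : lmodType K.
Local Notation J := (ext d A).
HB.instance Definition _ := GRing.Zmodule.copy J (A * A)%type.
Definition ext_scale (k : E) (x : J) : J :=
  (k.1 *: x.1 + d *: (k.2 *: x.2), k.1 *: x.2 + k.2 *: x.1).
Fact ext_scaleA a b v : ext_scale a (ext_scale b v) = ext_scale (a * b) v.
Proof.
case: a b v => [a1 a2] [b1 b2] [v1 v2]; rewrite /ext_scale /=.
by congr pair; mring.
Qed.
Fact ext_scale1 : left_id 1 ext_scale.
Proof. by move=> [v1 v2]; rewrite /ext_scale /=; congr pair; mring. Qed.
Fact ext_scaleDr : right_distributive ext_scale +%R.
Proof.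
move=> [a b] [x y] [z t]; rewrite /ext_scale; congr pair; rewrite /=; mring.
Qed.
Fact ext_scaleDl v : {morph ext_scale^~ v : a b / a + b}.
Proof.
move=> [a b] [x y]; case: v => [z t]; rewrite /ext_scale; congr pair; rewrite /=; mring.
Qed.
HB.instance Definition _ := GRing.Zmodule_isLmodule.Build E J
  ext_scaleA ext_scale1 ext_scaleDr ext_scaleDl.
End QuadRing.


Section Extension.
Variables (K : comNzRingType) (d : K) (A : lmodType K).
Variables (cr : A -> A -> A) (tr : A -> A -> K) (one : A) (i6 : K).
Hypothesis cs : cubic_structure cr tr one i6.
Local Notation E := (quad d).
Local Notation J := (ext d A).

Definition quad_in (k : K) : E := (k, 0).
Definition ext_in (x : A) : J := (x, 0).
Definition ext_cr (x y : J) : J :=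
  (cr x.1 y.1 + d *: cr x.2 y.2, cr x.1 y.2 + cr x.2 y.1).
Definition ext_tr (x y : J) : E :=
  (tr x.1 y.1 + d * tr x.2 y.2, tr x.1 y.2 + tr x.2 y.1).

Lemma ext_cubic_structure :
  cubic_structure ext_cr ext_tr (ext_in one) (quad_in i6).
Proof.
have crC := cr_comm cs; have trC := tr_comm cs.
split.
- by move=> [x x'] [y y']; rewrite /ext_cr /=; congr pair; rewrite (crC x) (crC x') // addrC.
- by move=> [x x'] [y y'] [z z']; congr pair; rewrite /= !(crE cs); mring.
- by move=> [a a'] [y y'] [z z']; congr pair; rewrite /= !(crE cs); mring.
- by move=> [x x'] [y y']; rewrite /ext_tr /=; congr pair; rewrite (trC x) (trC x') // addrC.
- by move=> [x x'] [y y'] [z z']; congr pair; rewrite /= !(trE cs); ring.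
- by move=> [a a'] [y y'] [z z']; congr pair; rewrite /= !(trE cs); ring.
- by move=> [x x'] [y y'] [z z']; congr pair; rewrite /= !(trE cs) !(tr_crA cs); ring.
- move=> [x x']; congr pair; rewrite /= !(crE cs) !(trE cs) !(cr1l cs) -!/(tr1 tr one _); mring.
- by congr pair; rewrite /= !(trE cs) ?(T1 cs) -?/(tr1 tr one _) ?(T1 cs); ring.
- move=> [x x'] [y y'] [z z'] [w w'].
  (* Expanding each argument as x + x' sqrt(d) gives sixteen instances over the base: those with an
     even number of primed entries form the first component, those with an odd number the second,
     with d to half that number rounded down. *)
  have F := cr_adjoint cs; congr pair; rewrite /= !(crE cs) !(trE cs).
    apply: (lin_comb 1 (F x y z w)).
    apply: (lin_comb d (F x y z' w')); apply: (lin_comb d (F x y' z w')).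
    apply: (lin_comb d (F x y' z' w)); apply: (lin_comb d (F x' y z w')).
    apply: (lin_comb d (F x' y z' w)); apply: (lin_comb d (F x' y' z w)).
    apply: (lin_comb (d ^+ 2) (F x' y' z' w')); mring.
  apply: (lin_comb 1 (F x y z w')); apply: (lin_comb 1 (F x y z' w)).
  apply: (lin_comb 1 (F x y' z w)); apply: (lin_comb 1 (F x' y z w)).
  apply: (lin_comb d (F x y' z' w')); apply: (lin_comb d (F x' y z' w')).
  apply: (lin_comb d (F x' y' z w')); apply: (lin_comb d (F x' y' z' w)); mring.
have -> : (6 : E) = 1 + 1 + 1 + 1 + 1 + 1 by ring.
by congr pair; rewrite /=; [ring: (mul_i6 cs) | ring].
Qed.
Lemma quad_in_half : half (quad_in i6) = quad_in (half i6).
Proof.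
rewrite /half; have -> : (3 : E) = 1 + 1 + 1 by ring.
by congr pair; rewrite /=; ring.
Qed.

Variable pH : A -> A.
Hypothesis sH : cubic_sub cr tr one pH.
Definition ext_pH (x : J) : J := (pH x.1, pH x.2).
Lemma ext_pH_id x : ext_pH x = x <-> pH x.1 = x.1 /\ pH x.2 = x.2.
Proof. by case: x => a b; rewrite /ext_pH /=; split=> [[-> ->]|[-> ->]]. Qed.
Lemma ext_pH_eq0 x : ext_pH x = 0 <-> pH x.1 = 0 /\ pH x.2 = 0.
Proof. by case: x => a b; rewrite /ext_pH /=; split=> [[-> ->]|[-> ->]]. Qed.
Lemma ext_cubic_sub : cubic_sub ext_cr ext_tr (ext_in one) ext_pH.
Proof.
split.
- by move=> [x x'] [y y']; congr pair; rewrite /= (subD sH).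
- by move=> [a a'] [y y']; congr pair; rewrite /= !(subE sH).
- by move=> [x x']; congr pair; rewrite /= (subK sH).
- by congr pair; rewrite /= ?(sub_one sH) ?(sub0 sH).
- move=> [x x'] [y y'] /ext_pH_id [/= h1 h2] /ext_pH_id [/= h3 h4].
  by congr pair; rewrite /= !(subE sH) !(sub_cr sH).
- move=> [x x'] [y y'] /ext_pH_id [/= h1 h2] /ext_pH_eq0 [/= h3 h4].
  by congr pair; rewrite /= !(subE sH) !(sub_cr_orth sH) // ?scaler0 addr0.
move=> [x x'] [y y'] /ext_pH_id [/= h1 h2] /ext_pH_eq0 [/= h3 h4].
by congr pair; rewrite /= !(sub_tr_orth sH) // ?mulr0 addr0.
Qed.

Definition quad_conj (k : E) : E := (k.1, - k.2).
Definition ext_conj (x : J) : J := (x.1, - x.2).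
Lemma ext_conjD x y : ext_conj (x + y) = ext_conj x + ext_conj y.
Proof. by congr pair; rewrite /= opprD. Qed.
Lemma ext_conjZ k x : ext_conj (k *: x) = quad_conj k *: ext_conj x.
Proof. by congr pair; rewrite /=; mring. Qed.
Lemma ext_conjK x : ext_conj (ext_conj x) = x.
Proof. by case: x => a b; rewrite /ext_conj /= opprK. Qed.
Lemma quad_conjK k : quad_conj (quad_conj k) = k.
Proof. by case: k => a b; rewrite /quad_conj /= opprK. Qed.
Lemma quad_conjM k l : quad_conj (k * l) = quad_conj k * quad_conj l.
Proof. by congr pair; rewrite /=; ring. Qed.
Lemma ext_conj_cr x y : ext_conj (ext_cr x y) = ext_cr (ext_conj x) (ext_conj y).
Proof. by congr pair; rewrite /= !(crE cs); mring. Qed.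
Lemma ext_conj_tr x y : quad_conj (ext_tr x y) = ext_tr (ext_conj x) (ext_conj y).
Proof. by congr pair; rewrite /= !(trE cs); ring. Qed.
Lemma ext_conj_pH x : ext_conj (ext_pH x) = ext_pH (ext_conj x).
Proof. by congr pair; rewrite /= (subN sH). Qed.
Lemma ext_conj_one : ext_conj (ext_in one) = ext_in one.
Proof. by congr pair; rewrite /= oppr0. Qed.
Lemma ext_conj_Nm x : Nm ext_cr ext_tr (quad_in i6) (ext_conj x) =
  quad_conj (Nm ext_cr ext_tr (quad_in i6) x).
Proof.
rewrite !NmE quad_conjM ext_conj_tr ext_conj_cr; congr (_ * _).
by congr pair; rewrite /= oppr0.
Qed.
Lemma ext_fixed x : ext_conj x = x -> x = ext_in x.1.
Proof.
case: x => a b [] /= E; congr pair; apply: (cancel2 cs); rewrite scaler0.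
by apply: (lin_comb (-1) E); mring.
Qed.
Lemma ext_conj_in x : ext_conj (ext_in x) = ext_in x.
Proof. by congr pair; rewrite /= oppr0. Qed.

Lemma ext_in_cr x y : ext_cr (ext_in x) (ext_in y) = ext_in (cr x y).
Proof. by congr pair; rewrite /= !(crE cs); mring. Qed.
Lemma ext_in_tr x y : ext_tr (ext_in x) (ext_in y) = quad_in (tr x y).
Proof. by congr pair; rewrite /= !(trE cs); ring. Qed.
Lemma quad_inM k l : quad_in (k * l) = quad_in k * quad_in l.
Proof. by congr pair; rewrite /=; ring. Qed.
Lemma ext_inZ k x : ext_in (k *: x) = quad_in k *: ext_in x.
Proof. by congr pair; rewrite /=; mring. Qed.
Lemma ext_inD x y : ext_in (x + y) = ext_in x + ext_in y.
Proof. by congr pair; rewrite /= addr0. Qed.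
Lemma ext_in_Nm x : Nm ext_cr ext_tr (quad_in i6) (ext_in x) = quad_in (Nm cr tr i6 x).
Proof. by rewrite !NmE ext_in_cr ext_in_tr quad_inM. Qed.
Lemma ext_in_sharp x : sharp ext_cr (quad_in i6) (ext_in x) = ext_in (sharp cr i6 x).
Proof. by rewrite !sharpE ext_in_cr quad_in_half ext_inZ. Qed.
Lemma ext_in_pH x : ext_pH (ext_in x) = ext_in (pH x).
Proof. by congr pair; rewrite /= (sub0 sH). Qed.
Lemma ext_in_act a x : act ext_cr (ext_in a) (ext_in x) = ext_in (act cr a x).
Proof. by rewrite !actE ext_in_cr; congr pair; rewrite /= oppr0. Qed.
Lemma ext_in_T x : tr1 ext_tr (ext_in one) (ext_in x) = quad_in (tr1 tr one x).
Proof. exact: ext_in_tr. Qed.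
Lemma ext_in_jm x y : jm ext_cr ext_tr (ext_in one) (quad_in i6) (ext_in x) (ext_in y) =
  ext_in (jm cr tr one i6 x y).
Proof.
rewrite !jm_def /Sq !ext_in_T ext_in_tr ext_in_cr quad_in_half.
by congr pair; rewrite /=; mring.
Qed.
Lemma ext_in_Q x : Q ext_cr (quad_in i6) ext_pH (ext_in x) = ext_in (Q cr i6 pH x).
Proof.
rewrite !QE !qfE ext_in_cr ext_in_pH quad_in_half.
by congr pair; rewrite /=; mring.
Qed.
Lemma ext_in_B x : B ext_cr (quad_in i6) ext_pH (ext_in x) = ext_in (B cr i6 pH x).
Proof.
rewrite !BE !btE !qfE ext_in_cr ext_in_pH quad_in_half.
by congr pair; rewrite /=; mring.
Qed.
End Extension.

Local Notation gNm := Nm.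
Local Notation gjm := jm.
Local Notation gtr1 := tr1.

(** * The similarity carrying K[t] to K[t'] *)

Section Similarity.
Variables (K : fieldType) (A : vectType K).
Variables (cr : A -> A -> A) (tr : A -> A -> K) (one : A) (i6 : K).
Hypothesis cs : cubic_structure cr tr one i6.
Local Notation T := (tr1 tr one).
Local Notation Nm := (Nm cr tr i6).
Local Notation jm := (jm cr tr one i6).
Local Notation sharp := (sharp cr i6).
Hypothesis aniso : forall x, Nm x = 0 -> x = 0.
Variables (H : {vspace A}) (pH : A -> A).
Hypothesis sH : cubic_sub cr tr one pH.
Hypothesis memH : forall x, x \in H <-> pH x = x.
Hypotheses (dimA : \dim {:A} = 27%N) (dimH : \dim H = 9%N).
Variables t v : A.
Hypotheses (ht : pH t = t) (hv : pH v = v).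
Hypothesis gen : forall G : A -> Prop,
  (forall x y, G x -> G y -> G (x + y)) -> (forall k x, G x -> G (k *: x)) ->
  G one -> G t -> G (jm t t) -> G v -> G (jm v v) ->
  G (jm t v) -> G (jm (jm t t) v) -> G (jm t (jm v v)) ->
  G (jm (jm t t) (jm v v)) -> forall z, pH z = z -> G z.
Definition orth3 p x := [/\ pH x = x, T x = 0, tr p x = 0 & tr (jm p p) x = 0].
Definition free3 p := forall a b c,
  a *: one + b *: p + c *: jm p p = 0 -> [/\ a = 0, b = 0 & c = 0].
Definition in3 p z := exists a b c, z = a *: one + b *: p + c *: jm p p.
Variables (t' : A) (al be ga : K).
Hypothesis ht' : pH t' = t'.
Hypothesis root_t : jm t (jm t t) + al *: jm t t + be *: t + ga *: one = 0.
Hypothesis root_t' : jm t' (jm t' t') + al *: jm t' t' + be *: t' + ga *: one = 0.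
Hypotheses (free_t : free3 t) (free_t' : free3 t').
Hypothesis orth_t : exists2 k, orth3 t k & k <> 0.
Hypothesis orth_t' : exists2 k, orth3 t' k & k <> 0.
Hypothesis dec_t' : forall z, pH z = z -> exists l x, [/\ in3 t' l, orth3 t' x & z = l + x].

(** Inclusions suffice here; equality of images follows at the end from injectivity and
    dimensions. *)
Definition carries (s : A -> A) (nu : K) :=
  [/\ forall k x y, s (k *: x + y) = k *: s x + s y,
      nu != 0, forall j, Nm (s j) = nu * Nm j,
      forall j, pH j = j -> pH (s j) = s j &
      forall l, in3 t l -> in3 t' (s l)].

Lemma three_neq0 : (3 : K) != 0.
Proof.
apply/eqP => E; have := mul_i6 cs; rewrite (_ : (6 : K) = 2 * 3); last by ring.
by rewrite E !mulr0 => /esym/eqP; rewrite oner_eq0.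
Qed.
(** The element is f'(p) for the generic polynomial f; its leading coefficient 3 is invertible and
    1, p, p^2 are independent. *)
Lemma free3_sep p : free3 p ->
  3 *: jm p p - (2 * T p) *: p + (half i6 * Sq tr one p p) *: one <> 0.
Proof.
move=> fp E; have [] := fp (half i6 * Sq tr one p p) (- (2 * T p)) 3.
  by rewrite -E; mring.
by move=> _ _ /eqP; rewrite (negPf three_neq0).
Qed.
Lemma carries_split x1 nV : pH x1 = 0 -> Q cr i6 pH x1 = 0 -> nV * Nm x1 = 1 ->
  exists s nu, carries s nu.
Proof.
move=> hx1 Qx1 hn.
have hdec := kummer_surjective cs sH memH dimA dimH hx1 Qx1 hn.
have hinv a : pH a = a -> a <> 0 -> exists k, k * Nm a = 1.
  move=> _ a0; exists (Nm a)^-1; rewrite mulVf //; apply/eqP => /aniso //.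
pose km := km cr i6 pH x1 nV.
have root p : pH p = p -> jm p (jm p p) + al *: jm p p + be *: p + ga *: one = 0 ->
    km p (km p p) + al *: km p p + be *: p + ga *: one = 0.
  move=> hp E; rewrite /km !(km_sq cs sH hx1 Qx1 hn hdec) //.
  by rewrite (km_pow cs sH hx1 Qx1 hn hdec).
have [k [hk Tk tk ttk] k0] := orth_t; have [k' [hk' Tk' tk' ttk'] k'0] := orth_t'.
have nc := km_noncomm cs sH hx1 Qx1 hn hdec ht hv gen hinv ht hk k0 (free3_sep free_t) Tk tk ttk.
have nc' := km_noncomm cs sH hx1 Qx1 hn hdec ht hv gen hinv ht' hk' k'0 (free3_sep free_t') Tk' tk' ttk'.
have [g [hg g0] Eg] := skolem_noether cs sH hx1 Qx1 hn hdec ht hv gen hinv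
  ht ht' hk hk' (root _ ht root_t) (root _ ht' root_t') nc nc'.
have [gi [hgi ggi gig]] := km_inverse cs sH hx1 Qx1 hn hdec hinv hg g0.
have Nkm := Nm_km cs sH hx1 Qx1 hn hdec.
have NN : Nm g * Nm gi = 1 by rewrite -Nkm // ggi (Nm_one cs).
(* With g' = y = g^-1 all three coordinates are conjugated by g, and the multiplier is 1. *)
pose s := smap cr i6 pH x1 nV g gi g gi gi g (Nm g * Nm gi).
exists s, (Nm g * Nm gi); split.
- by move=> a x y; rewrite /s (smap_linear cs sH).
- by rewrite NN oner_eq0.
- move=> j; apply: (Nm_smap cs sH hx1 Qx1 hn hdec ht hv gen) => //.
  by rewrite expr2 mulrA NN mul1r.
- by move=> j hj; rewrite /s (smap_H cs sH hx1 Qx1 hn) //; apply: (inH_km i6 sH).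
move=> l [a [b [c ->]]]; exists a, b, c.
rewrite /s (smap_cubic cs sH hx1 Qx1 hn hdec ht hv gen _ _ _ _ _ _ _ _ _ ht ht' hg Eg) ggi.
have h1 := sub_one sH.
by rewrite !(km_one_r cs sH hx1 Qx1 hn hdec) // (km_sq cs sH hx1 Qx1 hn hdec).
Qed.

(** * The case of a proper quadratic extension *)

Section NonSplit.
Variables (x : A) (d : K).
Hypotheses (hx : pH x = 0) (x0 : x <> 0).
Hypothesis d_def : d = (half i6 * Nm x) ^+ 2 - Nm (Q cr i6 pH x).
Hypothesis d_nonsquare : forall k, k ^+ 2 <> d.
Local Notation E := (quad d).
Local Notation J := (ext d A).
Local Notation cr' := (@ext_cr K d A cr).
Local Notation tr' := (@ext_tr K d A tr).
Local Notation one' := (@ext_in K d A one).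
Local Notation i6' := (@quad_in K d i6).
Local Notation pH' := (@ext_pH K d A pH).
Local Notation ein := (@ext_in K d A).
Local Notation qin := (@quad_in K d).
Local Notation conj := (@ext_conj K d A).
Local Notation Nm' := (gNm cr' tr' i6').
Let cs' : cubic_structure cr' tr' one' i6' := ext_cubic_structure d cs.
Let sH' : cubic_sub cr' tr' one' pH' := ext_cubic_sub d sH.
Let th : E := (0, 1).

Lemma quad_unit (k : E) : k <> 0 -> exists l : E, l * k = 1.
Proof.
case: k => a b k0; pose D := a ^+ 2 - d * b ^+ 2.
have D0 : D != 0.
  apply/eqP => ED; apply: k0.
  case: (b =P 0) => [b0|/eqP b0].
    move: ED; rewrite /D b0 expr0n /= mulr0 subr0 => /eqP.
    by rewrite expf_eq0 /= => /eqP ->.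
  case: (d_nonsquare (k := a / b)).
  rewrite expr_div_n; have -> : a ^+ 2 = d * b ^+ 2.
    by apply: (lin_comb_scal 1 ED); rewrite /D; ring.
  by rewrite mulfK // expf_neq0.
exists ((a / D, - b / D) : E); congr pair; rewrite /=.
  transitivity ((a ^+ 2 - d * b ^+ 2) / D); first by ring.
  by rewrite -/D divff.
by ring.
Qed.

Lemma ext_split (z : J) : z = ein z.1 + th *: ein z.2.
Proof. by case: z => a b; congr pair; rewrite /=; mring. Qed.
Lemma th2 : th ^+ 2 = qin d.
Proof. by rewrite expr2; congr pair; rewrite /=; ring. Qed.

(** Anisotropy survives a quadratic extension: a zero a + sqrt(d) b makes sqrt(d) a root of the
    cubic N(a + X b), which then has a third root in K. *)
Lemma ext_Nm_unit (z : J) : z <> 0 -> exists k : E, k * Nm' z = 1.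
Proof.
case: z => a b z0; apply: quad_unit => E0; apply: z0.
have sin := ext_in_sharp d cs.
have EN : Nm' (a, b) = (Nm a + d * tr (sharp b) a, tr (sharp a) b + d * Nm b).
  rewrite [(a, b)]ext_split /= (NmD cs') (NmZ cs') (sharpZ cs') !sin.
  rewrite !(trE cs') !(ext_in_tr d cs) !(ext_in_Nm d cs).
  have -> : th ^+ 3 = th * qin d by rewrite -th2; ring.
  by rewrite th2; congr pair; rewrite /=; ring.
move: E0; rewrite EN => -[E1 E2].
have Nb0 : b = 0.
  case: (b =P 0) => // /eqP b0; exfalso.
  have Nb : Nm b != 0 by apply: contra b0 => /eqP /aniso ->.
  (* The sum of the three roots of N(a + X b), hence the third one, as the other two are
     opposite. *)
  pose s := - tr (sharp b) a / Nm b.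
  have ts : tr (sharp b) a = - s * Nm b by rewrite /s !mulNr opprK mulfVK.
  have F : a + s *: b = 0.
    apply: aniso; rewrite (NmD cs) (NmZ cs) (sharpZ cs) !(trE cs) ts.
    rewrite ts in E1; apply: (lin_comb_scal 1 E1); apply: (lin_comb_scal s E2); ring.
  have Ea : a = - s *: b by apply: (lin_comb 1 F); mring.
  rewrite Ea (NmZ cs) !(trE cs) (sharpZ cs) !(trE cs) !(tr_sharp cs) in E1 E2.
  (* Now a = - s b, and the components of (sqrt(d) - s)^3 = 0 give [G1] and [G2], which together
     force d = 0. *)
  have G1 : s * (s ^+ 2 + 3 * d) = 0.
    by apply: (mulIf Nb); rewrite mul0r; apply: (lin_comb_scal (-1) E1); ring.
  have G2 : 3 * s ^+ 2 + d = 0.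
    by apply: (mulIf Nb); rewrite mul0r; apply: (lin_comb_scal 1 E2); ring.
  have G3 : d = 0.
    move: G1 => /eqP; rewrite mulf_eq0 => /orP [/eqP s0|/eqP G1].
      by move: G2; rewrite s0 expr0n /= mulr0 add0r.
    apply: (cancel2R cs); apply: (cancel2R cs); apply: (cancel2R cs).
    rewrite !mulr0; apply: (lin_comb_scal 3 G1); apply: (lin_comb_scal (-1) G2); ring.
  by apply: (d_nonsquare (k := 0)); rewrite G3 expr0n.
move: E1; rewrite Nb0 (sharp0 cs) (tr0l cs) mulr0 addr0 => /aniso ->.
by [].
Qed.

Let e : E := (half i6 * Nm x, 1).
Let u := act cr (Q cr i6 pH x) (B cr i6 pH x).
Let x1 : J := ein u - e *: ein x.

Lemma nonsplit_x1 : [/\ pH' x1 = 0, Q cr' i6' pH' x1 = 0, x1 <> 0 &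
  forall a, pH' a = a -> conj x1 <> act cr' a x1].
Proof.
have hx' : pH' (ein x) = 0 by rewrite (ext_in_pH d sH) hx.
have hu : pH u = 0 by apply: (inW_act sH); [apply: (inH_Q i6 sH) | apply: (inW_B i6 sH)].
have W1 : pH' x1 = 0.
  apply: (inWD sH'); first by rewrite (ext_in_pH d sH) hu.
  by apply: (inWN sH'); apply: (inWZ sH').
have d0 : d != 0.
  by apply/eqP => E0; apply: (d_nonsquare (k := 0)); rewrite E0 expr0n.
have Q1 : Q cr' i6' pH' x1 = 0.
  have := Q_root cs' sH' hx' (e := e).
  rewrite (ext_in_Q d cs sH) (ext_in_B d cs sH) (ext_in_act d cs) !(ext_in_Nm d cs).
  apply; have h2 := halfE cs.
  congr pair; rewrite /= ?expr2 /=.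
    transitivity ((2 * half i6 - 1) * (half i6 * Nm x * Nm x)).
      by rewrite d_def; ring.
    by rewrite h2 subrr mul0r.
  transitivity ((2 * half i6 - 1) * Nm x); first by ring.
  by rewrite h2 subrr mul0r.
split=> //.
  move=> E1; apply: x0; have := congr1 snd E1 => /= E2.
  by apply: (lin_comb (-1) E2); mring.
(* If the conjugate of x1 were a.x1, then (a - 1).x1 would be 2 sqrt(d) x. So q(x) = 0, and d =
   (N(x)/2)^2 would be a square. *)
move=> a ha Ea.
have h1 := sub_one sH'; have ha1 := inHD sH' ha (inHN sH' h1).
have F : act cr' (a - one') x1 = (2 * th) *: ein x.
  rewrite (actDl cs') (actNl cs') (act1 cs' sH' W1) -Ea /x1.
  congr pair; rewrite /=; mring.
have QF : Q cr' i6' pH' (act cr' (a - one') x1) = 0.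
  rewrite QE (qf_act_isotropic cs' sH' ha1 ha1 W1) ?scaler0 //.
  by rewrite (qf_xx cs') Q1 scaler0.
have Q0 : Q cr i6 pH x = 0.
  have QZ k y : Q cr' i6' pH' (k *: y) = k ^+ 2 *: Q cr' i6' pH' y.
    by rewrite !QE (qfZl cs' sH') (qfZr cs' sH'); mring.
  move: QF; rewrite F QZ (ext_in_Q d cs sH).
  have -> : (2 * th) ^+ 2 = qin (4 * d).
    have -> : (2 * th) ^+ 2 = 4 * th ^+ 2 by ring.
    rewrite th2; have -> : (4 : E) = 1 + 1 + 1 + 1 by ring.
    by congr pair; rewrite /=; ring.
  rewrite -(ext_inZ d) => /(congr1 fst) /= /eqP; rewrite scaler_eq0 mulf_eq0.
  rewrite (negPf d0) orbF => /orP [/eqP E4|/eqP //]; exfalso.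
  have := three_neq0; have := mul_i6 cs.
  have : (2 : K) * 2 = 0 by rewrite -[RHS]E4; ring.
  move=> /eqP; rewrite mulf_eq0 orbb => /eqP E2.
  rewrite (_ : (6 : K) = 2 * 3); last by ring.
  by rewrite E2 mul0r mulr0 => /esym/eqP; rewrite oner_eq0.
apply: (d_nonsquare (k := half i6 * Nm x)).
have N0 : Nm 0 = 0 by rewrite NmE (tr0r cs) mulr0.
by rewrite d_def Q0 N0 subr0.
Qed.

Lemma carries_nonsplit : exists s nu, carries s nu.
Proof.
have [hx1 Qx1 x10 cx1] := nonsplit_x1.
have [nV hn] := ext_Nm_unit x10.
have h2K : (2 : K) != 0.
  apply/eqP => E2; have := mul_i6 cs; rewrite (_ : (6 : K) = 2 * 3); last by ring.
  by rewrite E2 mul0r mulr0 => /esym/eqP; rewrite oner_eq0.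
have hdec : forall w, pH' w = 0 -> exists a b,
    [/\ pH' a = a, pH' b = b & w = act cr' a x1 + act cr' b (B cr' i6' pH' x1)].
  (* The dimension count is redone over K, with each module over the extension taken as pairs: 6 * 9
     = 2 * 27. *)
  move=> w hw; pose HH := subvs_of H.
  pose f (p : ((HH * HH) * (HH * HH) * (HH * HH))%type) : (A * A)%type :=
    ((vsval p.1.1.1, vsval p.1.1.2) : J) + (act cr' (vsval p.1.2.1, vsval p.1.2.2) x1
     + act cr' (vsval p.2.1, vsval p.2.2) (B cr' i6' pH' x1)).
  have vH (a : HH) : pH (vsval a) = vsval a by apply/memH; apply: subvsP.
  have vH2 (a b : HH) : pH' (vsval a, vsval b) = (vsval a, vsval b).
    by rewrite /ext_pH /= !vH.
  have f_lin (k : K) y z : f (k *: y + z) = k *: f y + f z.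
    have qZ (w' : J) : (k *: (w' : (A * A)%type) : J) = qin k *: w'.
      by congr pair; rewrite /=; mring.
    have pE (p q r s : A) : ((k *: p + r, k *: q + s) : J) = qin k *: ((p, q) : J) + (r, s).
      by congr pair; rewrite /=; mring.
    have E1 : (f (k *: y + z) : J) = qin k *: (f y : J) + (f z : J).
      rewrite /f /= !pE !(actDl cs', actZl cs').
      by rewrite /GRing.add /=; congr pair; rewrite /=; mring.
    exact: (etrans E1 (congr1 (fun w' : J => w' + (f z : J)) (esym (qZ (f y))))).
  have hB := inW_B i6' sH' x1.
  have hW a b : pH' a = a -> pH' b = b ->
      pH' (act cr' a x1 + act cr' b (B cr' i6' pH' x1)) = 0.
    by move=> ha hb; apply: (inWD sH'); apply: (inW_act sH').
  have f_inj y : f y = 0 -> y = 0.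
    case: y => -[[a a'] [b b']] [c c']; rewrite /f /= => E1.
    have [Ea Ebc] := HW_eq0 sH' (vH2 a a') (hW _ _ (vH2 b b') (vH2 c c')) E1.
    have p0 := sub0 sH'.
    have [] := kummer_act_inj cs' sH' hx1 Qx1 hn (vH2 b b') (vH2 c c') p0 p0.
      by rewrite Ebc !(act0l cs') addr0.
    have inj0 (z : HH) : vsval z = 0 -> z = 0.
      by move=> h; apply: subvs_inj; rewrite h [RHS]linear0.
    case: Ea => /inj0 -> /inj0 -> [/inj0 -> /inj0 ->] [/inj0 -> /inj0 ->].
    by [].
  have [|[[[a a'] [b b']] [c c']] Ew] := surjective_of_dim f_lin f_inj _ (w : (A * A)%type).
    change ((\dim H + \dim H + (\dim H + \dim H) + (\dim H + \dim H))%N = (dim A + dim A)%N).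
    by rewrite dimH -(dimvf A) dimA.
  exists (vsval b, vsval b'), (vsval c, vsval c'); split=> //.
  have {}Ew : w = ((vsval a, vsval a') : J) + (act cr' (vsval b, vsval b') x1
     + act cr' (vsval c, vsval c') (B cr' i6' pH' x1)) := Ew.
  rewrite Ew (subD sH') hW // vH2 addr0 in hw.
  by rewrite Ew hw add0r.
have hinv a : pH' a = a -> a <> 0 -> exists k, k * Nm' a = 1.
  by move=> _; apply: ext_Nm_unit.
have inp y : pH y = y -> pH' (ein y) = ein y by move=> hy; rewrite (ext_in_pH d sH) hy.
have ht1 := inp _ ht; have hv1 := inp _ hv; have ht1' := inp _ ht'.
pose jm' := gjm cr' tr' one' i6'.
have jin y z : jm' (ein y) (ein z) = ein (jm y z) := ext_in_jm d cs y z.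
have jgen : forall G : J -> Prop,
    (forall y z, G y -> G z -> G (y + z)) -> (forall k y, G y -> G (k *: y)) ->
    G one' -> G (ein t) -> G (jm' (ein t) (ein t)) -> G (ein v) ->
    G (jm' (ein v) (ein v)) -> G (jm' (ein t) (ein v)) ->
    G (jm' (jm' (ein t) (ein t)) (ein v)) -> G (jm' (ein t) (jm' (ein v) (ein v))) ->
    G (jm' (jm' (ein t) (ein t)) (jm' (ein v) (ein v))) -> forall z, pH' z = z -> G z.
  move=> G GD GZ; rewrite !jin => G1 G2 G3 G4 G5 G6 G7 G8 G9 z /ext_pH_id [hz1 hz2].
  have GE y : pH y = y -> G (ein y).
    apply: (gen (G := fun y => G (ein y))) => // [y1 y2|k y1] h.
      by move=> h'; rewrite (ext_inD d); apply: GD.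
    by rewrite (ext_inZ d); apply: GZ.
  rewrite [z]ext_split; apply: (GD); first exact: GE.
  by apply: (GZ); apply: GE.
pose km := km cr' i6' pH' x1 nV.
have kA := km_assoc cs' sH' hx1 Qx1 hn hdec ht1 hv1 jgen.
have k1r := km_one_r cs' sH' hx1 Qx1 hn hdec.
have k1l := km_one_l cs' sH' hx1 Qx1 hn hdec.
have kH y z : pH' (km y z) = km y z := inH_km i6' sH' x1 nV y z.
have kE := kE cs' sH' x1 nV; rewrite -/km in kA k1r k1l.
have root p : pH p = p -> jm p (jm p p) + al *: jm p p + be *: p + ga *: one = 0 ->
    km (ein p) (km (ein p) (ein p)) + qin al *: km (ein p) (ein p) + qin be *: ein p
      + qin ga *: one' = 0.
  move=> hp E1; rewrite /km !(km_sq cs' sH' hx1 Qx1 hn hdec) ?inp //.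
  rewrite (km_pow cs' sH' hx1 Qx1 hn hdec) ?inp // -/jm' !jin.
  by rewrite -!(ext_inZ d) -!(ext_inD d) E1.
have sep p : free3 p -> 3 *: jm' (ein p) (ein p) - (2 * gtr1 tr' one' (ein p)) *: ein p
    + (half i6' * Sq tr' one' (ein p) (ein p)) *: one' <> 0.
  move=> fp; have := free3_sep fp; rewrite jin /Sq !(ext_in_T d cs) !(ext_in_tr d cs).
  rewrite (quad_in_half d) => h E1; apply: h; move: E1.
  have -> : (3 : E) = 1 + 1 + 1 by ring.
  have -> : (2 : E) = 1 + 1 by ring.
  by move=> /(congr1 fst) /= E1; apply: (lin_comb 1 E1); mring.
have orth p y : orth3 p y -> [/\ pH' (ein y) = ein y, gtr1 tr' one' (ein y) = 0,
    tr' (ein p) (ein y) = 0 & tr' (jm' (ein p) (ein p)) (ein y) = 0].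
  move=> [hy Ty ty tty]; rewrite jin (ext_in_T d cs) !(ext_in_tr d cs) Ty ty tty.
  by split=> //; apply: inp.
have ein0 y : ein y = 0 -> y = 0 by case.
have [k /orth [hk Tk tk ttk] k0] := orth_t.
have [k' /orth [hk' Tk' tk' ttk'] k'0] := orth_t'.
have nz y : y <> 0 -> ein y <> 0 by move=> h /ein0.
have nc := km_noncomm cs' sH' hx1 Qx1 hn hdec ht1 hv1 jgen hinv ht1 hk (nz _ k0) (sep _ free_t) Tk tk ttk.
have nc' := km_noncomm cs' sH' hx1 Qx1 hn hdec ht1 hv1 jgen hinv ht1' hk' (nz _ k'0) (sep _ free_t') Tk' tk' ttk'.
have [g [hg g0] Eg] := skolem_noether cs' sH' hx1 Qx1 hn hdec ht1 hv1 jgen hinv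
  ht1 ht1' hk hk' (root _ ht root_t) (root _ ht' root_t') nc nc'.
rewrite -/km in Eg.
have cD := @ext_conjD K d A; have cZ := @ext_conjZ K d A; have cK := @ext_conjK K d A.
have ccr := ext_conj_cr (d := d) cs; have cpH := ext_conj_pH (d := d) sH.
have cin := @ext_conj_in K d A.
have [c [hc c0 Ec]] := iota_x1E cs' sH' hx1 Qx1 hn hdec ht1 hv1 jgen hinv cD ccr cpH cx1.
have ckm := iota_km cs' sH' hx1 Qx1 hn hdec ht1 hv1 jgen hinv cD ccr cpH hc c0 Ec.
have cu := iota_u cs' sH' hx1 cD cK ccr cpH hc Ec.
rewrite -/km in ckm.
have hcg : pH' (conj g) = conj g by rewrite -cpH hg.
(* u = n c is fixed by the conjugation, so u and its inverse come from H over K. *)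
pose u0 := (Nm' x1 *: c).1.
have Eu : Nm' x1 *: c = ein u0 := ext_fixed cs cu.
have hu0 : pH u0 = u0.
  have : pH' (Nm' x1 *: c) = Nm' x1 *: c by apply: (inHZ sH').
  by rewrite Eu (ext_in_pH d sH) => -[].
have u00 : u0 <> 0.
  move=> E0; apply: c0; rewrite -[c]scale1r -hn -scalerA Eu E0.
  by rewrite -[ein 0]/(0 : J) scaler0.
have Nu0 : Nm u0 != 0 by apply/eqP => /aniso.
pose w0 := (Nm u0)^-1 *: sharp u0.
have hw0 : pH w0 = w0 by apply: (inHZ sH); apply: (inH_sharp i6 sH).
have w00 : w0 <> 0.
  move=> /eqP; rewrite scaler_eq0 invr_eq0 (negPf Nu0) /= => /eqP.
  by move=> /(aniso_sharp cs aniso).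
have uw : km (ein u0) (ein w0) = one'.
  rewrite /w0 (ext_inZ d) -(ext_in_sharp d cs) /km !kE.
  rewrite (km_sharp cs' sH' hx1 Qx1 hn hdec (inp _ hu0)) (ext_in_Nm d cs) scalerA -quad_inM.
  by rewrite mulVf // scale1r.
have wu : km (ein w0) (ein u0) = one'.
  rewrite /w0 (ext_inZ d) -(ext_in_sharp d cs) /km !kE.
  rewrite (km_sharpl cs' sH' hx1 Qx1 hn hdec (inp _ hu0)) (ext_in_Nm d cs) scalerA -quad_inM.
  by rewrite mulVf // scale1r.
pose F m := km (ein m) g - km (conj g) (ein m).
have hF m : pH' (F m) = F m by apply: (inHD sH'); [|apply: (inHN sH')]; apply: kH.
(* For m over K the element m g - conj(g) m is skew under the conjugation, hence sqrt(d) times an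
   element of H. So [F] amounts to a K-linear endomorphism of H. *)
have F2 m : pH m = m -> F m = th *: ein (F m).2.
  move=> hm; have conjN (z : J) : conj (- z) = - conj z by congr pair.
  have : conj (F m) = - F m.
    by rewrite /F cD conjN !ckm ?inp // cK cin; mring.
  move: (F m) => [a b] [/eqP]; rewrite -subr_eq0 opprK -mulr2n -scaler_nat scaler_eq0.
  by rewrite (negPf h2K) => /eqP ->; congr pair; rewrite /=; mring.
have FP (a : K) y z : F (a *: y + z) = qin a *: F y + F z.
  by rewrite /F (ext_inD d) (ext_inZ d) /km !kE; mring.
have [m [mu [hm m0 Em]]] : exists m mu, [/\ pH m = m, m <> 0 & F m = mu *: ein w0].
  pose HH := subvs_of H; pose f (a : HH) : HH := vsproj H (F (vsval a)).2.
  have vH (a : HH) : pH (vsval a) = vsval a by apply/memH; apply: subvsP.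
  have Ff a : vsval (f a) = (F (vsval a)).2.
    by apply: vsprojK; apply/memH; have := hF (vsval a) => /ext_pH_id [].
  have f_lin (a : K) y z : f (a *: y + z) = a *: f y + f z.
    apply: subvs_inj; rewrite Ff.
    have -> : vsval (a *: y + z) = a *: vsval y + vsval z by [].
    have -> : vsval (a *: f y + f z) = a *: vsval (f y) + vsval (f z) by [].
    rewrite FP !Ff /=; mring.
  have [f' Ef'] := lfun_of_linear f_lin.
  (* If that endomorphism is injective it is onto and reaches u^-1, with mu = sqrt(d); otherwise a
     kernel element works with mu = 0. *)
  have [E0|n0] := eqVneq (lker f') 0%VS.
    have f_inj y : f y = 0 -> y = 0.
      by move=> E1; apply/eqP; rewrite -memv0 -E0 memv_ker Ef' E1.
    have [z Ez] := surjective_of_dim f_lin f_inj erefl (vsproj H w0).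
    exists (vsval z), th; split=> //.
      move=> z0; apply: w00; rewrite -(vsprojK (proj2 (memH w0) hw0)) Ez Ff z0.
      by have := FP (-1) 0 0; rewrite scaler0 addr0 => ->; rewrite /=; mring.
    by rewrite F2 // -Ff -Ez vsprojK //; apply/memH.
  exists (vsval (vpick (lker f'))), 0; split=> //.
    by move=> E1; move: n0; rewrite -vpick0 => /eqP; apply; apply: subvs_inj; rewrite E1 [RHS]linear0.
  rewrite F2 // -Ff scale0r; have := memv_pick (lker f'); rewrite memv_ker Ef' => /eqP ->.
  by congr pair; rewrite /=; mring.
rewrite /F in Em.
have iNm := ext_conj_Nm (d := d) cs.
have cone := @ext_conj_one K d A one.
have cqK := @quad_conjK K d.
rewrite -Eu in uw wu.
have [g'i [gi [y [yi []]]]] := hermitian_similarity cs' sH' hx1 Qx1 hn hdec ht1 hv1 jgen hinv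
  cD cZ cK ccr cpH cone iNm cqK hc c0 Ec hg g0 (inp _ hm) (nz _ m0) (cin m) (inp _ hw0) uw wu Em.
have [nu Dnu] : exists nu, nu = Nm' g * Nm' (conj g) by exists (Nm' g * Nm' (conj g)).
rewrite /= -Dnu => sN sfix.
pose s' := smap cr' i6' pH' x1 nV g (conj g) g'i gi y yi nu.
(* The map commutes with the conjugation on fixed points, so it descends to A. *)
pose s j := (s' (ein j)).1.
have sE j : s' (ein j) = ein (s j) by apply: (ext_fixed cs); apply: sfix; apply: cin.
have nu2 : nu.2 = 0 by rewrite Dnu iNm /=; ring.
have nu1 : nu.1 != 0.
  have [ka Ea] := hinv _ hg g0.
  have cg0 : conj g <> 0.
    by move=> E0; apply: g0; rewrite -(cK g) E0; congr pair; rewrite /= oppr0.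
  have [kb Eb] := hinv _ hcg cg0.
  have : (ka * kb) * nu = 1.
    by transitivity ((ka * Nm' g) * (kb * Nm' (conj g))); [rewrite Dnu; ring | rewrite Ea Eb mulr1].
  move/(congr1 fst) => /=; rewrite nu2 !mulr0 addr0 => E1.
  by apply/eqP => E0; move: E1; rewrite E0 mulr0 => /esym/eqP; rewrite oner_eq0.
have [zfix zcomm] := hermitian_square cs' sH' hx1 Qx1 hn hdec ht1 hv1 jgen hinv
  cD cK ccr cpH hc c0 Ec hg ht1 ht1' (cin t) (cin t') Eg.
rewrite -/km in zfix zcomm.
exists s, nu.1; split=> //.
- move=> a y1 y2; rewrite /s (ext_inD d) (ext_inZ d) /s' (smap_linear cs' sH') /=; mring.
- move=> j; have := sN (ein j); rewrite -/s' sE !(ext_in_Nm d cs) => /(congr1 fst) /= ->.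
  by rewrite mulr0 mulr0 addr0.
- move=> j hj; have E1 : s' (ein j) = km (km g (ein j)) (conj g).
    exact: (smap_H cs' sH' hx1 Qx1 hn _ _ _ _ _ _ _ (inp _ hj)).
  by have := kH (km g (ein j)) (conj g); rewrite -E1 sE (ext_in_pH d sH) => -[].
(* z commutes with t', so its part orthogonal to 1, t', t'^2 vanishes and z lies in K[t']. *)
pose z := km g (conj g); pose z0 := z.1.
have Ez : z = ein z0 := ext_fixed cs zfix.
have hz0 : pH z0 = z0.
  by have := kH g (conj g); rewrite -/z Ez (ext_in_pH d sH) => -[].
have [l [w [[l1 [l2 [l3 El]]] ow Ezl]]] := dec_t' hz0.
have [hw Tw tw ttw] := orth _ _ ow.
have w_0 : ein w = 0.
  apply: (km_commutant cs' sH' hx1 Qx1 hn hdec ht1 hv1 jgen hinv ht1' hw (sep _ free_t') Tw tw ttw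
    (a := qin l1) (b := qin l2) (c := qin l3) (z := z) _ zcomm).
  by rewrite -/jm' jin -!(ext_inZ d) -!(ext_inD d) -El -Ezl.
(* Multiplication by t' in the basis 1, t', t'^2, reduced by the cubic equation of t'. *)
have tstep a b c1 : km (ein t') (ein (a *: one + b *: t' + c1 *: jm t' t')) =
    ein ((- c1 * ga) *: one + (a - c1 * be) *: t' + (b - c1 * al) *: jm t' t').
  have F3 : jm t' (jm t' t') = - (al *: jm t' t' + be *: t' + ga *: one).
    by apply: (lin_comb 1 root_t'); mring.
  have G3 : km (ein t') (ein (jm t' t')) = ein (jm t' (jm t' t')).
    by rewrite -!jin; apply: (km_pow cs' sH' hx1 Qx1 hn hdec ht1').
  have G2 : km (ein t') (ein t') = ein (jm t' t').
    by rewrite -jin; apply: (km_sq cs' sH' hx1 Qx1 hn hdec ht1').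
  rewrite !(ext_inD d) !(ext_inZ d) /km !kE -/km k1r // G2 G3 F3.
  rewrite -!(ext_inZ d) -!(ext_inD d); congr ext_in; mring.
have Ez1 : z = ein (l1 *: one + l2 *: t' + l3 *: jm t' t').
  by rewrite Ez Ezl (ein0 _ w_0) addr0 El.
move=> j [a [b [c1 ->]]].
have E1 : ein (s (a *: one + b *: t + c1 *: jm t t)) =
    qin a *: z + qin b *: km (ein t') z + qin c1 *: km (ein t') (km (ein t') z).
  rewrite -sE !(ext_inD d) !(ext_inZ d) -jin.
  exact: (smap_cubic cs' sH' hx1 Qx1 hn hdec ht1 hv1 jgen _ _ _ _ _ _ _ _ _ ht1 ht1' hg Eg).
move: E1; rewrite Ez1 !tstep -!(ext_inZ d) -!(ext_inD d) => /(congr1 fst) /= ->.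
move: (- l3 * ga) (l1 - l3 * be) (l2 - l3 * al) => a1 a2 a3.
exists (a * l1 + b * a1 + c1 * (- a3 * ga)), (a * l2 + b * a2 + c1 * (a1 - a3 * be)),
  (a * l3 + b * a3 + c1 * (a2 - a3 * al)).
mring.
Qed.


End NonSplit.
End Similarity.

(** * Generators of cubic extensions and polarisation of the forms *)

Lemma cubic_field_generator (K : fieldType) (F : fieldExtType K) :
  \dim {:F} = 3%N -> exists z : F, exists al be ga : K,
  [/\ z * (z * z) + al *: (z * z) + be *: z + ga *: 1 = 0,
      forall a b c : K, a *: 1 + b *: z + c *: (z * z) = 0 ->
        [/\ a = 0, b = 0 & c = 0] &
      forall y, exists a b c : K, y = a *: 1 + b *: z + c *: (z * z)].
Proof.
move=> dF.
have : ~~ ({:F} <= 1)%VS.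
  by apply/negP => /dimvS; rewrite dF dimv1.
case/subvPn => z _ nz.
(* The degree of z divides the prime 3 and is not 1, as z lies outside K. *)
have dz : adjoin_degree 1%AS z = 3%N.
  have := field_dimS (subvf <<1; z>>%AS); rewrite dF dim_Fadjoin dimv1 muln1.
  rewrite dvdn_divisors // !inE => /orP [|/eqP //].
  by rewrite -[_ == _]/(adjoin_degree 1%AS z == 1%N) adjoin_deg_eq1 (negPf nz).
have free a b c : a *: 1 + b *: z + c *: (z * z) = 0 -> [/\ a = 0, b = 0 & c = 0].
  move=> E; pose p := Poly [:: a%:A; b%:A; c%:A] : {poly F}.
  have pK : p \is a polyOver 1%AS.
    apply/polyOverP => i; rewrite coef_Poly.
    by case: i => [|[|[|i]]] /=; rewrite ?nth_nil ?rpred0 ?rpredZ ?rpred1.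
  have rp : root p z.
    rewrite /root horner_Poly /= mul0r add0r mulr_algl mulrDl -scalerAl mulr_algl.
    by rewrite -E; apply/eqP; mring.
  have p0 : p = 0.
    apply/eqP; apply/negPn/negP => np.
    have := dvdp_leq np (minPoly_dvdp pK rp); rewrite size_minPoly dz.
    by rewrite leqNgt (leq_ltn_trans (size_Poly _)).
  have h i : p`_i = 0 by rewrite p0 coef0.
  have A0 (k : K) : k%:A = 0 :> F -> k = 0.
    by move/eqP; rewrite scaler_eq0 oner_eq0 orbF => /eqP.
  have := (h 0%N, h 1%N, h 2%N); rewrite !coef_Poly /= => -[[/A0 -> /A0 ->] /A0 ->].
  by [].
pose f (p : (K^o * K^o * K^o)%type) := p.1.1 *: 1 + p.1.2 *: z + p.2 *: (z * z).
have f_lin (k : K) x y : f (k *: x + y) = k *: f x + f y.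
  have sc (a : K^o) (w : F) : (k *: a) *: w = k *: ((a : K) *: w) by rewrite scalerA.
  by rewrite /f /= !scalerDl !sc; mring.
have f_inj x : f x = 0 -> x = 0.
  by case: x => -[a b] c E; have [Ea Eb Ec] := free a b c E; rewrite Ea Eb Ec.
have span y : exists a b c : K, y = a *: 1 + b *: z + c *: (z * z).
  have [|[[a b] c] ->] := surjective_of_dim f_lin f_inj _ y.
    by rewrite -[RHS](dimvf F) dF.
  by exists a, b, c.
have [a [b [c E]]] := span (z * (z * z)).
by exists z, (- c), (- b), (- a); split=> //; rewrite E; mring.
Qed.

Section Forms.
Variables (K : fieldType) (A : vectType K).
Local Notation co := (coord (vbasis {:A})).
Lemma linear_form_props (T : A -> K) : is_linear_form T ->
  (forall x y, T (x + y) = T x + T y) /\ (forall k x, T (k *: x) = k * T x).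
Proof.
move=> [c E]; split=> [x y|k x]; rewrite !E.
  by rewrite -big_split; apply: eq_bigr => i _; rewrite linearD mulrDr.
by rewrite mulr_sumr; apply: eq_bigr => i _; rewrite linearZ mulrCA.
Qed.

Lemma quadratic_form_props (S : A -> K) : is_quadratic_form S ->
  exists Sb : A -> A -> K, [/\ forall x, S x = Sb x x,
   forall x y z, Sb (x + y) z = Sb x z + Sb y z,
   forall x y z, Sb z (x + y) = Sb z x + Sb z y,
   forall k x z, Sb (k *: x) z = k * Sb x z &
   forall k x z, Sb z (k *: x) = k * Sb z x].
Proof.
move=> [c E]; exists (fun x y => \sum_i \sum_j c i j * co i x * co j y); split=> //.
- move=> x y z; rewrite -big_split; apply: eq_bigr => i _; rewrite -big_split.
  by apply: eq_bigr => j _; rewrite linearD /=; ring.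
- move=> x y z; rewrite -big_split; apply: eq_bigr => i _; rewrite -big_split.
  by apply: eq_bigr => j _; rewrite linearD /=; ring.
- move=> k x z; rewrite mulr_sumr; apply: eq_bigr => i _; rewrite mulr_sumr.
  by apply: eq_bigr => j _; rewrite linearZ /=; ring.
move=> k x z; rewrite mulr_sumr; apply: eq_bigr => i _; rewrite mulr_sumr.
by apply: eq_bigr => j _; rewrite linearZ /=; ring.
Qed.

Lemma cubic_form_props (N : A -> K) : is_cubic_form N ->
  exists Nb : A -> A -> A -> K, [/\ forall x, N x = Nb x x x,
   [/\ forall x y z w, Nb (x + y) z w = Nb x z w + Nb y z w,
   forall x y z w, Nb z (x + y) w = Nb z x w + Nb z y w &
   forall x y z w, Nb z w (x + y) = Nb z w x + Nb z w y],
   forall k x z w, Nb (k *: x) z w = k * Nb x z w,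
   forall k x z w, Nb z (k *: x) w = k * Nb z x w &
   forall k x z w, Nb z w (k *: x) = k * Nb z w x].
Proof.
move=> [c E].
exists (fun x y z => \sum_i \sum_j \sum_k c i j k * co i x * co j y * co k z).
split=> //; first split.
- move=> x y z w; do 3 (rewrite -big_split; apply: eq_bigr => ? _).
  by rewrite linearD /=; ring.
- move=> x y z w; do 3 (rewrite -big_split; apply: eq_bigr => ? _).
  by rewrite linearD /=; ring.
- move=> x y z w; do 3 (rewrite -big_split; apply: eq_bigr => ? _).
  by rewrite linearD /=; ring.
- move=> k x z w; do 3 (rewrite mulr_sumr; apply: eq_bigr => ? _).
  by rewrite linearZ /=; ring.
- move=> k x z w; do 3 (rewrite mulr_sumr; apply: eq_bigr => ? _).
  by rewrite linearZ /=; ring.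
move=> k x z w; do 3 (rewrite mulr_sumr; apply: eq_bigr => ? _).
by rewrite linearZ /=; ring.
Qed.
End Forms.

(** * Existence of the similarity, and the data of a cubic subfield *)

Section Carries.
Variables (K : fieldType) (A : vectType K).
Variables (cr : A -> A -> A) (tr : A -> A -> K) (one : A) (i6 : K).
Hypothesis cs : cubic_structure cr tr one i6.
Local Notation Nm := (Nm cr tr i6).
Local Notation jm := (jm cr tr one i6).
Hypothesis aniso : forall x, Nm x = 0 -> x = 0.
Hypothesis dimA : \dim {:A} = 27%N.

Lemma exists_notin (U : {vspace A}) : (\dim U < 27)%N -> exists x, x \notin U.
Proof.
move=> dU; have : ~~ ({:A} <= U)%VS.
  by apply/negP => /dimvS; rewrite dimA leqNgt dU.
by case/subvPn => x _ nx; exists x.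
Qed.

Section Extend.
Variables (H : {vspace A}) (pH : A -> A).
Hypothesis sH : cubic_sub cr tr one pH.
Hypothesis memH : forall x, x \in H <-> pH x = x.
Hypothesis dimH : \dim H = 9%N.
Variables t v : A.
Hypotheses (ht : pH t = t) (hv : pH v = v).
Hypothesis gen : forall G : A -> Prop,
  (forall x y, G x -> G y -> G (x + y)) -> (forall k x, G x -> G (k *: x)) ->
  G one -> G t -> G (jm t t) -> G v -> G (jm v v) ->
  G (jm t v) -> G (jm (jm t t) v) -> G (jm t (jm v v)) ->
  G (jm (jm t t) (jm v v)) -> forall z, pH z = z -> G z.
Variables (t' : A) (al be ga : K).
Hypothesis ht' : pH t' = t'.
Hypothesis root_t : jm t (jm t t) + al *: jm t t + be *: t + ga *: one = 0.
Hypothesis root_t' : jm t' (jm t' t') + al *: jm t' t' + be *: t' + ga *: one = 0.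
Hypotheses (free_t : free3 cr tr one i6 t) (free_t' : free3 cr tr one i6 t').
Hypothesis orth_t : exists2 k, orth3 cr tr one i6 pH t k & k <> 0.
Hypothesis orth_t' : exists2 k, orth3 cr tr one i6 pH t' k & k <> 0.
Hypothesis dec_t' : forall z, pH z = z -> exists l x,
  [/\ in3 cr tr one i6 t' l, orth3 cr tr one i6 pH t' x & z = l + x].

Lemma carries_exists : exists s nu, carries cr tr one i6 pH t t' s nu.
Proof.
have [y ny] : exists y, y \notin H by apply: exists_notin; rewrite dimH.
have hx := inW_sub sH y; set x := y - pH y in hx.
have x0 : x <> 0.
  move=> /eqP; rewrite subr_eq0 => /eqP E; move: ny => /negP; apply.
  by apply/memH; rewrite -E.
(* A quarter of the discriminant of X^2 - N(x) X + N(q(x)); whether it is a square decides between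
   the two cases. *)
pose d := (half i6 * Nm x) ^+ 2 - Nm (Q cr i6 pH x).
case: (classic (exists k, k ^+ 2 = d)) => [[k Ek]|nk]; last first.
  apply: (carries_nonsplit cs aniso sH memH dimA dimH ht hv gen ht' root_t root_t'
    free_t free_t' orth_t orth_t' dec_t' hx x0 (erefl d)) => k Ek.
  by apply: nk; exists k.
have he : (half i6 * Nm x + k) ^+ 2 - Nm x * (half i6 * Nm x + k) + Nm (Q cr i6 pH x) = 0.
  apply: (lin_comb_scal 1 Ek); rewrite /d.
  by apply: (lin_comb_scal (Nm x * (half i6 * Nm x + k)) (halfE cs)); ring.
have [x1 [hx1 x10 Qx1]] := isotropic_of_root cs aniso sH hx x0 he.
apply: (carries_split cs aniso sH memH dimA dimH ht hv gen ht' root_t root_t'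
    free_t free_t' orth_t orth_t' hx1 Qx1 (nV := (Nm x1)^-1)).
by rewrite mulVf //; apply/eqP => /aniso.
Qed.
End Extend.
End Carries.

Section CubicSubfield.
Variables (K : fieldType) (A : vectType K) (mul : A -> A -> A) (one : A).
Variables (F : fieldExtType K) (phi : F -> A) (L : {vspace A}).
Hypothesis hL : sep_cubic_subfield mul one phi L.
Variables (z : F) (al be ga : K).
Hypothesis root_z : z * (z * z) + al *: (z * z) + be *: z + ga *: 1 = 0.
Hypothesis free_z : forall a b c : K, a *: 1 + b *: z + c *: (z * z) = 0 ->
  [/\ a = 0, b = 0 & c = 0].
Hypothesis span_z : forall y, exists a b c : K, y = a *: 1 + b *: z + c *: (z * z).
Local Notation t := (phi z).

Lemma cubic_subfield_props :
  [/\ \dim L = 3%N, t \in L,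
      mul t (mul t t) + al *: mul t t + be *: t + ga *: one = 0,
      forall a b c, a *: one + b *: t + c *: mul t t = 0 -> [/\ a = 0, b = 0 & c = 0] &
      forall x, x \in L <-> exists a b c, x = a *: one + b *: t + c *: mul t t]
  /\ (one \in L /\ forall x y, x \in L -> y \in L -> mul x y \in L).
Proof.
have [[dF _] [phiP phi_inj] phi1 phiM memL] := hL.
have phi0 : phi 0 = 0.
  have := phiP (-1) 0 0; rewrite scaler0 addr0 scaleN1r => ->; exact: addNr.
have phiZ a x : phi (a *: x) = a *: phi x.
  by rewrite -[a *: x]addr0 phiP phi0 addr0.
have phiD x y : phi (x + y) = phi x + phi y by rewrite -[x]scale1r phiP !scale1r.
have comb a b c : phi (a *: 1 + b *: z + c *: (z * z)) = a *: one + b *: t + c *: mul t t.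
  by rewrite !phiD !phiZ phi1 phiM.
split; first split.
- have [U dU mU] := @image_of_linear K F A phi phiP (fun x E => phi_inj _ _ (etrans E (esym phi0))).
  have -> : L = U.
    by apply/vspaceP => x; apply/idP/idP => [/memL h|/mU h]; [apply/mU | apply/memL].
  by rewrite dU -dF dimvf.
- by apply/memL; exists z.
- by rewrite -!phiM -phi1 -!phiZ -!phiD root_z.
- by move=> a b c; rewrite -comb -phi0 => /phi_inj /free_z.
- move=> x; split=> [/memL [y ->]|[a [b [c ->]]]]; last by apply/memL; eexists; rewrite -comb.
  by have [a [b [c ->]]] := span_z y; exists a, b, c; rewrite comb.
split; first by apply/memL; exists 1.
by move=> x y /memL [x' ->] /memL [y' ->]; apply/memL; exists (x' * y'); rewrite phiM.
Qed.
End CubicSubfield.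

Unset Implicit Arguments.

Theorem mainTheorem14 (K : fieldType)
  (K_infinite : forall s : seq K, exists x : K, x \notin s)
  (K_char2 : 2%N \notin [pchar K]) (K_char3 : 3%N \notin [pchar K])
  (A : vectType K) (mul : A -> A -> A) (one : A) (N : A -> K)
  (hA : division_albert mul one N)
  (F : fieldExtType K) (phi phi' : F -> A) (L L' : {vspace A})
  (hL : sep_cubic_subfield mul one phi L)
  (hL' : sep_cubic_subfield mul one phi' L') :
  (exists B : {vspace A},
     [/\ is_subalgebra mul one B, \dim B = 9%N, (L <= B)%VS, (L' <= B)%VS &
         exists s : 'End(A),
           [/\ in_Str N s, (s @: B)%VS = B & (s @: L)%VS = L']])
  /\ (exists g : 'End(A), in_Str N g /\ (g @: L)%VS = L').
Proof.
suff main : exists B : {vspace A},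
     [/\ is_subalgebra mul one B, \dim B = 9%N, (L <= B)%VS, (L' <= B)%VS &
         exists s : 'End(A),
           [/\ in_Str N s, (s @: B)%VS = B & (s @: L)%VS = L']].
  by split=> //; have [B [_ _ _ _ [s [s1 _ s2]]]] := main; exists s.
have two0 : (2 : K) != 0 by move: K_char2; rewrite inE.
have three0 : (3 : K) != 0 by move: K_char3; rewrite inE.
have [[mulC mulP mul1 jordan] dimA [NF N1] [T [S [TF SF cay]]] aniso] := hA.
have [TD TZ] := linear_form_props TF.
have [Sb [SE SDl SDr SZl SZr]] := quadratic_form_props SF.
have [Nb [NE [ND1 ND2 ND3] NZ1 NZ2 NZ3]] := cubic_form_props NF.
have cay' x : mul x (mul x x) - T x *: mul x x + Sb x x *: x - Nb x x x *: one = 0.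
  by rewrite -SE -NE cay.
have N1' : Nb one one one = 1 by rewrite -NE.
have aniso' x : Nb x x x = 0 -> x = 0 by rewrite -NE; apply: aniso.
have dF : \dim {:F} = 3%N by case: hL => -[].
have [z [al [be [ga [rz fz sz]]]]] := cubic_field_generator dF.
have [[dL tL root_t free_t memL] [oneL mulL]] := cubic_subfield_props hL rz fz sz.
have [[dL' tL' root_t' free_t' memL'] [oneL' mulL']] := cubic_subfield_props hL' rz fz sz.
set t := phi z in tL root_t free_t memL; set t' := phi' z in tL' root_t' free_t' memL'.
have T1 : T one = 3.
  exact: (jordan_cubic_T1 two0 mulC mulP mul1 TD SDl SDr ND1 ND2 ND3 cay' free_t).
have cs := jordan_cubic_structure two0 three0 mulC mulP mul1 jordan TD TZ SDl SDr
  SZl SZr ND1 ND2 ND3 NZ1 NZ2 NZ3 cay' N1' aniso' T1.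
have NmN := jordan_cubic_norm two0 three0 mulC mulP mul1 jordan TD TZ SDl SDr
  SZl SZr ND1 ND2 ND3 NZ1 NZ2 NZ3 cay' N1' aniso' T1.
have jmM := jordan_cubic_jm two0 three0 mulC mulP mul1 jordan TD TZ SDl SDr
  SZl SZr ND1 ND2 ND3 NZ1 NZ2 NZ3 cay' N1' aniso' T1.
set cr := jordan_cross mul one T Sb in cs NmN jmM.
set tr := (fun x y : A => T (mul x y)) in cs NmN jmM.
set i6 := (6 : K)^-1 in cs NmN jmM.
have ani x : Nm cr tr i6 x = 0 -> x = 0 by rewrite NmN; apply: aniso'.
have crE x y : cr x y = 2 *: mul x y - T x *: y - T y *: x + S2 Sb x y *: one.
  exact: jordan_crossE.
have cr_closed (U : {vspace A}) : one \in U ->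
    (forall x y, x \in U -> y \in U -> mul x y \in U) ->
    forall x y, x \in U -> y \in U -> cr x y \in U.
  move=> h1 hm x y hx hy; rewrite crE.
  by rewrite !(memvN, memvD, memvZ, hm).
have jm_closed (U : {vspace A}) : one \in U ->
    (forall x y, x \in U -> y \in U -> cr x y \in U) ->
    forall x y, x \in U -> y \in U -> mul x y \in U.
  move=> h1 hc x y hx hy; rewrite -jmM jm_def; apply: rpredZ.
  by rewrite !(memvN, memvD, memvZ, hc).
have [pL [sL mL oL]] := orthogonal_projection cs ani oneL (cr_closed _ oneL mulL).
have [pL' [sL' mL' oL']] := orthogonal_projection cs ani oneL' (cr_closed _ oneL' mulL').
have Lspan x : x \in L -> exists a b c,
    x = a *: one + b *: t + c *: jm cr tr one i6 t t.
  by rewrite jmM => /memL.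
have [v [hv v0 t'v]] : exists v, [/\ pL v = 0, v <> 0 &
    exists2 l, l \in L & exists k : K, t' = l + k *: v].
  (* If t' already lies in L, any nonzero v orthogonal to L serves, with k = 0; otherwise v is the
     orthogonal component of t'. *)
  case: (t' - pL t' =P 0) => [E|nz].
    have [y ny] : exists y, y \notin L by apply: (exists_notin dimA); rewrite dL.
    exists (y - pL y); split; first exact: (inW_sub sL).
      by move=> /eqP; rewrite subr_eq0 => /eqP Ey; move: ny; rewrite -[_ \in _]/(y \in L) => /negP; apply; apply/mL.
    exists (pL t'); first by apply/mL; apply: (subK sL).
    by exists 0; apply: (lin_comb 1 E); mring.
  exists (t' - pL t'); split=> //; first exact: (inW_sub sL).
  exists (pL t'); first by apply/mL; apply: (subK sL).
  by exists 1; mring.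
have [H [dH LH vH crH genH]] := nine_dim_subalgebra cs ani dL Lspan sL mL tL hv v0.
have oneH : one \in H by apply: (subvP LH).
have mulH := jm_closed H oneH crH.
have [pH [sH mH oH]] := orthogonal_projection cs ani oneH crH.
have tH : t \in H by apply: (subvP LH).
have t'H : t' \in H.
  have [l hl [k ->]] := t'v.
  by apply: rpredD; [apply: (subvP LH) | apply: rpredZ].
have LH' : (L' <= H)%VS.
  apply/subvP => x /memL' [a [b [c ->]]].
  by rewrite !(memvD, memvZ, mulH).
have orth_of (M : {vspace A}) (pM : A -> A) p : cubic_sub cr tr one pM ->
    (forall x, x \in M <-> pM x = x) -> (M <= H)%VS -> one \in M -> p \in M ->
    mul p p \in M -> forall y, y \in H -> orth3 cr tr one i6 pH p (y - pM y).
  move=> sM mM MH hM1 hMp hMpp y hy; have hW := inW_sub sM y.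
  split.
  - by apply/mH; apply: rpredB => //; apply: (subvP MH); apply/mM; apply: (subK sM).
  - exact: (tr_WH cs sM hW (proj1 (mM _) hM1)).
  - by rewrite (tr_comm cs); apply: (tr_WH cs sM hW); apply/mM.
  by rewrite jmM (tr_comm cs); apply: (tr_WH cs sM hW); apply/mM.
have orth_ex (M : {vspace A}) (pM : A -> A) p : \dim M = 3%N -> cubic_sub cr tr one pM ->
    (forall x, x \in M <-> pM x = x) -> (M <= H)%VS -> one \in M -> p \in M ->
    mul p p \in M -> exists2 k, orth3 cr tr one i6 pH p k & k <> 0.
  move=> dM sM mM MH hM1 hMp hMpp.
  have /subvPn [y hy ny] : ~~ (H <= M)%VS by apply/negP => /dimvS; rewrite dH dM.
  exists (y - pM y); first exact: (orth_of M).
  by move=> /eqP; rewrite subr_eq0 => /eqP Ey; move: ny => /negP; apply; apply/mM.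
have gen' : forall G : A -> Prop,
  (forall x y, G x -> G y -> G (x + y)) -> (forall k x, G x -> G (k *: x)) ->
  G one -> G t -> G (jm cr tr one i6 t t) -> G v -> G (jm cr tr one i6 v v) ->
  G (jm cr tr one i6 t v) -> G (jm cr tr one i6 (jm cr tr one i6 t t) v) ->
  G (jm cr tr one i6 t (jm cr tr one i6 v v)) ->
  G (jm cr tr one i6 (jm cr tr one i6 t t) (jm cr tr one i6 v v)) ->
  forall z, pH z = z -> G z.
  by move=> G *; apply: (genH G) => //; apply/mH.
have rt : jm cr tr one i6 t (jm cr tr one i6 t t) + al *: jm cr tr one i6 t t
   + be *: t + ga *: one = 0 by rewrite !jmM.
have rt' : jm cr tr one i6 t' (jm cr tr one i6 t' t') + al *: jm cr tr one i6 t' t'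
   + be *: t' + ga *: one = 0 by rewrite !jmM.
have fr : free3 cr tr one i6 t by move=> a b c; rewrite jmM; apply: free_t.
have fr' : free3 cr tr one i6 t' by move=> a b c; rewrite jmM; apply: free_t'.
have dec x : pH x = x -> exists l y,
    [/\ in3 cr tr one i6 t' l, orth3 cr tr one i6 pH t' y & x = l + y].
  move=> /mH hx; exists (pL' x), (x - pL' x); split; last by mring.
    by rewrite /in3 jmM; apply/memL'; apply/mL'; apply: (subK sL').
  by apply: (orth_of L') => //; apply: mulL'.
have [s [nu [s_lin nu0 sN sH' sL2]]] := carries_exists cs ani dimA sH mH dH
  (proj1 (mH _) tH) (proj1 (mH _) vH) gen' (proj1 (mH _) t'H) rt rt' fr fr'
  (orth_ex L pL t dL sL mL LH oneL tL (mulL _ _ tL tL))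
  (orth_ex L' pL' t' dL' sL' mL' LH' oneL' tL' (mulL' _ _ tL' tL')) dec.
have [g Eg] := lfun_of_linear s_lin.
have gN a : N (g a) = nu * N a by rewrite Eg !NE -!NmN.
have kg : lker g = 0%VS.
  apply/eqP; rewrite -subv0; apply/subvP => x; rewrite memv_ker memv0 => /eqP E0.
  apply/eqP/aniso; have := gN x.
  have N0 : N 0 = 0 by rewrite NE -(scale0r 0) NZ1 mul0r.
  by rewrite E0 N0 => /esym/eqP; rewrite mulf_eq0 (negPf nu0) => /eqP.
(* Anisotropy and the nonzero multiplier make g injective, so an inclusion between spaces of equal
   dimension becomes an equality. *)
have imE (U V : {vspace A}) : \dim U = \dim V -> (g @: U <= V)%VS -> (g @: U)%VS = V.
  move=> dUV gUV; apply/eqP; rewrite eqEdim gUV -dUV limg_dim_eq /= ?leqnn //.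
  by rewrite kg capv0.
exists H; split=> //; exists g; split.
- split; last by exists nu.
  exists (g^-1)%VF; first by apply: lker0_lfunK; rewrite kg.
  by apply: lker0_lfunVK; rewrite kg.
- apply: imE => //; apply/subvP => _ /memv_imgP [x hx ->]; rewrite Eg.
  by apply/mH; apply: sH'; apply/mH.
apply: imE; first by rewrite dL dL'.
apply/subvP => _ /memv_imgP [x hx ->]; rewrite Eg; apply/memL'.
have := sL2 x; rewrite /in3 !jmM => h.
by have [] := h (proj1 (memL x) hx) => a [b [c ->]]; exists a, b, c.
Qed.
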